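(* Consider a discrete memoryless MARC or MABRC with channel law $p(y_3,y|x_1,x_2,x_3)$, correlated sources $(S_1,S_2)$, relay side information $W_3$ and receiver side information $W$ with joint law $p(s_1,s_2,w_3,w)$, and let the source pair $(S_1,S_2)$ have common part $T\triangleq h_1(S_1)=h_2(S_2)$. The source-channel rate $\kappa=1$ is achievable (for the MARC, and also for the MABRC) if $$\begin{aligned} H(S_1|S_2,W_3) &< I(X_1;Y_3|S_2,V_1,X_2,X_3,W_3,Q),\\ H(S_2|S_1,W_3) &< I(X_2;Y_3|S_1,V_2,X_1,X_3,W_3,Q),\\ H(S_1,S_2|W_3,T) &< I(X_1,X_2;Y_3|V_1,V_2,X_3,W_3,T,Q),\\ H(S_1,S_2|W_3) &< I(X_1,X_2;Y_3|V_1,V_2,X_3,W_3),\\ H(S_1|S_2,W) &< I(X_1,X_3;Y|S_1,V_2,X_2,Q),\\ H(S_2|S_1,W) &< I(X_2,X_3;Y|S_2,V_1,X_1,Q),\\ H(S_1,S_2|W) &< I(X_1,X_2,X_3;Y|S_1,S_2,Q), \end{aligned}$$ for some joint distribution (with auxiliary random variables $Q,V_1,V_2$ on finite alphabets) that factorizes as $$p(s_1,s_2,w_3,w)\,p(q)\,p(v_1)\,p(x_1|s_1,v_1,q)\,p(v_2)\,p(x_2|s_2,v_2,q)\,p(x_3|v_1,v_2)\,p(y_3,y|x_1,x_2,x_3).$$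
   Context: Sources and side information. $\{(S_{1,k},S_{2,k},W_k,W_{3,k})\}_{k\ge 1}$ are i.i.d. across $k$ with joint law $p(s_1,s_2,w,w_3)$ on a finite alphabet $\mathcal S_1\times\mathcal S_2\times\mathcal W\times\mathcal W_3$, known to all nodes. Transmitter $i$ ($i=1,2$) observes $S_i^m$, the relay observes side information $W_3^m$, the receiver (destination) observes side information $W^m$. The common part $T$ of $(S_1,S_2)$ is the common information in the sense of G\'acs, K\''orner and Witsenhausen: $T=h_1(S_1)=h_2(S_2)$, where $h_1,h_2$ are deterministic functions. Channel. The discrete memoryless multiple-access relay channel (MARC) has finite input alphabets $\mathcal X_1,\mathcal X_2,\mathcal X_3$ (transmitter 1, transmitter 2, relay), finite output alphabets $\mathcal Y$ (receiver), $\mathcal Y_3$ (relay), and is memoryless: for each $k=1,\dots,n$, the conditional law of $(Y_k,Y_{3,k})$ given all sources, side informations, inputs up to time $k$ and outputs up to time $k-1$ equals $p(y_k,y_{3,k}|x_{1,k},x_{2,k},x_{3,k})$. Codes. An $(m,n)$ source-channel code for the multiple-access broadcast relay channel (MABRC) consists of encoders $f_i^{(m,n)}:\mathcal S_i^m\to\mathcal X_i^n$, $i=1,2$; causal relay encoders with $x_{3,k}=f_{3,k}^{(m,n)}(y_{3,1}^{k-1},w_3^m)$, $1\le k\le n$; a receiver decoder $g^{(m,n)}:\mathcal Y^n\times\mathcal W^m\to\mathcal S_1^m\times\mathcal S_2^m$ with output $(\hat S_1^m,\hat S_2^m)$; and a relay decoder $g_3^{(m,n)}:\mathcal Y_3^n\times\mathcal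 W_3^m\to\mathcal S_1^m\times\mathcal S_2^m$ with output $(\tilde S_1^m,\tilde S_2^m)$. A code for the MARC is the same without the relay decoder $g_3^{(m,n)}$. Error probability. MABRC: $P_e^{(m,n)}=\Pr\big\{\{(\hat S_1^m,\hat S_2^m)\ne(S_1^m,S_2^m)\}\cup\{(\tilde S_1^m,\tilde S_2^m)\neq(S_1^m,S_2^m)\}\big\}$. MARC: $P_e^{(m,n)}=\Pr\{(\hat S_1^m,\hat S_2^m)\ne(S_1^m,S_2^m)\}$. Achievability. A source-channel rate $\kappa$ is achievable if for every $\epsilon>0$ there is $m_0$ such that for all $m>m_0$, with $n=\lfloor\kappa m\rfloor$, there exists an $(m,n)$ code with $P_e^{(m,n)}<\epsilon$. *)

(* Defs.v *)
From HB Require Import structures.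
From mathcomp Require Import all_boot all_order all_algebra.
From mathcomp Require Import reals exp.

(* MathComp / MathComp-Analysis, over an arbitrary [R : realType]. *)

Set Implicit Arguments.
Unset Strict Implicit.
Unset Printing Implicit Defensive.

Import Order.TTheory GRing.Theory Num.Theory.

Local Open Scope ring_scope.

Record fdist (R : realType) (A : finType) := FDist {
  fdist_fun :> {ffun A -> R};
  fdist_ge0 : forall a, 0 <= fdist_fun a;
  fdist_sum1 : \sum_a fdist_fun a = 1 }.

(* A random variable on the finite probability space [(Omega, P)] is a plain
   function on [Omega]; a tuple of random variables is again a random variable,
   with values in a left-nested product. *)
Definition rv_pair (Omega A B : Type) (X : Omega -> A) (Y : Omega -> B) :
  Omega -> A * B := fun o => (X o, Y o).

Notation "[% X , Y , .. , Z ]" := (rv_pair .. (rv_pair X Y) .. Z)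
  (at level 0, format "[%  X ,  Y ,  .. ,  Z ]").

Section Information.
Context (R : realType) (Omega : finType) (P : fdist R Omega).

Definition law (A : finType) (X : Omega -> A) (a : A) : R :=
  \sum_(o | X o == a) P o.

(* Base 2, so that information is in bits. The convention 0 log 0 = 0 holds in
   the formulas below because [ln] is total and every logarithm is multiplied by
   a probability that vanishes whenever its argument degenerates. *)
Definition log2 (x : R) : R := ln x / ln 2.

Definition entropy (A : finType) (X : Omega -> A) : R :=
  - \sum_a law X a * log2 (law X a).

(* H(X | Y) *)
Definition cond_entropy (A B : finType) (X : Omega -> A) (Y : Omega -> B) : R :=
  - \sum_a \sum_b law [% X, Y] (a, b) * log2 (law [% X, Y] (a, b) / law Y b).

(* I(X ; Y | Z) *)
Definition cond_mutual_info (A B C : finType)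
    (X : Omega -> A) (Y : Omega -> B) (Z : Omega -> C) : R :=
  cond_entropy X Z - cond_entropy X [% Y, Z].

Definition common_function (A B U : finType) (X : Omega -> A) (Y : Omega -> B)
    (f : A -> U) (g : B -> U) : Prop :=
  forall o, 0 < P o -> f (X o) = g (Y o).

(* The common part of Gacs, Korner and Witsenhausen: [f X = g Y] almost surely,
   and it has the largest entropy among all such common functions. *)
Definition common_part (A B T : finType) (X : Omega -> A) (Y : Omega -> B)
    (f : A -> T) (g : B -> T) : Prop :=
  common_function X Y f g /\
  forall (U : finType) (f' : A -> U) (g' : B -> U),
    common_function X Y f' g' -> entropy (f' \o X) <= entropy (f \o X).

End Information.

Section Coding.
Context (R : realType).
Context (aS1 aS2 aW aW3 aX1 aX2 aX3 aY aY3 : finType).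

(* Time instants are numbered from 0, so [past k y] lists the [k] symbols
   strictly before instant [k]. *)
Definition past (A : Type) (n : nat) (k : 'I_n) (y : n.-tuple A) : k.-tuple A :=
  [tuple tnth y (widen_ord (ltnW (ltn_ord k)) j) | j < k].

Record marc_code (m n : nat) := MarcCode {
  enc1 : m.-tuple aS1 -> n.-tuple aX1;
  enc2 : m.-tuple aS2 -> n.-tuple aX2;
  relay_enc : forall k : 'I_n, k.-tuple aY3 -> m.-tuple aW3 -> aX3;
  dec : n.-tuple aY -> m.-tuple aW -> m.-tuple aS1 * m.-tuple aS2 }.

Record mabrc_code (m n : nat) := MabrcCode {
  mabrc_marc :> marc_code m n;
  relay_dec : n.-tuple aY3 -> m.-tuple aW3 -> m.-tuple aS1 * m.-tuple aS2 }.

Definition block_outcome (m n : nat) : finType :=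
  (m.-tuple aS1 * m.-tuple aS2 * m.-tuple aW * m.-tuple aW3
   * n.-tuple aY * n.-tuple aY3)%type.

Context (src : fdist R (aS1 * aS2 * aW * aW3)%type)
        (ch : aX1 -> aX2 -> aX3 -> fdist R (aY * aY3)%type).

(* The joint probability of (s1^m, s2^m, w^m, w3^m, y^n, y3^n): by the chain
   rule, an i.i.d. source and a channel that is memoryless given the whole past
   contribute one factor per source letter and one per channel use, the inputs
   being functions of the sources, side information and past relay outputs. *)
Definition block_law (m n : nat) (c : marc_code m n)
    (o : block_outcome m n) : R :=
  let: (s1, s2, w, w3, y, y3) := o in
  (\prod_(i < m) src (tnth s1 i, tnth s2 i, tnth w i, tnth w3 i)) *
  (\prod_(k < n) ch (tnth (enc1 c s1) k) (tnth (enc2 c s2) k)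
                    (relay_enc c (past k y3) w3) (tnth y k, tnth y3 k)).

Definition dest_error (m n : nat) (c : marc_code m n)
    (o : block_outcome m n) : bool :=
  let: (s1, s2, w, w3, y, y3) := o in dec c y w != (s1, s2).

Definition relay_error (m n : nat) (c : mabrc_code m n)
    (o : block_outcome m n) : bool :=
  let: (s1, s2, w, w3, y, y3) := o in relay_dec c y3 w3 != (s1, s2).

Definition marc_Pe (m n : nat) (c : marc_code m n) : R :=
  \sum_(o | dest_error c o) block_law c o.

Definition mabrc_Pe (m n : nat) (c : mabrc_code m n) : R :=
  \sum_(o | dest_error c o || relay_error c o) block_law c o.

(* [Num.truncn] is the floor, as a natural number, of a nonnegative real. *)
Definition marc_achievable (kappa : R) : Prop :=
  forall eps : R, 0 < eps -> exists m0 : nat, forall m : nat, (m0 < m)%N ->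
  exists c : marc_code m (Num.truncn (kappa * m%:R)), marc_Pe c < eps.

Definition mabrc_achievable (kappa : R) : Prop :=
  forall eps : R, 0 < eps -> exists m0 : nat, forall m : nat, (m0 < m)%N ->
  exists c : mabrc_code m (Num.truncn (kappa * m%:R)), mabrc_Pe c < eps.

End Coding.

(* Main.v *)
(* Block Markov coding with correlation-preserving random codewords: in each
   block the codeword of transmitter 1 is drawn letterwise from
   [p(x1 | s1, v1, q)], where [v1] is a codeword for its previous source block
   and [q] one for the current common part; transmitter 2 is symmetric, and the
   relay repeats its estimate of the previous pair through [x3(v1, v2)].  The
   relay decodes forwards, the destination backwards.

   Decoders accept a candidate when the conditional law of its redrawn
   components, given everything else and the output, exceeds [rho ^- N] times
   the probability with which the codebook drew them.  Summing the coding
   probability over the accepted candidates then gives at most [rho ^+ N]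
   because conditional laws sum to 1, and the true words pass except with
   exponentially small probability (Chernoff) because the expected logarithm of
   the ratio is at least (mutual information - source entropy), by Gibbs'
   inequality.

   Block Markov coding spends one more channel block than there are data blocks,
   so with one source letter per channel use it would only give [kappa > 1].
   The value [kappa = 1] is reached because the strict inequalities leave room for each
   block to carry [(K + 1) L] source letters in [K L] channel uses, the codeword
   laws using only the first [K L] letters. *)
From HB Require Import structures.
From mathcomp Require Import all_boot all_order all_algebra.
From mathcomp Require Import reals sequences exp.
From mathcomp Require Import ring lra zify.
Require Import Defs.

Set Implicit Arguments.
Unset Strict Implicit.
Unset Printing Implicit Defensive.

Import Order.TTheory GRing.Theory Num.Theory.
Local Open Scope ring_scope.

(** * Expectations and product laws on finite types *)

Section Expectation.
Context {R : realType}.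

(** Two feedback effects have to be removed. Errors propagate from block to block, and the relay
    feeds its own errors back into the channel. Both are handled by comparison with a system whose
    decoders and relay are told the true neighbouring block: while those decoders make no error, the
    actual code behaves in the same way.

    The blocks are arranged in a cycle whose last member holds only filler letters known to all. The
    filler is drawn from the source law and fixed at the very end, so every block has the same joint
    law with its predecessor and one single-block bound serves for all.

    The codebook is indexed by whole source blocks. Blocks that differ only in letters which no
    codeword law uses still get separately drawn codewords; the price is a factor [#|aS1| * #|aS2|]
    per surplus letter in the number of candidates, which [K] covered letters absorb because
    [rho ^+ K] is small.

    At the relay, source letter and channel output belong to the same block and form one conditional
    law. At the destination the source term concerns the previous block and the channel term the
    current one, so a test is a product of two factors whose mean logarithms add. *)

Definition Ex (A : finType) (p : fdist R A) (f : A -> R) : R := \sum_a p a * f a.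

Lemma eq_Ex (A : finType) (p : fdist R A) (f g : A -> R) :
  (forall a, 0 < p a -> f a = g a) -> Ex p f = Ex p g.
Proof.
move=> fg; apply: eq_bigr => a _; have := fdist_ge0 p a.
by rewrite le_eqVlt => /orP[/eqP<-|/fg->//]; rewrite !mul0r.
Qed.

Lemma le_Ex (A : finType) (p : fdist R A) (f g : A -> R) :
  (forall a, 0 < p a -> f a <= g a) -> Ex p f <= Ex p g.
Proof.
move=> fg; apply: ler_sum => a _; have := fdist_ge0 p a.
by rewrite le_eqVlt => /orP[/eqP<-|/[dup] /fg ? ?]; rewrite ?mul0r ?ler_pM2l.
Qed.

Lemma Ex_cst (A : finType) (p : fdist R A) (c : R) : Ex p (fun _ => c) = c.
Proof. by rewrite /Ex -mulr_suml fdist_sum1 mul1r. Qed.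

Lemma Ex_eq_cst (A : finType) (p : fdist R A) (f : A -> R) (c : R) :
  (forall a, f a = c) -> Ex p f = c.
Proof. by move=> fc; rewrite -[RHS](Ex_cst p); apply: eq_Ex. Qed.

Lemma Ex_eq0 (A : finType) (p : fdist R A) (f : A -> R) :
  (forall a, 0 < p a -> f a = 0) -> Ex p f = 0.
Proof. by move=> f0; rewrite (eq_Ex f0) Ex_cst. Qed.

Lemma Ex_le (A : finType) (p : fdist R A) (f : A -> R) (c : R) :
  (forall a, 0 < p a -> f a <= c) -> Ex p f <= c.
Proof. by move=> fc; rewrite -[leRHS](Ex_cst p); apply: le_Ex. Qed.

Lemma Ex_ge0 (A : finType) (p : fdist R A) (f : A -> R) :
  (forall a, 0 <= f a) -> 0 <= Ex p f.
Proof. by move=> f0; apply: sumr_ge0 => a _; rewrite mulr_ge0 ?fdist_ge0. Qed.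

Lemma ExD (A : finType) (p : fdist R A) (f g : A -> R) :
  Ex p (fun a => f a + g a) = Ex p f + Ex p g.
Proof. by rewrite /Ex -big_split; apply: eq_bigr => a _; rewrite mulrDr. Qed.

Lemma sum_pair (A B : finType) (f : A * B -> R) :
  \sum_u f u = \sum_a \sum_b f (a, b).
Proof. by rewrite pair_bigA /=; apply: eq_bigr => -[]. Qed.

Lemma ExN (A : finType) (p : fdist R A) (f : A -> R) :
  Ex p (fun a => - f a) = - Ex p f.
Proof. by rewrite /Ex -sumrN; apply: eq_bigr => a _; rewrite mulrN. Qed.

Lemma Ex_sum (A I : finType) (p : fdist R A) (P : pred I) (f : I -> A -> R) :
  Ex p (fun a => \sum_(i | P i) f i a) = \sum_(i | P i) Ex p (f i).
Proof. by rewrite exchange_big; apply: eq_bigr => a _; rewrite mulr_sumr. Qed.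

Lemma ExZl (A : finType) (p : fdist R A) (c : R) (f : A -> R) :
  Ex p (fun a => c * f a) = c * Ex p f.
Proof. by rewrite /Ex mulr_sumr; apply: eq_bigr => a _; rewrite mulrCA. Qed.

Lemma Ex_exchange (A B : finType) (p : fdist R A) (q : fdist R B) (f : A -> B -> R) :
  Ex p (fun a => Ex q (f a)) = Ex q (fun b => Ex p (f^~ b)).
Proof.
rewrite [RHS]/Ex; under [RHS]eq_bigr do rewrite -ExZl.
by rewrite -Ex_sum.
Qed.

Lemma Ex_exists (A : finType) (p : fdist R A) (f : A -> R) (c : R) :
  Ex p f < c -> exists a, f a < c.
Proof.
move=> fc; case: (boolP [exists a, f a < c]) => [/existsP[a fa]|/existsPn nf]; first by exists a.
have : Ex p (fun _ => c) <= Ex p f by apply: le_Ex => a _; rewrite leNgt nf.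
by rewrite Ex_cst leNgt fc.
Qed.

Lemma dirac_ge0 (A : finType) (a0 a : A) : 0 <= [ffun x => (x == a0)%:R] a :> R.
Proof. by rewrite ffunE ler0n. Qed.

Lemma dirac_sum1 (A : finType) (a0 : A) : \sum_a [ffun x => (x == a0)%:R] a = 1 :> R.
Proof.
under eq_bigr do rewrite ffunE.
by rewrite (bigD1 a0) //= eqxx big1 ?addr0 // => a /negbTE->.
Qed.

Definition dirac (A : finType) (a0 : A) : fdist R A :=
  FDist (dirac_ge0 a0) (dirac_sum1 a0).

Lemma Ex_dirac (A : finType) (a0 : A) (f : A -> R) : Ex (dirac a0) f = f a0.
Proof.
rewrite /Ex (bigD1 a0) //= ffunE eqxx mul1r big1 ?addr0 // => a /negbTE aa0.
by rewrite ffunE aa0 mul0r.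
Qed.

Lemma sum_pred_le (I : finType) (P P' : pred I) (f : I -> R) :
  (forall i, 0 <= f i) -> (forall i, P i -> P' i) ->
  \sum_(i | P i) f i <= \sum_(i | P' i) f i.
Proof.
move=> f0 PP'; rewrite [leLHS]big_mkcond [leRHS]big_mkcond; apply: ler_sum => i _.
by case: ifP => [/PP'->//|_]; case: ifP.
Qed.

Lemma mul_ExE (A : finType) (p : fdist R A) (c : R) (f : A -> R) :
  c * Ex p f = \sum_a c * p a * f a.
Proof. by rewrite mulr_sumr; apply: eq_bigr => a _; rewrite mulrA. Qed.

Lemma fdist_sum_mul (A : finType) (p : fdist R A) (c : R) :
  \sum_a c * p a = c.
Proof. by rewrite -mulr_sumr fdist_sum1 mulr1. Qed.

Lemma exists_expr_lt (x e : R) : 0 < x < 1 -> 0 < e ->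
  exists k0, forall k, (k0 <= k)%N -> x ^+ k < e.
Proof.
move=> /andP[x0 x1] e0; have lx : ln x < 0 by rewrite ln_lt0 ?x0.
exists (Num.bound (`|ln e / ln x|)) => k k0k.
apply: le_lt_trans (_ : x ^+ Num.bound (`|ln e / ln x|) < e).
  by apply: ler_wiXn2l => //; exact: ltW.
have kx := archi_boundP (normr_ge0 (ln e / ln x)).
have {}kx := le_lt_trans (ler_norm _) kx.
move: (Num.bound _) kx => b kx.
rewrite -(lnK (x := x)) ?posrE // -(expRM_natr) -[ltRHS]lnK ?posrE // ltr_expR.
by rewrite -[ltRHS](divfK (ltr0_neq0 lx)) [ltRHS]mulrC ltr_nM2l.
Qed.

Lemma negb_and_le (a b : bool) : (~~ (a && b))%:R <= (~~ a)%:R + (~~ b)%:R :> R.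
Proof. by case: a; case: b => /=; rewrite ?addr0 ?add0r //= lerDl. Qed.

Lemma odflt_pick_wrong (A : finType) (P : pred A) (a0 a : A) :
  odflt a0 [pick c | P c] != a -> ~~ P a \/ exists2 c, c != a & P c.
Proof.
case: pickP => [c Pc /= ca|nP _]; first by right; exists c.
by left; rewrite nP.
Qed.

End Expectation.

(** * Product laws: tables with independent entries *)

Section ProductLaw.
Context {R : realType}.

Definition tab_fun (J A : finType) (p : J -> fdist R A) : {ffun {ffun J -> A} -> R} :=
  [ffun c : {ffun J -> A} => \prod_j p j (c j)].

Lemma tab_ge0 (J A : finType) (p : J -> fdist R A) c : 0 <= tab_fun p c.
Proof. by rewrite ffunE prodr_ge0 // => j _; apply: fdist_ge0. Qed.

Lemma tab_sum1 (J A : finType) (p : J -> fdist R A) : \sum_c tab_fun p c = 1.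
Proof.
under eq_bigr do rewrite ffunE.
by rewrite -(bigA_distr_bigA (fun j a => p j a)) big1 // => j _; apply: fdist_sum1.
Qed.

(** One construction for three purposes: the random tables of a codebook, i.i.d. source blocks, and
    memoryless channel outputs. *)
Definition tab (J A : finType) (p : J -> fdist R A) : fdist R {ffun J -> A} :=
  FDist (tab_ge0 p) (tab_sum1 p).

Lemma tabE (J A : finType) (p : J -> fdist R A) (c : {ffun J -> A}) : tab p c = \prod_j p j (c j).
Proof. by rewrite /tab /= ffunE. Qed.

Lemma tab_gt0 (J A : finType) (p : J -> fdist R A) (c : {ffun J -> A}) :
  0 < tab p c -> forall j, 0 < p j (c j).
Proof.
move=> c0 j; rewrite lt_neqAle fdist_ge0 andbT eq_sym.
by apply: contraTneq c0; rewrite tabE (bigD1 j) //= => ->; rewrite mul0r ltxx.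
Qed.

Lemma Ex_tab_prod (J A : finType) (p : J -> fdist R A) (g : J -> A -> R) :
  Ex (tab p) (fun c : {ffun J -> A} => \prod_j g j (c j)) = \prod_j Ex (p j) (g j).
Proof.
by rewrite bigA_distr_bigA; apply: eq_bigr => c _; rewrite tabE -big_split.
Qed.

(** Grouping functions by their restriction along [phi] turns each group into a product set, on
    which the sum of a product factors. When [p] is a family of laws, the coordinates outside the
    image contribute 1; when [p] is constantly 1, they count free values. *)
Lemma sum_ffun_sub (K J A : finType) (phi : K -> J) (p : J -> A -> R)
    (g : {ffun K -> A} -> R) : injective phi ->
  \sum_(c : {ffun J -> A}) (\prod_j p j (c j)) * g [ffun k => c (phi k)] =
  (\prod_(j | j \notin codom phi) \sum_a p j a) *
  \sum_(d : {ffun K -> A}) (\prod_k p (phi k) (d k)) * g d.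
Proof.
move=> phiI.
rewrite (partition_big (fun c : {ffun J -> A} => [ffun k => c (phi k)]) predT) //=.
rewrite mulr_sumr; apply: eq_bigr => d _.
rewrite (eq_bigr (fun c : {ffun J -> A} => (\prod_j p j (c j)) * g d)); last first.
  by move=> c /eqP h; rewrite h.
rewrite -mulr_suml mulrA; congr (_ * _).
pose Q j a := [forall k, (phi k == j) ==> (a == d k)].
rewrite (eq_bigl (fun c : {ffun J -> A} => c \in family Q)); last first.
  move=> c; apply/eqP/familyP => [h j|cQ].
    by apply/forallP => k; apply/implyP => /eqP kj; rewrite -h ffunE kj.
  apply/ffunP => k; rewrite ffunE; have /forallP/(_ k) := cQ (phi k).
  by rewrite eqxx => /eqP.
rewrite -bigA_distr_big_dep /= (bigID (mem (codom phi))) /= mulrC.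
congr (_ * _).
  apply: eq_bigr => j jphi; apply: eq_bigl => a; apply/forallP => k.
  by apply/implyP => /eqP kj; rewrite -kj codom_f in jphi.
rewrite -big_uniq /=; last by rewrite map_inj_uniq ?enum_uniq.
rewrite big_map big_enum /=; apply: eq_bigr => k _.
apply: big_pred1 => a; apply/forallP/eqP => [/(_ k)|-> k'].
  by rewrite eqxx => /eqP.
by apply/implyP => /eqP/phiI->.
Qed.

Lemma Ex_tab_sub (K J A : finType) (phi : K -> J) (p : J -> fdist R A)
    (g : {ffun K -> A} -> R) : injective phi ->
  Ex (tab p) (fun c : {ffun J -> A} => g [ffun k => c (phi k)]) = Ex (tab (p \o phi)) g.
Proof.
move=> phiI; rewrite /Ex.
under eq_bigr do rewrite tabE.
rewrite (sum_ffun_sub p g phiI) big1 ?mul1r; last by move=> j _; apply: fdist_sum1.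
by under [RHS]eq_bigr do rewrite tabE.
Qed.

Lemma Ex_tab1 (J A : finType) (p : J -> fdist R A) (j : J) (f : A -> R) :
  Ex (tab p) (fun c : {ffun J -> A} => f (c j)) = Ex (p j) f.
Proof.
have I : injective (fun _ : unit => j) by move=> [] [].
rewrite -(eq_Ex (f := fun c : {ffun J -> A} => f ([ffun k : unit => c j] tt))); last first.
  by move=> c _; rewrite ffunE.
rewrite (Ex_tab_sub p (fun d => f (d tt)) I) /Ex (reindex (fun a => [ffun _ : unit => a])) /=.
  by apply: eq_bigr => a _; rewrite tabE (big_pred1 tt) ?ffunE //; case.
exists (fun d : {ffun unit -> A} => d tt) => [a _|d _]; first by rewrite ffunE.
by apply/ffunP => -[]; rewrite ffunE.
Qed.

End ProductLaw.

(** * The joint law of two table entries *)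

Section TwoEntries.
Context {R : realType}.

(* The law of a second table entry given that the first one is [a]: a copy if the two
   indices coincide, an independent draw otherwise. *)
Definition copy_law (A : finType) (b : bool) (p : fdist R A) (a : A) : fdist R A :=
  if b then dirac a else p.

Lemma Ex_copyT (A : finType) (p : fdist R A) (a : A) (f : A -> R) :
  Ex (copy_law true p a) f = f a.
Proof. exact: Ex_dirac. Qed.

Lemma Ex_bool_ffun (A : finType) (p : bool -> fdist R A) (f : A -> A -> R) :
  Ex (tab p) (fun d => f (d true) (d false)) =
  Ex (p true) (fun a => Ex (p false) (f a)).
Proof.
pose h (ab : A * A) : {ffun bool -> A} := [ffun b : bool => if b then ab.1 else ab.2].
rewrite /Ex (reindex h) /=; last first.
  exists (fun d => (d true, d false)) => [[a b] _|d _]; first by rewrite !ffunE.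
  by apply/ffunP => -[]; rewrite ffunE.
under [RHS]eq_bigr do rewrite mulr_sumr.
rewrite pair_bigA /=; apply: eq_bigr => -[a b] _.
by rewrite ffunE big_bool !ffunE mulrA.
Qed.

Lemma Ex_tab2 (J A : finType) (p : J -> fdist R A) (j j' : J) (f : A -> A -> R) :
  Ex (tab p) (fun c => f (c j) (c j')) =
  Ex (p j) (fun a => Ex (copy_law (j' == j) (p j') a) (f a)).
Proof.
have [->|jj'] := eqVneq j' j.
  rewrite (Ex_tab1 p j (fun a => f a a)).
  by apply: eq_Ex => a _; rewrite Ex_copyT.
pose phi (b : bool) := if b then j else j'.
have phiI : injective phi.
  by move=> [] [] //= e; rewrite -e eqxx in jj' || rewrite e eqxx in jj'.
rewrite -(Ex_bool_ffun (p \o phi)) -(Ex_tab_sub p _ phiI).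
by apply: eq_Ex => c _; rewrite !ffunE.
Qed.

End TwoEntries.

Arguments copy_law : simpl never.

(** * Random coding for one block *)

Section RandomCodebook.
Context {R : realType}.
Variables (Src I1 I2 IT V1 V2 Q X1 X2 X3 Z W Y W3 Y3 : finType).
Variables (ps : fdist R Src) (s1 : Src -> I1) (s2 : Src -> I2) (w : Src -> W)
  (w3 : Src -> W3) (t1 : I1 -> IT) (t2 : I2 -> IT).
Variables (pV1 : fdist R V1) (pV2 : fdist R V2) (pQ : fdist R Q)
  (pX1 : I1 -> V1 -> Q -> fdist R X1) (pX2 : I2 -> V2 -> Q -> fdist R X2)
  (pX3 : V1 -> V2 -> fdist R X3) (ch : X1 -> X2 -> X3 -> fdist R Z)
  (y : Z -> Y) (y3 : Z -> Y3).

(* A primed index refers to the previous source block, an unprimed one to the current. *)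
Record codebook := Codebook {
  cV1 : {ffun I1 -> V1};
  cV2 : {ffun I2 -> V2};
  cQ : {ffun IT -> Q};
  cX1 : {ffun I1 * I1 * V1 * Q -> X1};
  cX2 : {ffun I2 * I2 * V2 * Q -> X2};
  cX3 : {ffun I1 * I2 * V1 * V2 -> X3} }.

(** The tables for [x1], [x2], [x3] are also indexed by the codewords that condition them. This
    makes all six tables independent: conditional drawing becomes a lookup at the codewords actually
    chosen. The block indices ensure that a wrong block causes a redraw even if the conditioning
    codewords happen to agree. *)
Definition ExC (F : codebook -> R) : R :=
  Ex (tab (fun _ : I1 => pV1)) (fun c1 =>
  Ex (tab (fun _ : I2 => pV2)) (fun c2 =>
  Ex (tab (fun _ : IT => pQ)) (fun c3 =>
  Ex (tab (fun j : I1 * I1 * V1 * Q => pX1 j.1.1.1 j.1.2 j.2)) (fun c4 =>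
  Ex (tab (fun j : I2 * I2 * V2 * Q => pX2 j.1.1.1 j.1.2 j.2)) (fun c5 =>
  Ex (tab (fun j : I1 * I2 * V1 * V2 => pX3 j.1.2 j.2)) (fun c6 =>
  F (Codebook c1 c2 c3 c4 c5 c6))))))).

Lemma le_ExC (F G : codebook -> R) : (forall C, F C <= G C) -> ExC F <= ExC G.
Proof. by move=> FG; do 6!apply: le_Ex => ? _. Qed.

Lemma ExCD (F G : codebook -> R) : ExC (fun C => F C + G C) = ExC F + ExC G.
Proof.
rewrite /ExC.
rewrite -ExD; apply: eq_Ex => c1 _.
rewrite -ExD; apply: eq_Ex => c2 _.
rewrite -ExD; apply: eq_Ex => c3 _.
rewrite -ExD; apply: eq_Ex => c4 _.
rewrite -ExD; apply: eq_Ex => c5 _.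
by rewrite -ExD; apply: eq_Ex => c6 _.
Qed.

Lemma ExC_sum (I : finType) (P : pred I) (F : I -> codebook -> R) :
  ExC (fun C => \sum_(i | P i) F i C) = \sum_(i | P i) ExC (F i).
Proof. rewrite /ExC.
rewrite -Ex_sum; apply: eq_Ex => c1 _.
rewrite -Ex_sum; apply: eq_Ex => c2 _.
rewrite -Ex_sum; apply: eq_Ex => c3 _.
rewrite -Ex_sum; apply: eq_Ex => c4 _.
rewrite -Ex_sum; apply: eq_Ex => c5 _.
by rewrite -Ex_sum; apply: eq_Ex => c6 _. Qed.

Lemma ExC_Ex (A : finType) (p : fdist R A) (F : A -> codebook -> R) :
  ExC (fun C => Ex p (F^~ C)) = Ex p (fun a => ExC (F a)).
Proof.
rewrite /ExC.
rewrite [RHS]Ex_exchange; apply: eq_Ex => c1 _.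
rewrite [RHS]Ex_exchange; apply: eq_Ex => c2 _.
rewrite [RHS]Ex_exchange; apply: eq_Ex => c3 _.
rewrite [RHS]Ex_exchange; apply: eq_Ex => c4 _.
rewrite [RHS]Ex_exchange; apply: eq_Ex => c5 _.
by rewrite [RHS]Ex_exchange; apply: eq_Ex => c6 _.
Qed.

Lemma ExC_exists (F : codebook -> R) (e : R) : ExC F < e -> exists C, F C < e.
Proof.
do 6!move=> /Ex_exists[? ].
by eexists; eassumption.
Qed.

Definition word : Type := V1 * V2 * Q * X1 * X2 * X3.

Definition enc_x1 C i1 i1' := cX1 C (i1, i1', cV1 C i1', cQ C (t1 i1)).
Definition enc_x2 C i2 i2' := cX2 C (i2, i2', cV2 C i2', cQ C (t2 i2)).
Definition enc_x3 C i1' i2' := cX3 C (i1', i2', cV1 C i1', cV2 C i2').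

Definition word_of C (i1 : I1) (i2 : I2) (i1' : I1) (i2' : I2) : word :=
  (cV1 C i1', cV2 C i2', cQ C (t1 i1), enc_x1 C i1 i1', enc_x2 C i2 i2',
   enc_x3 C i1' i2').

Definition ExW (i1 : I1) (i2 : I2) (F : word -> R) : R :=
  Ex pV1 (fun v1 => Ex pV2 (fun v2 => Ex pQ (fun q =>
  Ex (pX1 i1 v1 q) (fun x1 => Ex (pX2 i2 v2 q) (fun x2 => Ex (pX3 v1 v2) (fun x3 =>
  F (v1, v2, q, x1, x2, x3))))))).

(** Each table is read at two places, so [Ex_tab2] applies table by table. The hypotheses on [t1]
    and [t2] make both encoders of a word look up the same entry of [cQ]. *)
Lemma ExC_two_words i1 i2 i1' i2' k1 k2 k1' k2' (F : word -> word -> R) :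
  t2 i2 = t1 i1 -> t2 k2 = t1 k1 ->
  ExC (fun C => F (word_of C i1 i2 i1' i2') (word_of C k1 k2 k1' k2')) =
  Ex pV1 (fun v1 => Ex (copy_law (k1' == i1') pV1 v1) (fun u1 =>
  Ex pV2 (fun v2 => Ex (copy_law (k2' == i2') pV2 v2) (fun u2 =>
  Ex pQ (fun q => Ex (copy_law (t1 k1 == t1 i1) pQ q) (fun r =>
  Ex (pX1 i1 v1 q) (fun x1 => Ex (copy_law ((k1, k1', u1, r) == (i1, i1', v1, q))
    (pX1 k1 u1 r) x1) (fun z1 =>
  Ex (pX2 i2 v2 q) (fun x2 => Ex (copy_law ((k2, k2', u2, r) == (i2, i2', v2, q))
    (pX2 k2 u2 r) x2) (fun z2 =>
  Ex (pX3 v1 v2) (fun x3 => Ex (copy_law ((k1', k2', u1, u2) == (i1', i2', v1, v2))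
    (pX3 u1 u2) x3) (fun z3 =>
  F (v1, v2, q, x1, x2, x3) (u1, u2, r, z1, z2, z3))))))))))))).
Proof.
move=> ti tk.
pose G6 v1 u1 v2 u2 q r x1 z1 x2 z2 :=
  Ex (pX3 v1 v2) (fun x3 => Ex (copy_law ((k1', k2', u1, u2) == (i1', i2', v1, v2))
    (pX3 u1 u2) x3) (fun z3 =>
  F (v1, v2, q, x1, x2, x3) (u1, u2, r, z1, z2, z3))).
pose G5 v1 u1 v2 u2 q r x1 z1 :=
  Ex (pX2 i2 v2 q) (fun x2 => Ex (copy_law ((k2, k2', u2, r) == (i2, i2', v2, q))
    (pX2 k2 u2 r) x2) (G6 v1 u1 v2 u2 q r x1 z1 x2)).
pose G4 v1 u1 v2 u2 q r :=
  Ex (pX1 i1 v1 q) (fun x1 => Ex (copy_law ((k1, k1', u1, r) == (i1, i1', v1, q))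
    (pX1 k1 u1 r) x1) (G5 v1 u1 v2 u2 q r x1)).
pose G3 v1 u1 v2 u2 := Ex pQ (fun q => Ex (copy_law (t1 k1 == t1 i1) pQ q)
  (G4 v1 u1 v2 u2 q)).
pose G2 v1 u1 := Ex pV2 (fun v2 => Ex (copy_law (k2' == i2') pV2 v2) (G3 v1 u1 v2)).
rewrite /ExC /word_of /enc_x1 /enc_x2 /enc_x3 /= ti tk.
rewrite -[RHS](Ex_tab2 _ _ _ G2); apply: eq_Ex => c1 _.
rewrite -[RHS](Ex_tab2 _ _ _ (G3 _ _)); apply: eq_Ex => c2 _.
rewrite -[RHS](Ex_tab2 _ _ _ (G4 _ _ _ _)); apply: eq_Ex => c3 _.
rewrite -[RHS](Ex_tab2 (fun j : I1 * I1 * V1 * Q => pX1 j.1.1.1 j.1.2 j.2)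
  (_, _, _, _) (_, _, _, _) (G5 _ _ _ _ _ _)); apply: eq_Ex => c4 _.
rewrite -[RHS](Ex_tab2 (fun j : I2 * I2 * V2 * Q => pX2 j.1.1.1 j.1.2 j.2)
  (_, _, _, _) (_, _, _, _) (G6 _ _ _ _ _ _ _ _)); apply: eq_Ex => c5 _.
by rewrite -[RHS](Ex_tab2 (fun j : I1 * I2 * V1 * V2 => pX3 j.1.2 j.2)
  (_, _, _, _) (_, _, _, _) (fun x3 z3 => F (_, _, _, _, _, x3) (_, _, _, _, _, z3))).
Qed.

Lemma ExC_word i1 i2 i1' i2' (F : word -> R) : t2 i2 = t1 i1 ->
  ExC (fun C => F (word_of C i1 i2 i1' i2')) = ExW i1 i2 F.
Proof.
move=> ti.
rewrite (ExC_two_words i1' i2' i1' i2' (fun a _ => F a) ti ti).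
apply: eq_Ex => v1 _; apply: Ex_eq_cst => u1.
apply: eq_Ex => v2 _; apply: Ex_eq_cst => u2.
apply: eq_Ex => q _; apply: Ex_eq_cst => r.
apply: eq_Ex => x1 _; apply: Ex_eq_cst => z1.
apply: eq_Ex => x2 _; apply: Ex_eq_cst => z2.
by apply: eq_Ex => x3 _; apply: Ex_eq_cst.
Qed.

(** The law of a second word of the same codebook given that the first is [c]: a component is copied
    where its table index agrees with that of [c], and redrawn otherwise. *)
Definition copies (i1 : I1) (i2 : I2) (i1' : I1) (i2' : I2)
    (k1 : I1) (k2 : I2) (k1' : I1) (k2' : I2) (c : word) (F : word -> R) : R :=
  let: (v1, v2, q, x1, x2, x3) := c in
  Ex (copy_law (k1' == i1') pV1 v1) (fun u1 =>
  Ex (copy_law (k2' == i2') pV2 v2) (fun u2 =>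
  Ex (copy_law (t1 k1 == t1 i1) pQ q) (fun r =>
  Ex (copy_law ((k1, k1', u1, r) == (i1, i1', v1, q)) (pX1 k1 u1 r) x1) (fun z1 =>
  Ex (copy_law ((k2, k2', u2, r) == (i2, i2', v2, q)) (pX2 k2 u2 r) x2) (fun z2 =>
  Ex (copy_law ((k1', k2', u1, u2) == (i1', i2', v1, v2)) (pX3 u1 u2) x3) (fun z3 =>
  F (u1, u2, r, z1, z2, z3))))))).

Definition chw (c : word) : fdist R Z := ch c.1.1.2 c.1.2 c.2.

(** The output is produced by the true word alone, so given that word the competing one is
    independent of the output. The proof moves the draws of the competing word inwards, one at a
    time. *)
Lemma ExC_copies i1 i2 i1' i2' k1 k2 k1' k2' (F : Z -> word -> R) :
  t2 i2 = t1 i1 -> t2 k2 = t1 k1 ->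
  ExC (fun C => Ex (chw (word_of C i1 i2 i1' i2'))
    (fun z => F z (word_of C k1 k2 k1' k2'))) =
  ExW i1 i2 (fun c => Ex (chw c) (fun z => copies i1 i2 i1' i2' k1 k2 k1' k2' c (F z))).
Proof.
move=> ti tk.
rewrite (ExC_two_words i1' i2' k1' k2' (fun c d => Ex (chw c) (F^~ d)) ti tk) /ExW /copies.
pose L3 v1 v2 x3 u1 u2 := copy_law ((k1', k2', u1, u2) == (i1', i2', v1, v2)) (pX3 u1 u2) x3.
pose L2 v2 q x2 u2 r := copy_law ((k2, k2', u2, r) == (i2, i2', v2, q)) (pX2 k2 u2 r) x2.
pose L1 v1 q x1 u1 r := copy_law ((k1, k1', u1, r) == (i1, i1', v1, q)) (pX1 k1 u1 r) x1.
pose LQ q := copy_law (t1 k1 == t1 i1) pQ q.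
pose LV2 v2 := copy_law (k2' == i2') pV2 v2.
pose E3 v1 v2 x3 u1 u2 r z1 z2 z := Ex (L3 v1 v2 x3 u1 u2) (fun z3 => F z (u1, u2, r, z1, z2, z3)).
pose E2 v1 v2 q x2 x3 u1 u2 r z1 z :=
  Ex (L2 v2 q x2 u2 r) (fun z2 => E3 v1 v2 x3 u1 u2 r z1 z2 z).
pose E1 v1 v2 q x1 x2 x3 u1 u2 r z :=
  Ex (L1 v1 q x1 u1 r) (fun z1 => E2 v1 v2 q x2 x3 u1 u2 r z1 z).
pose EQ v1 v2 q x1 x2 x3 u1 u2 z := Ex (LQ q) (fun r => E1 v1 v2 q x1 x2 x3 u1 u2 r z).
pose E0 v1 v2 q x1 x2 x3 u1 z := Ex (LV2 v2) (fun u2 => EQ v1 v2 q x1 x2 x3 u1 u2 z).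
pose chx x1 x2 x3 f := Ex (ch x1 x2 x3) f.
apply: eq_Ex => v1 _.
transitivity (Ex (copy_law (k1' == i1') pV1 v1) (fun u1 =>
  Ex pV2 (fun v2 => Ex pQ (fun q => Ex (pX1 i1 v1 q) (fun x1 => Ex (pX2 i2 v2 q) (fun x2 =>
  Ex (pX3 v1 v2) (fun x3 => chx x1 x2 x3 (E0 v1 v2 q x1 x2 x3 u1)))))))); last first.
  by do 6 (rewrite Ex_exchange; apply: eq_Ex => ? _).
apply: eq_Ex => u1 _; apply: eq_Ex => v2 _.
transitivity (Ex (LV2 v2) (fun u2 =>
  Ex pQ (fun q => Ex (pX1 i1 v1 q) (fun x1 => Ex (pX2 i2 v2 q) (fun x2 =>
  Ex (pX3 v1 v2) (fun x3 => chx x1 x2 x3 (EQ v1 v2 q x1 x2 x3 u1 u2))))))); last first.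
  by do 5 (rewrite Ex_exchange; apply: eq_Ex => ? _).
apply: eq_Ex => u2 _; apply: eq_Ex => q _.
transitivity (Ex (LQ q) (fun r =>
  Ex (pX1 i1 v1 q) (fun x1 => Ex (pX2 i2 v2 q) (fun x2 =>
  Ex (pX3 v1 v2) (fun x3 => chx x1 x2 x3 (E1 v1 v2 q x1 x2 x3 u1 u2 r)))))); last first.
  by do 4 (rewrite Ex_exchange; apply: eq_Ex => ? _).
apply: eq_Ex => r _; apply: eq_Ex => x1 _.
transitivity (Ex (L1 v1 q x1 u1 r) (fun z1 =>
  Ex (pX2 i2 v2 q) (fun x2 =>
  Ex (pX3 v1 v2) (fun x3 => chx x1 x2 x3 (E2 v1 v2 q x2 x3 u1 u2 r z1))))); last first.
  by do 3 (rewrite Ex_exchange; apply: eq_Ex => ? _).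
apply: eq_Ex => z1 _; apply: eq_Ex => x2 _.
transitivity (Ex (L2 v2 q x2 u2 r) (fun z2 =>
  Ex (pX3 v1 v2) (fun x3 => chx x1 x2 x3 (E3 v1 v2 x3 u1 u2 r z1 z2)))); last first.
  by do 2 (rewrite Ex_exchange; apply: eq_Ex => ? _).
apply: eq_Ex => z2 _; apply: eq_Ex => x3 _.
by rewrite Ex_exchange.
Qed.

Lemma ExW_sum i1 i2 (I : finType) (P : pred I) (F : I -> word -> R) :
  ExW i1 i2 (fun c => \sum_(i | P i) F i c) = \sum_(i | P i) ExW i1 i2 (F i).
Proof.
rewrite /ExW.
rewrite -Ex_sum; apply: eq_Ex => v1 _.
rewrite -Ex_sum; apply: eq_Ex => v2 _.
rewrite -Ex_sum; apply: eq_Ex => q _.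
rewrite -Ex_sum; apply: eq_Ex => x1 _.
rewrite -Ex_sum; apply: eq_Ex => x2 _.
by rewrite -Ex_sum; apply: eq_Ex => x3 _.
Qed.

Lemma ExW_le i1 i2 (F : word -> R) (e : R) : (forall c, F c <= e) -> ExW i1 i2 F <= e.
Proof. by move=> Fe; do 6 (apply: Ex_le => ? _). Qed.

Lemma ExC_copies_sum i1 i2 i1' i2' (I : finType) (P : pred I)
    (k1 : I -> I1) (k2 : I -> I2) (k1' : I -> I1) (k2' : I -> I2)
    (F : I -> Z -> word -> R) (e : R) :
  t2 i2 = t1 i1 -> (forall i, P i -> t2 (k2 i) = t1 (k1 i)) ->
  (forall c z, \sum_(i | P i)
    copies i1 i2 i1' i2' (k1 i) (k2 i) (k1' i) (k2' i) c (F i z) <= e) ->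
  \sum_(i | P i) ExC (fun C => Ex (chw (word_of C i1 i2 i1' i2'))
    (fun z => F i z (word_of C (k1 i) (k2 i) (k1' i) (k2' i)))) <= e.
Proof.
move=> ti tk Fe.
under eq_bigr => i Pi do rewrite (ExC_copies i1' i2' _ _ (F i) ti (tk i Pi)).
rewrite -ExW_sum; apply: ExW_le => c.
rewrite -Ex_sum; apply: Ex_le => z _; exact: Fe.
Qed.

(** * Decoders and their error events *)

Section Decoding.
Variables (rtest1 rtest2 rtest3 rtest4 : I1 -> I2 -> word -> W3 -> Y3 -> bool).
Variables (dtest1 dtest2 dtest3 : I1 -> I2 -> I1 -> I2 -> word -> W -> Y -> bool).
Variables (d d' : R).

Definition rtest i1 i2 c a b :=
  [&& rtest1 i1 i2 c a b, rtest2 i1 i2 c a b, rtest3 i1 i2 c a b & rtest4 i1 i2 c a b].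

Definition dtest i1 i2 i1' i2' c a b :=
  [&& dtest1 i1 i2 i1' i2' c a b, dtest2 i1 i2 i1' i2' c a b
    & dtest3 i1 i2 i1' i2' c a b].

(** Pairs with different common parts are discarded, since their encoders would not share an entry
    of [cQ]. The default [p] is returned only if no candidate is accepted, which already counts as a
    rejection of the true pair. *)
Definition relay_decode C (p : I1 * I2) (a : W3) (b : Y3) : I1 * I2 :=
  odflt p [pick c : I1 * I2 | (t2 c.2 == t1 c.1) &&
    rtest c.1 c.2 (word_of C c.1 c.2 p.1 p.2) a b].

Definition dest_decode C (c : I1 * I2) (a : W) (b : Y) : I1 * I2 :=
  odflt c [pick p : I1 * I2 | dtest c.1 c.2 p.1 p.2 (word_of C c.1 c.2 p.1 p.2) a b].

(** A wrong candidate errs in one component or in both, and then with the right or the wrong common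
    part. Each event keeps only the test designed for it. With a single wrong component the common
    part is right, because the other component determines it. *)
Lemma relay_decode_wrong C i1 i2 i1' i2' a b : t2 i2 = t1 i1 ->
  (relay_decode C (i1', i2') a b != (i1, i2))%:R <=
  (~~ rtest i1 i2 (word_of C i1 i2 i1' i2') a b)%:R +
  \sum_(k1 | (k1 != i1) && (t2 i2 == t1 k1))
    (rtest1 k1 i2 (word_of C k1 i2 i1' i2') a b)%:R +
  \sum_(k2 | (k2 != i2) && (t2 k2 == t1 i1))
    (rtest2 i1 k2 (word_of C i1 k2 i1' i2') a b)%:R +
  \sum_(k : I1 * I2 | [&& k.1 != i1, k.2 != i2, t1 k.1 == t1 i1 & t2 k.2 == t1 k.1])
    (rtest3 k.1 k.2 (word_of C k.1 k.2 i1' i2') a b)%:R +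
  \sum_(k : I1 * I2 | [&& k.1 != i1, k.2 != i2, t1 k.1 != t1 i1 & t2 k.2 == t1 k.1])
    (rtest4 k.1 k.2 (word_of C k.1 k.2 i1' i2') a b)%:R :> R.
Proof.
move=> ti.
have term (I : finType) (P : pred I) (B : I -> bool) i :
    P i -> B i -> 1 <= \sum_(j | P j) (B j)%:R :> R.
  by move=> Pi Bi; rewrite (bigD1 i) //= Bi lerDl sumr_ge0.
have sum0 (I : finType) (P : pred I) (B : I -> bool) : 0 <= \sum_(j | P j) (B j)%:R :> R.
  by apply: sumr_ge0.
case: (boolP (_ != _)) => [|_]; last by rewrite !addr_ge0.
move/odflt_pick_wrong => /= [|[[k1 k2] /= kne]].
  by rewrite ti eqxx /= => ->; rewrite -!addrA lerDl !addr_ge0.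
case/andP=> /eqP tk /and4P[r1 r2 r3 r4].
have [e1|n1] := eqVneq k1 i1.
  subst k1; have n2 : k2 != i2 by apply: contra_neq kne => ->.
  have := term _ (fun k2 => (k2 != i2) && (t2 k2 == t1 i1))
    (fun k2 => rtest2 i1 k2 (word_of C i1 k2 i1' i2') a b) k2.
  rewrite n2 tk eqxx => /(_ isT r2) h; apply: (le_trans h).
  by do 2 (apply: ler_wpDr; first exact: sum0); rewrite lerDr !addr_ge0.
have [e2|n2] := eqVneq k2 i2.
  subst k2.
  have := term _ (fun k1 => (k1 != i1) && (t2 i2 == t1 k1))
    (fun k1 => rtest1 k1 i2 (word_of C k1 i2 i1' i2') a b) k1.
  rewrite n1 tk eqxx => /(_ isT r1) h; apply: (le_trans h).
  by do 3 (apply: ler_wpDr; first exact: sum0); rewrite lerDr.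
have [et|nt] := eqVneq (t1 k1) (t1 i1).
  have := term _ (fun k => [&& k.1 != i1, k.2 != i2, t1 k.1 == t1 i1 & t2 k.2 == t1 k.1])
    (fun k => rtest3 k.1 k.2 (word_of C k.1 k.2 i1' i2') a b) (k1, k2).
  rewrite /= n1 n2 tk et eqxx => /(_ isT r3) h; apply: (le_trans h).
  by apply: ler_wpDr; first exact: sum0; rewrite lerDr !addr_ge0.
have := term _ (fun k => [&& k.1 != i1, k.2 != i2, t1 k.1 != t1 i1 & t2 k.2 == t1 k.1])
  (fun k => rtest4 k.1 k.2 (word_of C k.1 k.2 i1' i2') a b) (k1, k2).
rewrite /= n1 n2 tk nt eqxx => /(_ isT r4) h; apply: (le_trans h).
by rewrite lerDr !addr_ge0.
Qed.

(** Backward decoding knows the current pair and hence the codeword of its common part, so three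
    events suffice. *)
Lemma dest_decode_wrong C i1 i2 i1' i2' a b :
  (dest_decode C (i1, i2) a b != (i1', i2'))%:R <=
  (~~ dtest i1 i2 i1' i2' (word_of C i1 i2 i1' i2') a b)%:R +
  \sum_(k1 | k1 != i1') (dtest1 i1 i2 k1 i2' (word_of C i1 i2 k1 i2') a b)%:R +
  \sum_(k2 | k2 != i2') (dtest2 i1 i2 i1' k2 (word_of C i1 i2 i1' k2) a b)%:R +
  \sum_(k : I1 * I2 | (k.1 != i1') && (k.2 != i2'))
    (dtest3 i1 i2 k.1 k.2 (word_of C i1 i2 k.1 k.2) a b)%:R :> R.
Proof.
have term (I : finType) (P : pred I) (B : I -> bool) i :
    P i -> B i -> 1 <= \sum_(j | P j) (B j)%:R :> R.
  by move=> Pi Bi; rewrite (bigD1 i) //= Bi lerDl sumr_ge0.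
have sum0 (I : finType) (P : pred I) (B : I -> bool) : 0 <= \sum_(j | P j) (B j)%:R :> R.
  by apply: sumr_ge0.
case: (boolP (_ != _)) => [|_]; last by rewrite !addr_ge0.
move/odflt_pick_wrong => /= [->|[[k1 k2] /= kne]].
  by rewrite -!addrA lerDl !addr_ge0.
case/and3P=> r1 r2 r3.
have [e1|n1] := eqVneq k1 i1'.
  subst k1; have n2 : k2 != i2' by apply: contra_neq kne => ->.
  have := term _ (fun k2 => k2 != i2')
    (fun k2 => dtest2 i1 i2 i1' k2 (word_of C i1 i2 i1' k2) a b) k2.
  rewrite n2 => /(_ isT r2) h; apply: (le_trans h).
  by apply: ler_wpDr; first exact: sum0; rewrite lerDr !addr_ge0.
have [e2|n2] := eqVneq k2 i2'.
  subst k2.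
  have := term _ (fun k1 => k1 != i1')
    (fun k1 => dtest1 i1 i2 k1 i2' (word_of C i1 i2 k1 i2') a b) k1.
  rewrite n1 => /(_ isT r1) h; apply: (le_trans h).
  by do 2 (apply: ler_wpDr; first exact: sum0); rewrite lerDr.
have := term _ (fun k => (k.1 != i1') && (k.2 != i2'))
  (fun k => dtest3 i1 i2 k.1 k.2 (word_of C i1 i2 k.1 k.2) a b) (k1, k2).
rewrite /= n1 n2 => /(_ isT r3) h; apply: (le_trans h).
by rewrite lerDr !addr_ge0.
Qed.

Hypothesis common_ps : forall o, 0 < ps o -> t2 (s2 o) = t1 (s1 o).

(** The law of a true transmission averaged over codebooks. The previous block [o'] does not
    influence the law of the word, as it only selects table entries. *)
Definition exper (F : Src -> Src -> word -> Z -> R) : R :=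
  Ex ps (fun o' => Ex ps (fun o => ExW (s1 o) (s2 o) (fun c => Ex (chw c) (F o' o c)))).

Definition relay_failure C : R :=
  Ex ps (fun o' => Ex ps (fun o => Ex (chw (word_of C (s1 o) (s2 o) (s1 o') (s2 o')))
    (fun z => (relay_decode C (s1 o', s2 o') (w3 o) (y3 z) != (s1 o, s2 o))%:R))).

Definition dest_failure C : R :=
  Ex ps (fun o' => Ex ps (fun o => Ex (chw (word_of C (s1 o) (s2 o) (s1 o') (s2 o')))
    (fun z => (dest_decode C (s1 o, s2 o) (w o') (y z) != (s1 o', s2 o'))%:R))).

Lemma eq_exper (F G : Src -> Src -> word -> Z -> R) :
  (forall o' o c z, F o' o c z = G o' o c z) -> exper F = exper G.
Proof. by move=> FG; do 9 (apply: eq_Ex => ? _). Qed.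

Lemma le_exper (F G : Src -> Src -> word -> Z -> R) :
  (forall o' o c z, F o' o c z <= G o' o c z) -> exper F <= exper G.
Proof. by move=> FG; do 9 (apply: le_Ex => ? _). Qed.

Lemma experD (F G : Src -> Src -> word -> Z -> R) :
  exper (fun o' o c z => F o' o c z + G o' o c z) = exper F + exper G.
Proof.
rewrite /exper /ExW.
rewrite -ExD; apply: eq_Ex => o' _.
rewrite -ExD; apply: eq_Ex => o _.
rewrite -ExD; apply: eq_Ex => v1 _.
rewrite -ExD; apply: eq_Ex => v2 _.
rewrite -ExD; apply: eq_Ex => q _.
rewrite -ExD; apply: eq_Ex => x1 _.
rewrite -ExD; apply: eq_Ex => x2 _.
rewrite -ExD; apply: eq_Ex => x3 _.
by rewrite -ExD; apply: eq_Ex => z _.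
Qed.

(** In this and the next three cases the previous pair is known, so [v1], [v2], [x3] are copied.
    Redrawn are the inputs of the wrong transmitters, and [q] when the common part is wrong. *)
Lemma copies_relay1 i1 i2 i1' i2' k1 v1 v2 q x1 x2 x3 (F : word -> R) :
  k1 != i1 -> t1 k1 = t1 i1 ->
  copies i1 i2 i1' i2' k1 i2 i1' i2' (v1, v2, q, x1, x2, x3) F =
  Ex (pX1 k1 v1 q) (fun z1 => F (v1, v2, q, z1, x2, x3)).
Proof.
move=> n1 tk; rewrite /copies tk !eqxx !Ex_copyT !xpair_eqE (negbTE n1) /=.
by apply: eq_Ex => z1 _; rewrite ?eqxx /= ?Ex_copyT.
Qed.

Lemma copies_relay2 i1 i2 i1' i2' k2 v1 v2 q x1 x2 x3 (F : word -> R) :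
  k2 != i2 ->
  copies i1 i2 i1' i2' i1 k2 i1' i2' (v1, v2, q, x1, x2, x3) F =
  Ex (pX2 k2 v2 q) (fun z2 => F (v1, v2, q, x1, z2, x3)).
Proof.
move=> n2; rewrite /copies !eqxx !Ex_copyT !xpair_eqE (negbTE n2) /= ?eqxx ?Ex_copyT.
by apply: eq_Ex => z1 _; rewrite ?eqxx /= ?Ex_copyT.
Qed.

Lemma copies_relay3 i1 i2 i1' i2' k1 k2 v1 v2 q x1 x2 x3 (F : word -> R) :
  k1 != i1 -> k2 != i2 -> t1 k1 = t1 i1 ->
  copies i1 i2 i1' i2' k1 k2 i1' i2' (v1, v2, q, x1, x2, x3) F =
  Ex (pX1 k1 v1 q) (fun z1 => Ex (pX2 k2 v2 q) (fun z2 => F (v1, v2, q, z1, z2, x3))).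
Proof.
move=> n1 n2 tk; rewrite /copies tk !eqxx !Ex_copyT !xpair_eqE (negbTE n1) (negbTE n2) /=.
by apply: eq_Ex => z1 _; apply: eq_Ex => z2 _; rewrite ?eqxx /= ?Ex_copyT.
Qed.

Lemma copies_relay4 i1 i2 i1' i2' k1 k2 v1 v2 q x1 x2 x3 (F : word -> R) :
  k1 != i1 -> k2 != i2 -> t1 k1 != t1 i1 ->
  copies i1 i2 i1' i2' k1 k2 i1' i2' (v1, v2, q, x1, x2, x3) F =
  Ex pQ (fun r => Ex (pX1 k1 v1 r) (fun z1 => Ex (pX2 k2 v2 r) (fun z2 =>
  F (v1, v2, r, z1, z2, x3)))).
Proof.
move=> n1 n2 tk; rewrite /copies (negbTE tk) !eqxx !Ex_copyT.
apply: eq_Ex => r _; rewrite !xpair_eqE (negbTE n1) (negbTE n2) /=.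
by apply: eq_Ex => z1 _; apply: eq_Ex => z2 _; rewrite ?eqxx /= ?Ex_copyT.
Qed.

(** In this and the next two cases the current pair is known, so [q] is copied. A wrong previous
    block of one transmitter redraws its auxiliary codeword, its input, and also [x3], whose table
    is indexed by both previous blocks. *)
Lemma copies_dest1 i1 i2 i1' i2' k1 v1 v2 q x1 x2 x3 (F : word -> R) :
  k1 != i1' ->
  copies i1 i2 i1' i2' i1 i2 k1 i2' (v1, v2, q, x1, x2, x3) F =
  Ex pV1 (fun u1 => Ex (pX1 i1 u1 q) (fun z1 => Ex (pX3 u1 v2) (fun z3 =>
  F (u1, v2, q, z1, x2, z3)))).
Proof.
move=> n1; rewrite /copies (negbTE n1) !eqxx.
apply: eq_Ex => u1 _; rewrite !Ex_copyT !xpair_eqE (negbTE n1) /= andbF.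
by apply: eq_Ex => z1 _; rewrite ?eqxx /= ?Ex_copyT.
Qed.

Lemma copies_dest2 i1 i2 i1' i2' k2 v1 v2 q x1 x2 x3 (F : word -> R) :
  k2 != i2' ->
  copies i1 i2 i1' i2' i1 i2 i1' k2 (v1, v2, q, x1, x2, x3) F =
  Ex pV2 (fun u2 => Ex (pX2 i2 u2 q) (fun z2 => Ex (pX3 v1 u2) (fun z3 =>
  F (v1, u2, q, x1, z2, z3)))).
Proof.
move=> n2; rewrite /copies (negbTE n2) !eqxx Ex_copyT.
apply: eq_Ex => u2 _; rewrite !Ex_copyT !xpair_eqE (negbTE n2) /= !andbF ?eqxx /= ?Ex_copyT.
by apply: eq_Ex => z2 _.
Qed.

Lemma copies_dest3 i1 i2 i1' i2' k1 k2 v1 v2 q x1 x2 x3 (F : word -> R) :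
  k1 != i1' -> k2 != i2' ->
  copies i1 i2 i1' i2' i1 i2 k1 k2 (v1, v2, q, x1, x2, x3) F =
  Ex pV1 (fun u1 => Ex pV2 (fun u2 => Ex (pX1 i1 u1 q) (fun z1 =>
  Ex (pX2 i2 u2 q) (fun z2 => Ex (pX3 u1 u2) (fun z3 => F (u1, u2, q, z1, z2, z3)))))).
Proof.
move=> n1 n2; rewrite /copies (negbTE n1) (negbTE n2) !eqxx.
apply: eq_Ex => u1 _; apply: eq_Ex => u2 _; rewrite !Ex_copyT.
rewrite !xpair_eqE (negbTE n1) (negbTE n2) /= !andbF.
by apply: eq_Ex => z1 _.
Qed.

Hypothesis rtest1_sum : forall k2 v1 v2 q x2 x3 a b,
  \sum_k1 Ex (pX1 k1 v1 q) (fun z1 =>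
    (rtest1 k1 k2 (v1, v2, q, z1, x2, x3) a b)%:R) <= d.
Hypothesis rtest2_sum : forall k1 v1 v2 q x1 x3 a b,
  \sum_k2 Ex (pX2 k2 v2 q) (fun z2 =>
    (rtest2 k1 k2 (v1, v2, q, x1, z2, x3) a b)%:R) <= d.
Hypothesis rtest3_sum : forall t v1 v2 q x3 a b,
  \sum_(k : I1 * I2 | (t1 k.1 == t) && (t2 k.2 == t))
    Ex (pX1 k.1 v1 q) (fun z1 => Ex (pX2 k.2 v2 q) (fun z2 =>
    (rtest3 k.1 k.2 (v1, v2, q, z1, z2, x3) a b)%:R)) <= d.
Hypothesis rtest4_sum : forall v1 v2 x3 a b,
  \sum_(k : I1 * I2) Ex pQ (fun r =>
    Ex (pX1 k.1 v1 r) (fun z1 => Ex (pX2 k.2 v2 r) (fun z2 =>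
    (rtest4 k.1 k.2 (v1, v2, r, z1, z2, x3) a b)%:R))) <= d.
Hypothesis dtest1_sum : forall i1 i2 i2' v2 q x2 a b,
  \sum_k1 Ex pV1 (fun u1 => Ex (pX1 i1 u1 q) (fun z1 => Ex (pX3 u1 v2) (fun z3 =>
    (dtest1 i1 i2 k1 i2' (u1, v2, q, z1, x2, z3) a b)%:R))) <= d.
Hypothesis dtest2_sum : forall i1 i2 i1' v1 q x1 a b,
  \sum_k2 Ex pV2 (fun u2 => Ex (pX2 i2 u2 q) (fun z2 => Ex (pX3 v1 u2) (fun z3 =>
    (dtest2 i1 i2 i1' k2 (v1, u2, q, x1, z2, z3) a b)%:R))) <= d.
Hypothesis dtest3_sum : forall i1 i2 q a b,
  \sum_(k : I1 * I2) Ex pV1 (fun u1 => Ex pV2 (fun u2 => Ex (pX1 i1 u1 q) (fun z1 =>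
    Ex (pX2 i2 u2 q) (fun z2 => Ex (pX3 u1 u2) (fun z3 =>
    (dtest3 i1 i2 k.1 k.2 (u1, u2, q, z1, z2, z3) a b)%:R))))) <= d.

Hypothesis rtest1_true : exper (fun _ o c z =>
  (~~ rtest1 (s1 o) (s2 o) c (w3 o) (y3 z))%:R) <= d'.
Hypothesis rtest2_true : exper (fun _ o c z =>
  (~~ rtest2 (s1 o) (s2 o) c (w3 o) (y3 z))%:R) <= d'.
Hypothesis rtest3_true : exper (fun _ o c z =>
  (~~ rtest3 (s1 o) (s2 o) c (w3 o) (y3 z))%:R) <= d'.
Hypothesis rtest4_true : exper (fun _ o c z =>
  (~~ rtest4 (s1 o) (s2 o) c (w3 o) (y3 z))%:R) <= d'.
Hypothesis dtest1_true : exper (fun o' o c z =>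
  (~~ dtest1 (s1 o) (s2 o) (s1 o') (s2 o') c (w o') (y z))%:R) <= d'.
Hypothesis dtest2_true : exper (fun o' o c z =>
  (~~ dtest2 (s1 o) (s2 o) (s1 o') (s2 o') c (w o') (y z))%:R) <= d'.
Hypothesis dtest3_true : exper (fun o' o c z =>
  (~~ dtest3 (s1 o) (s2 o) (s1 o') (s2 o') c (w o') (y z))%:R) <= d'.

Lemma relay_failure_le : ExC relay_failure <= 4%:R * d' + 4%:R * d.
Proof.
have step : ExC relay_failure <= exper (fun _ o c z =>
    (~~ rtest (s1 o) (s2 o) c (w3 o) (y3 z))%:R) + 4%:R * d.
  rewrite /relay_failure ExC_Ex -[X in _ + X](Ex_cst ps) /exper -ExD.
  apply: le_Ex => o' _; rewrite ExC_Ex -[X in _ + X](Ex_cst ps) -ExD.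
  apply: le_Ex => o /common_ps ti.
  pose tru c z : R := (~~ rtest (s1 o) (s2 o) c (w3 o) (y3 z))%:R.
  pose e1 k1 z c : R := (rtest1 k1 (s2 o) c (w3 o) (y3 z))%:R.
  pose e2 k2 z c : R := (rtest2 (s1 o) k2 c (w3 o) (y3 z))%:R.
  pose e3 k z c : R := (rtest3 k.1 k.2 c (w3 o) (y3 z))%:R.
  pose e4 k z c : R := (rtest4 k.1 k.2 c (w3 o) (y3 z))%:R.
  pose w0 C := word_of C (s1 o) (s2 o) (s1 o') (s2 o').
  pose f1 k C := Ex (chw (w0 C)) (fun z => e1 k z (word_of C k (s2 o) (s1 o') (s2 o'))).
  pose f2 k C := Ex (chw (w0 C)) (fun z => e2 k z (word_of C (s1 o) k (s1 o') (s2 o'))).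
  pose f3 k C := Ex (chw (w0 C)) (fun z => e3 k z (word_of C k.1 k.2 (s1 o') (s2 o'))).
  pose f4 k C := Ex (chw (w0 C)) (fun z => e4 k z (word_of C k.1 k.2 (s1 o') (s2 o'))).
  pose P1 k1 := (k1 != s1 o) && (t2 (s2 o) == t1 k1).
  pose P2 k2 := (k2 != s2 o) && (t2 k2 == t1 (s1 o)).
  pose P3 (k : I1 * I2) :=
    [&& k.1 != s1 o, k.2 != s2 o, t1 k.1 == t1 (s1 o) & t2 k.2 == t1 k.1].
  pose P4 (k : I1 * I2) :=
    [&& k.1 != s1 o, k.2 != s2 o, t1 k.1 != t1 (s1 o) & t2 k.2 == t1 k.1].
  apply: (@le_trans _ _ (ExC (fun C => Ex (chw (w0 C)) (tru (w0 C)) +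
    \sum_(k | P1 k) f1 k C + \sum_(k | P2 k) f2 k C + \sum_(k | P3 k) f3 k C +
    \sum_(k | P4 k) f4 k C))).
    apply: le_ExC => C.
    rewrite -!Ex_sum -!ExD; apply: le_Ex => z _.
    exact: relay_decode_wrong.
  have tru_word : ExC (fun C => Ex (chw (w0 C)) (tru (w0 C))) =
      ExW (s1 o) (s2 o) (fun c => Ex (chw c) (tru c)).
    exact: (ExC_word _ _ (fun c => Ex (chw c) (tru c)) ti).
  rewrite !ExCD tru_word !ExC_sum -!addrA lerD2l.
  have -> : 4%:R * d = d + (d + (d + d)) by ring.
  apply: lerD; last apply: lerD; last apply: lerD.
  - apply: (@ExC_copies_sum _ _ (s1 o') (s2 o') _ _ (id) (fun=> s2 o)
      (fun=> s1 o') (fun=> s2 o') e1 _ ti) => [k /andP[_ /eqP]//|].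
    move=> [[[[[v1 v2] q] x1] x2] x3] z; apply: le_trans (rtest1_sum _ _ _ _ _ _ _ _).
    under eq_bigr => k /andP[n1 /eqP tk] do rewrite copies_relay1 -?tk //.
    by apply: sum_pred_le => // k; apply: Ex_ge0.
  - apply: (@ExC_copies_sum _ _ (s1 o') (s2 o') _ _ (fun=> s1 o) (id)
      (fun=> s1 o') (fun=> s2 o') e2 _ ti) => [k /andP[_ /eqP]//|].
    move=> [[[[[v1 v2] q] x1] x2] x3] z; apply: le_trans (rtest2_sum _ _ _ _ _ _ _ _).
    under eq_bigr => k /andP[n1 _] do rewrite copies_relay2 //.
    by apply: sum_pred_le => // k; apply: Ex_ge0.
  - apply: (@ExC_copies_sum _ _ (s1 o') (s2 o') _ _ (fst) (snd)
      (fun=> s1 o') (fun=> s2 o') e3 _ ti) => [k /and4P[_ _ _ /eqP]//|].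
    move=> [[[[[v1 v2] q] x1] x2] x3] z; apply: le_trans (rtest3_sum (t1 (s1 o)) _ _ _ _ _ _).
    under eq_bigr => k /and4P[n1 n2 /eqP tk _] do rewrite copies_relay3 //.
    apply: sum_pred_le => k; first by do 2 (apply: Ex_ge0 => ?).
    by case/and4P=> _ _ /eqP<- /eqP->; rewrite eqxx.
  - apply: (@ExC_copies_sum _ _ (s1 o') (s2 o') _ _ (fst) (snd)
      (fun=> s1 o') (fun=> s2 o') e4 _ ti) => [k /and4P[_ _ _ /eqP]//|].
    move=> [[[[[v1 v2] q] x1] x2] x3] z; apply: le_trans (rtest4_sum _ _ _ _ _).
    under eq_bigr => k /and4P[n1 n2 tk _] do rewrite copies_relay4 //.
    by apply: sum_pred_le => // k; do 3 (apply: Ex_ge0 => ?).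
apply: (le_trans step); rewrite lerD2r.
apply: le_trans (le_exper (G := fun _ o c z =>
  (~~ rtest1 (s1 o) (s2 o) c (w3 o) (y3 z))%:R +
  ((~~ rtest2 (s1 o) (s2 o) c (w3 o) (y3 z))%:R +
  ((~~ rtest3 (s1 o) (s2 o) c (w3 o) (y3 z))%:R +
   (~~ rtest4 (s1 o) (s2 o) c (w3 o) (y3 z))%:R))) _) _.
  move=> o' o c z; do 2 (apply: (le_trans (negb_and_le _ _)); rewrite lerD2l).
  exact: negb_and_le.
rewrite !experD; have -> : 4%:R * d' = d' + (d' + (d' + d')) by ring.
by do 3 (apply: lerD; first by []).
Qed.

Lemma dest_failure_le : ExC dest_failure <= 3%:R * d' + 3%:R * d.
Proof.
have step : ExC dest_failure <= exper (fun o' o c z =>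
    (~~ dtest (s1 o) (s2 o) (s1 o') (s2 o') c (w o') (y z))%:R) + 3%:R * d.
  rewrite /dest_failure ExC_Ex -[X in _ + X](Ex_cst ps) /exper -ExD.
  apply: le_Ex => o' _; rewrite ExC_Ex -[X in _ + X](Ex_cst ps) -ExD.
  apply: le_Ex => o /common_ps ti.
  pose tru c z : R := (~~ dtest (s1 o) (s2 o) (s1 o') (s2 o') c (w o') (y z))%:R.
  pose e1 k1 z c : R := (dtest1 (s1 o) (s2 o) k1 (s2 o') c (w o') (y z))%:R.
  pose e2 k2 z c : R := (dtest2 (s1 o) (s2 o) (s1 o') k2 c (w o') (y z))%:R.
  pose e3 k z c : R := (dtest3 (s1 o) (s2 o) k.1 k.2 c (w o') (y z))%:R.
  pose w0 C := word_of C (s1 o) (s2 o) (s1 o') (s2 o').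
  pose f1 k C := Ex (chw (w0 C)) (fun z => e1 k z (word_of C (s1 o) (s2 o) k (s2 o'))).
  pose f2 k C := Ex (chw (w0 C)) (fun z => e2 k z (word_of C (s1 o) (s2 o) (s1 o') k)).
  pose f3 k C := Ex (chw (w0 C)) (fun z => e3 k z (word_of C (s1 o) (s2 o) k.1 k.2)).
  pose P3 (k : I1 * I2) := (k.1 != s1 o') && (k.2 != s2 o').
  apply: (@le_trans _ _ (ExC (fun C => Ex (chw (w0 C)) (tru (w0 C)) +
    \sum_(k | k != s1 o') f1 k C + \sum_(k | k != s2 o') f2 k C +
    \sum_(k | P3 k) f3 k C))).
    apply: le_ExC => C.
    rewrite -!Ex_sum -!ExD; apply: le_Ex => z _.
    exact: dest_decode_wrong.
  have tru_word : ExC (fun C => Ex (chw (w0 C)) (tru (w0 C))) =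
      ExW (s1 o) (s2 o) (fun c => Ex (chw c) (tru c)).
    exact: (ExC_word _ _ (fun c => Ex (chw c) (tru c)) ti).
  rewrite !ExCD tru_word !ExC_sum -!addrA lerD2l.
  have -> : 3%:R * d = d + (d + d) by ring.
  apply: lerD; last apply: lerD.
  - apply: (@ExC_copies_sum _ _ (s1 o') (s2 o') _ _ (fun=> s1 o) (fun=> s2 o)
      (id) (fun=> s2 o') e1 _ ti) => //.
    move=> [[[[[v1 v2] q] x1] x2] x3] z.
    apply: le_trans (dtest1_sum (s1 o) (s2 o) (s2 o') v2 q x2 (w o') (y z)).
    under eq_bigr => k n1 do rewrite copies_dest1 //.
    by apply: sum_pred_le => // k; do 3 (apply: Ex_ge0 => ?).
  - apply: (@ExC_copies_sum _ _ (s1 o') (s2 o') _ _ (fun=> s1 o) (fun=> s2 o)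
      (fun=> s1 o') (id) e2 _ ti) => //.
    move=> [[[[[v1 v2] q] x1] x2] x3] z.
    apply: le_trans (dtest2_sum (s1 o) (s2 o) (s1 o') v1 q x1 (w o') (y z)).
    under eq_bigr => k n2 do rewrite copies_dest2 //.
    by apply: sum_pred_le => // k; do 3 (apply: Ex_ge0 => ?).
  - apply: (@ExC_copies_sum _ _ (s1 o') (s2 o') _ _ (fun=> s1 o) (fun=> s2 o)
      (fst) (snd) e3 _ ti) => //.
    move=> [[[[[v1 v2] q] x1] x2] x3] z.
    apply: le_trans (dtest3_sum (s1 o) (s2 o) q (w o') (y z)).
    under eq_bigr => k /andP[n1 n2] do rewrite copies_dest3 //.
    by apply: sum_pred_le => // k; do 5 (apply: Ex_ge0 => ?).
apply: (le_trans step); rewrite lerD2r.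
apply: le_trans (le_exper (G := fun o' o c z =>
  (~~ dtest1 (s1 o) (s2 o) (s1 o') (s2 o') c (w o') (y z))%:R +
  ((~~ dtest2 (s1 o) (s2 o) (s1 o') (s2 o') c (w o') (y z))%:R +
   (~~ dtest3 (s1 o) (s2 o) (s1 o') (s2 o') c (w o') (y z))%:R)) _) _.
  move=> o' o c z; apply: (le_trans (negb_and_le _ _)); rewrite lerD2l.
  exact: negb_and_le.
rewrite !experD; have -> : 3%:R * d' = d' + (d' + d') by ring.
by do 2 (apply: lerD; first by []).
Qed.

End Decoding.

End RandomCodebook.

(** * Block Markov coding *)

Section ProductLawMore.
Context {R : realType}.

Lemma eq_tab (J A : finType) (p p' : J -> fdist R A) (f : {ffun J -> A} -> R) :
  (forall j, p j = p' j) -> Ex (tab p) f = Ex (tab p') f.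
Proof.
by move=> pp'; apply: eq_bigr => c _; rewrite !tabE; under eq_bigr do rewrite pp'.
Qed.

Lemma Ex_tab_plus (J1 J2 A : finType) (p : J1 + J2 -> fdist R A)
    (f : {ffun J1 -> A} -> {ffun J2 -> A} -> R) :
  Ex (tab p) (fun c => f [ffun j => c (inl j)] [ffun j => c (inr j)]) =
  Ex (tab (p \o inl)) (fun a => Ex (tab (p \o inr)) (f a)).
Proof.
pose h (ab : {ffun J1 -> A} * {ffun J2 -> A}) : {ffun J1 + J2 -> A} :=
  [ffun j => match j with inl j => ab.1 j | inr j => ab.2 j end].
rewrite /Ex (reindex h) /=; last first.
  exists (fun c : {ffun J1 + J2 -> A} => ([ffun j => c (inl j)], [ffun j => c (inr j)])).
    by move=> [a b] _; congr (_, _); apply/ffunP => j; rewrite !ffunE.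
  by move=> c _; apply/ffunP => -[j|j]; rewrite !ffunE.
under [RHS]eq_bigr do rewrite mulr_sumr.
rewrite pair_bigA /=; apply: eq_bigr => -[a b] _.
rewrite !tabE big_sumType /= mulrA; congr (_ * _ * f _ _).
- by apply: eq_bigr => j _; rewrite ffunE.
- by apply: eq_bigr => j _; rewrite ffunE.
- by apply/ffunP => j; rewrite !ffunE.
- by apply/ffunP => j; rewrite !ffunE.
Qed.

(* A channel used with feedback still has total mass 1. *)
Lemma causal_sum1 (A : finType) (a0 : A) (n : nat)
    (p : 'I_n -> {ffun 'I_n -> A} -> fdist R A) :
  (forall (k : 'I_n) (z z' : {ffun 'I_n -> A}),
    (forall j : 'I_n, (j < k)%N -> z j = z' j) -> p k z = p k z') ->
  \sum_(z : {ffun 'I_n -> A}) \prod_k p k z (z k) = 1.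
Proof.
elim: n p => [|n IH] p pP.
  rewrite (big_pred1 [ffun _ => a0]) ?big_ord0 // => z.
  by apply/esym/eqP/ffunP => -[].
pose h (da : {ffun 'I_n -> A} * A) : {ffun 'I_n.+1 -> A} :=
  [ffun k => if unlift ord_max k is Some j then da.1 j else da.2].
have hw da j : h da (widen_ord (leqnSn n) j) = da.1 j.
  have -> : widen_ord (leqnSn n) j = lift ord_max j.
    by apply: val_inj; rewrite /= /bump leqNgt ltn_ord.
  by rewrite ffunE liftK.
have hm da : h da ord_max = da.2 by rewrite ffunE unlift_none.
rewrite (reindex h) /=; last first.
  exists (fun z : {ffun 'I_n.+1 -> A} => ([ffun j => z (lift ord_max j)], z ord_max)).
    move=> [d a] _; congr (_, _); last exact: hm.
    by apply/ffunP => j; rewrite !ffunE liftK.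
  move=> z _; apply/ffunP => k; rewrite ffunE /=.
  by case: unliftP => [j ->|->] //=; rewrite ffunE.
(* The last symbol is filled with [a0]; by causality neither the earlier factors nor the law of the
   last symbol depend on this value. *)
pose p' (k : 'I_n) d := p (widen_ord (leqnSn n) k) (h (d, a0)).
rewrite -[RHS](IH p') => [|k z z' zz']; last first.
  apply: pP => j jk; have jn : (j < n)%N by apply: ltn_trans jk (ltn_ord k).
  have -> : j = widen_ord (leqnSn n) (Ordinal jn) by apply: val_inj.
  by rewrite !hw; apply: zz'.
transitivity (\sum_d \sum_a \prod_k p k (h (d, a)) (h (d, a) k)).
  by rewrite pair_bigA /=; apply: eq_bigr => -[d a] _.
apply: eq_bigr => d _.
have step a : \prod_k p k (h (d, a)) (h (d, a) k) =
    (\prod_k p' k d (d k)) * p ord_max (h (d, a0)) a.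
  have indep (k : 'I_n.+1) : p k (h (d, a)) = p k (h (d, a0)).
    apply: pP => j jk; have jn : (j < n)%N by apply: leq_trans jk (leq_ord k).
    have -> : j = widen_ord (leqnSn n) (Ordinal jn) by apply: val_inj.
    by rewrite !hw.
  rewrite big_ord_recr /= hm indep; congr (_ * _).
  by apply: eq_bigr => k _; rewrite hw indep.
rewrite (eq_bigr _ (fun a _ => step a)).
by rewrite -mulr_sumr fdist_sum1 mulr1.
Qed.

End ProductLawMore.

(** * Filling the free positions of an i.i.d. field *)

Section Merge.
Context {R : realType}.
Variables (K G : finType) (iota : K -> G).
Hypothesis iotaI : injective iota.

Definition merge (A : Type) (r : K -> A) (p : G -> A) (g : G) : A :=
  if [pick k | iota k == g] is Some k then r k else p g.

Lemma merge_in A (r : K -> A) (p : G -> A) k : merge r p (iota k) = r k.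
Proof.
rewrite /merge; case: pickP => [k' /eqP/iotaI->//|/(_ k)].
by rewrite eqxx.
Qed.

Lemma merge_out A (r : K -> A) (p : G -> A) g :
  (forall k, iota k != g) -> merge r p g = p g.
Proof. by move=> ng; rewrite /merge; case: pickP => // k; rewrite (negbTE (ng k)). Qed.

Lemma merge_map A A' (f : A -> A') (r : K -> A) (p : G -> A) g :
  f (merge r p g) = merge (fun k => f (r k)) (fun g => f (p g)) g.
Proof. by rewrite /merge; case: pickP. Qed.

(* Pads are shared randomness: an i.i.d. field in which some letters are replaced by fresh
   ones is again i.i.d., so some fixed pad is at least as good as the average. *)
Lemma Ex_merge (A : finType) (p : fdist R A) (F : {ffun G -> A} -> R) :
  Ex (tab (fun _ : G => p)) (fun d => Ex (tab (fun _ : K => p)) (fun c =>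
    F [ffun g => merge c d g])) = Ex (tab (fun _ : G => p)) F.
Proof.
rewrite -(Ex_tab_plus (fun _ : G + K => p)
  (fun d c => F [ffun g => merge c d g])).
(* [phi g] is the coordinate that supplies position [g], a fresh letter or a pad letter. As [phi] is
   injective, the merged field is a restriction of one product table. *)
pose phi g : G + K := if [pick k | iota k == g] is Some k then inr k else inl g.
have phiI : injective phi.
  move=> g g'; rewrite /phi; case: pickP => [k /eqP<-|_]; case: pickP => [k' /eqP<-|_] //.
    by case=> ->.
  by case.
rewrite -[RHS](Ex_tab_sub (fun _ : G + K => p) F phiI); apply: eq_Ex => c _.
congr F; apply/ffunP => g; rewrite !ffunE /merge /phi.
by case: pickP => [k _|_]; rewrite ffunE.
Qed.

End Merge.

Section BlockMarkov.
Context {R : realType}.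
Variables (aS1 aS2 aW aW3 aX1 aX2 aX3 aY aY3 : finType).
Variables (src : fdist R (aS1 * aS2 * aW * aW3)%type)
  (ch : aX1 -> aX2 -> aX3 -> fdist R (aY * aY3)%type).
Variables (y0 : aY) (y30 : aY3).
Variables (m n B M N : nat).
Hypotheses (B_gt0 : (0 < B)%N) (N_gt0 : (0 < N)%N) (M_gt0 : (0 < M)%N).
Hypotheses (m_le : (m <= B * M)%N) (n_ge : (B.+1 * N <= n)%N).

Local Notation aS := (aS1 * aS2 * aW * aW3)%type.
Local Notation blk A := {ffun 'I_M -> A}.
Local Notation out A := {ffun 'I_N -> A}.
Local Notation pos := ('I_B.+1 * 'I_M)%type.

Variables (e1 : blk aS1 -> blk aS1 -> out aX1) (e2 : blk aS2 -> blk aS2 -> out aX2)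
  (e3 : blk aS1 -> blk aS2 -> out aX3).
Variables
  (rdec : blk aS1 * blk aS2 -> blk aW3 -> out aY3 -> blk aS1 * blk aS2)
  (ddec : blk aS1 * blk aS2 -> blk aW -> out aY -> blk aS1 * blk aS2).

Definition fS1 (I : finType) (o : {ffun I -> aS}) : {ffun I -> aS1} :=
  [ffun i => (o i).1.1.1].
Definition fS2 (I : finType) (o : {ffun I -> aS}) : {ffun I -> aS2} :=
  [ffun i => (o i).1.1.2].
Definition fW (I : finType) (o : {ffun I -> aS}) : {ffun I -> aW} :=
  [ffun i => (o i).1.2].
Definition fW3 (I : finType) (o : {ffun I -> aS}) : {ffun I -> aW3} :=
  [ffun i => (o i).2].
Definition fY (I : finType) (z : {ffun I -> aY * aY3}) : {ffun I -> aY} :=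
  [ffun i => (z i).1].
Definition fY3 (I : finType) (z : {ffun I -> aY * aY3}) : {ffun I -> aY3} :=
  [ffun i => (z i).2].

Definition blk_ch (x1 : out aX1) (x2 : out aX2) (x3 : out aX3) :
  fdist R (out (aY * aY3)) := tab (fun j => ch (x1 j) (x2 j) (x3 j)).

Definition blk_relay_failure : R :=
  Ex (tab (fun _ : 'I_M => src)) (fun o' => Ex (tab (fun _ : 'I_M => src)) (fun o =>
  Ex (blk_ch (e1 (fS1 o) (fS1 o')) (e2 (fS2 o) (fS2 o')) (e3 (fS1 o') (fS2 o')))
    (fun z => (rdec (fS1 o', fS2 o') (fW3 o) (fY3 z) != (fS1 o, fS2 o))%:R))).

Definition blk_dest_failure : R :=
  Ex (tab (fun _ : 'I_M => src)) (fun o' => Ex (tab (fun _ : 'I_M => src)) (fun o =>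
  Ex (blk_ch (e1 (fS1 o) (fS1 o')) (e2 (fS2 o) (fS2 o')) (e3 (fS1 o') (fS2 o')))
    (fun z => (ddec (fS1 o, fS2 o) (fW o') (fY z) != (fS1 o', fS2 o'))%:R))).

(** Cyclic: the first block is preceded by the last, which [slot] never reaches and which therefore
    holds pad letters only. It starts both the forward and the backward decoding. *)
Definition prv (b : 'I_B.+1) : 'I_B.+1 := if b == ord0 then ord_max else inord b.-1.

Lemma prv_neq b : prv b != b.
Proof.
have [->|b0] := eqVneq b ord0; first by rewrite /prv eqxx -val_eqE /= -lt0n.
rewrite /prv (negbTE b0).
have b_gt0 : (0 < b)%N by rewrite lt0n.
rewrite -val_eqE /= inordK; first by rewrite neq_ltn ltn_predL b_gt0.
by apply: leq_ltn_trans (leq_pred _) (ltn_ord b).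
Qed.

Definition slot (i : 'I_m) : pos := (inord (i %/ M), Ordinal (ltn_pmod i M_gt0)).

Lemma slot_lt (i : 'I_m) : (i %/ M < B)%N.
Proof. by rewrite ltn_divLR // (leq_trans (ltn_ord i)). Qed.

Lemma slot1 i : (slot i).1 = (i %/ M)%N :> nat.
Proof. by rewrite /= inordK // ltnS ltnW // slot_lt. Qed.

Lemma slot_inj : injective slot.
Proof.
move=> i j ij; apply: val_inj; rewrite /= (divn_eq i M) (divn_eq j M).
by rewrite -slot1 -(slot1 j) ij; congr (_ + _)%N; case: ij.
Qed.

Lemma slot_out i j : slot i != (ord_max, j).
Proof.
apply: contraTneq (slot_lt i) => h.
by rewrite -slot1 h /= ltnn.
Qed.

Lemma kpos_lt (b : 'I_B.+1) (j : 'I_N) : (b * N + j < n)%N.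
Proof.
apply: leq_trans n_ge; rewrite mulSn addnC -addSn.
by rewrite leq_add // leq_pmul2r // leq_ord.
Qed.

Definition kpos b j : 'I_n := Ordinal (kpos_lt b j).

Lemma kpos_inj b : injective (kpos b).
Proof. by move=> j j' /(congr1 val) /= /addnI /val_inj. Qed.

Definition kblk (k : 'I_n) : 'I_B.+1 := inord (k %/ N).
Definition kidx (k : 'I_n) : 'I_N := Ordinal (ltn_pmod k N_gt0).

Lemma kblk_kpos b j : kblk (kpos b j) = b.
Proof.
apply: val_inj; rewrite /= /kblk /= divnMDl // divn_small // addn0 inordK //.
Qed.

Lemma kidx_kpos b j : kidx (kpos b j) = j.
Proof. by apply: val_inj; rewrite /= modnMDl modn_small. Qed.

(** For channel uses after the last block [inord] falls back to 0, so the bound persists. It is the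
    causality of the relay: the estimate used at time [k] reads only outputs before time [k]. *)
Lemma kblk_le k : (kblk k * N <= k)%N.
Proof.
rewrite /kblk /inord /insubd; case: insubP => [b _ ->|_] /=; last by rewrite mul0n.
by rewrite leq_divM.
Qed.

(** * The code for a fixed pad and its genie-aided comparison *)

Section Code.
Variable pad : {ffun pos -> aS}.

Definition blkof (A : finType) (f : pos -> A) (b : 'I_B.+1) : blk A := [ffun j => f (b, j)].

Definition b1 (s1 : m.-tuple aS1) := blkof (merge slot (tnth s1) (fS1 pad)).
Definition b2 (s2 : m.-tuple aS2) := blkof (merge slot (tnth s2) (fS2 pad)).
Definition bw (w : m.-tuple aW) := blkof (merge slot (tnth w) (fW pad)).
Definition bw3 (w3 : m.-tuple aW3) := blkof (merge slot (tnth w3) (fW3 pad)).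

Definition dummy := (blkof (fS1 pad) ord_max, blkof (fS2 pad) ord_max).

Definition readout (A : finType) (a : A) (ys : seq A) (b : nat) : out A :=
  [ffun j : 'I_N => nth a ys (b * N + j)].

(* The block index pair that the relay believes was sent one block before block [b]. *)
Fixpoint relay_est (ys : seq aY3) (w3 : m.-tuple aW3) (b : nat) :=
  if b is b'.+1
  then rdec (relay_est ys w3 b') (bw3 w3 (inord b')) (readout y30 ys b')
  else dummy.

(* Backward decoding: the block index pair that the destination assigns to block [B - d]. *)
Fixpoint dest_est (ys : seq aY) (w : m.-tuple aW) (d : nat) :=
  if d is d'.+1
  then ddec (dest_est ys w d') (bw w (inord (B - d').-1)) (readout y0 ys (B - d'))
  else dummy.

(** The indices are shifted: the destination's estimate of block [b] is [dest_est] at [B - b], while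
    the relay's estimate of block [b] is [relay_est] at [b + 1]. *)
Definition markov_marc : marc_code aS1 aS2 aW aW3 aX1 aX2 aX3 aY aY3 m n := MarcCode
  (fun s1 => [tuple e1 (b1 s1 (kblk k)) (b1 s1 (prv (kblk k))) (kidx k) | k < n])
  (fun s2 => [tuple e2 (b2 s2 (kblk k)) (b2 s2 (prv (kblk k))) (kidx k) | k < n])
  (fun k ys w3 => let c := relay_est ys w3 (kblk k) in e3 c.1 c.2 (kidx k))
  (fun ys w => ([tuple (dest_est ys w (B - (slot i).1)).1 (slot i).2 | i < m],
                [tuple (dest_est ys w (B - (slot i).1)).2 (slot i).2 | i < m])).

Definition markov_code : mabrc_code aS1 aS2 aW aW3 aX1 aX2 aX3 aY aY3 m n :=
  MabrcCode markov_marc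
  (fun ys w3 => ([tuple (relay_est ys w3 (slot i).1.+1).1 (slot i).2 | i < m],
                 [tuple (relay_est ys w3 (slot i).1.+1).2 (slot i).2 | i < m])).

Definition bpair s1 s2 b := (b1 s1 b, b2 s2 b).

(* An error of a decoder that is told the true neighbouring block; in its absence the
   actual estimates are correct by induction. *)
Definition genie_error (o : block_outcome aS1 aS2 aW aW3 aY aY3 m n) (b : 'I_B.+1) : bool :=
  let: (s1, s2, w, w3, y, y3) := o in
  (rdec (bpair s1 s2 (prv b)) (bw3 w3 b) (readout y30 y3 b) != bpair s1 s2 b) ||
  (ddec (bpair s1 s2 b) (bw w (prv b)) (readout y0 y b) != bpair s1 s2 (prv b)).

Lemma blkof_merge_last (A : finType) (r : 'I_m -> A) (p : pos -> A) :
  blkof (merge slot r p) ord_max = blkof p ord_max.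
Proof.
by apply/ffunP => j; rewrite !ffunE merge_out // => i; apply: slot_out.
Qed.

Lemma bpair_last s1 s2 : bpair s1 s2 ord_max = dummy.
Proof. by rewrite /bpair /b1 /b2 !blkof_merge_last. Qed.

Lemma relay_est_ext ys ys' w3 b :
  (forall i, (i < b * N)%N -> nth y30 ys i = nth y30 ys' i) ->
  relay_est ys w3 b = relay_est ys' w3 b.
Proof.
elim: b => //= b IH yy'; rewrite IH => [|i ib]; last first.
  by apply: yy'; rewrite mulSn (leq_trans ib) ?leq_addl.
congr rdec; apply/ffunP => j; rewrite !ffunE; apply: yy'.
by rewrite mulSn addnC ltn_add2r.
Qed.

Lemma relay_est_genie s1 s2 w w3 y y3 :
  (forall b, ~~ genie_error (s1, s2, w, w3, y, y3) b) ->
  forall b : 'I_B.+1, relay_est y3 w3 b = bpair s1 s2 (prv b) /\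
    relay_est y3 w3 b.+1 = bpair s1 s2 b.
Proof.
move=> ok.
have succ (b : 'I_B.+1) : relay_est y3 w3 b = bpair s1 s2 (prv b) ->
    relay_est y3 w3 b.+1 = bpair s1 s2 b.
  move=> /= ->; have /norP[/negPn/eqP + _] := ok b.
  by rewrite inord_val.
have H k : (k <= B)%N -> relay_est y3 w3 k = bpair s1 s2 (prv (inord k)).
  elim: k => [|k IH] kB.
    by rewrite /prv -val_eqE /= inordK //= bpair_last.
  have kB' := ltnW kB.
  have := succ (inord k); rewrite inordK ?ltnS // => ->; last exact: IH.
  rewrite /prv -val_eqE /= inordK ?ltnS //=.
move=> b; have Hb : relay_est y3 w3 b = bpair s1 s2 (prv b).
  by rewrite H ?leq_ord // inord_val.
by split=> //; apply: succ.
Qed.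

Lemma dest_est_genie s1 s2 w w3 y y3 :
  (forall b, ~~ genie_error (s1, s2, w, w3, y, y3) b) ->
  forall d, (d <= B)%N -> dest_est y w d = bpair s1 s2 (inord (B - d)).
Proof.
move=> ok; elim=> [|d IH] dB.
  by rewrite subn0 /= -(bpair_last s1 s2); congr bpair; apply: val_inj; rewrite /= inordK.
have dB' := ltnW dB.
have Bd : (B - d < B.+1)%N by rewrite ltnS leq_subr.
have Bd0 : (0 < B - d)%N by rewrite subn_gt0.
have /norP[_ /negPn/eqP] := ok (inord (B - d)).
have -> : prv (inord (B - d)) = inord (B - d).-1.
  by rewrite /prv -val_eqE /= inordK // eqn0Ngt Bd0.
by rewrite /= IH // inordK // subnS.
Qed.

Lemma past_nth (A : Type) (a : A) (k : 'I_n) (y : n.-tuple A) i :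
  (i < k)%N -> nth a (past k y) i = nth a y i.
Proof.
move=> ik; rewrite -(tnth_nth a (past k y) (Ordinal ik)) tnth_mktuple (tnth_nth a).
by [].
Qed.

Definition ideal_x3 s1 s2 (k : 'I_n) : aX3 :=
  e3 (b1 s1 (prv (kblk k))) (b2 s2 (prv (kblk k))) (kidx k).

Lemma relay_enc_genie s1 s2 w w3 y y3 :
  (forall b, ~~ genie_error (s1, s2, w, w3, y, y3) b) ->
  forall k, relay_enc markov_marc (past k y3) w3 = ideal_x3 s1 s2 k.
Proof.
move=> ok k; rewrite /= (@relay_est_ext _ y3) => [|i ik]; last first.
  by rewrite past_nth // (leq_trans ik) // kblk_le.
by have [-> _] := relay_est_genie ok (kblk k).
Qed.

Lemma no_genie_no_error s1 s2 w w3 y y3 :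
  (forall b, ~~ genie_error (s1, s2, w, w3, y, y3) b) ->
  ~~ (dest_error markov_code (s1, s2, w, w3, y, y3) ||
      relay_error markov_code (s1, s2, w, w3, y, y3)).
Proof.
move=> ok; rewrite /= negb_or !negbK; apply/andP; split; apply/eqP; congr (_, _);
  apply: eq_from_tnth => i; rewrite tnth_mktuple.
- rewrite (dest_est_genie ok) ?leq_subr // subKn ?leq_ord // inord_val.
  by rewrite /= ffunE; apply: (merge_in slot_inj _ _ i).
- rewrite (dest_est_genie ok) ?leq_subr // subKn ?leq_ord // inord_val.
  by rewrite /= ffunE; apply: (merge_in slot_inj _ _ i).
- have [_ /= ->] := relay_est_genie ok (slot i).1.
  by rewrite /= ffunE; apply: (merge_in slot_inj _ _ i).
- have [_ /= ->] := relay_est_genie ok (slot i).1.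
  by rewrite /= ffunE; apply: (merge_in slot_inj _ _ i).
Qed.

End Code.

(** * Passage to a field of i.i.d. blocks and the union bound *)

Definition mk_outcome (c : {ffun 'I_m -> aS}) (z : {ffun 'I_n -> aY * aY3}) :
    block_outcome aS1 aS2 aW aW3 aY aY3 m n :=
  ([tuple (c i).1.1.1 | i < m], [tuple (c i).1.1.2 | i < m], [tuple (c i).1.2 | i < m],
   [tuple (c i).2 | i < m], [tuple (z k).1 | k < n], [tuple (z k).2 | k < n]).

Lemma sum_outcome (F : block_outcome aS1 aS2 aW aW3 aY aY3 m n -> R) :
  \sum_o F o = \sum_c \sum_z F (mk_outcome c z).
Proof.
rewrite pair_bigA /= (reindex (fun cz => mk_outcome cz.1 cz.2)) //=.
exists (fun o => let: (s1, s2, w, w3, y, y3) := o in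
  ([ffun i => (tnth s1 i, tnth s2 i, tnth w i, tnth w3 i)],
   [ffun k => (tnth y k, tnth y3 k)])).
  move=> [c z] _; rewrite /mk_outcome /=; congr (_, _); apply/ffunP => i;
    rewrite ffunE !tnth_mktuple.
    by case: (c i) => [[[? ?] ?] ?].
  by case: (z i).
move=> [[[[[s1 s2] w] w3] y] y3] _; rewrite /mk_outcome /=.
by do !congr (_, _); apply: eq_from_tnth => i; rewrite tnth_mktuple ffunE.
Qed.

Definition field pad (c : {ffun 'I_m -> aS}) (b : 'I_B.+1) : blk aS :=
  [ffun j => merge slot c pad (b, j)].

Lemma b1_field pad (c : {ffun 'I_m -> aS}) b :
  b1 pad [tuple (c i).1.1.1 | i < m] b = fS1 (field pad c b).
Proof.
apply/ffunP => j; rewrite !ffunE (merge_map slot (fun o : aS => o.1.1.1)).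
by rewrite /merge; case: pickP => [i _|_]; rewrite ?tnth_mktuple ?ffunE.
Qed.

Lemma b2_field pad (c : {ffun 'I_m -> aS}) b :
  b2 pad [tuple (c i).1.1.2 | i < m] b = fS2 (field pad c b).
Proof.
apply/ffunP => j; rewrite !ffunE (merge_map slot (fun o : aS => o.1.1.2)).
by rewrite /merge; case: pickP => [i _|_]; rewrite ?tnth_mktuple ?ffunE.
Qed.

Lemma bw_field pad (c : {ffun 'I_m -> aS}) b :
  bw pad [tuple (c i).1.2 | i < m] b = fW (field pad c b).
Proof.
apply/ffunP => j; rewrite !ffunE (merge_map slot (fun o : aS => o.1.2)).
by rewrite /merge; case: pickP => [i _|_]; rewrite ?tnth_mktuple ?ffunE.
Qed.

Lemma bw3_field pad (c : {ffun 'I_m -> aS}) b :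
  bw3 pad [tuple (c i).2 | i < m] b = fW3 (field pad c b).
Proof.
apply/ffunP => j; rewrite !ffunE (merge_map slot (fun o : aS => o.2)).
by rewrite /merge; case: pickP => [i _|_]; rewrite ?tnth_mktuple ?ffunE.
Qed.

(** The channel driven by a relay that always knows the true previous pair: given the sources it is
    memoryless, without feedback. *)
Definition field_ch (f : 'I_B.+1 -> blk aS) : fdist R {ffun 'I_n -> aY * aY3} :=
  tab (fun k => ch (e1 (fS1 (f (kblk k))) (fS1 (f (prv (kblk k)))) (kidx k))
                   (e2 (fS2 (f (kblk k))) (fS2 (f (prv (kblk k)))) (kidx k))
                   (e3 (fS1 (f (prv (kblk k)))) (fS2 (f (prv (kblk k)))) (kidx k))).

Definition relay_wrong (o' o : blk aS) (z : out (aY * aY3)) : bool :=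
  rdec (fS1 o', fS2 o') (fW3 o) (fY3 z) != (fS1 o, fS2 o).

Definition dest_wrong (o' o : blk aS) (z : out (aY * aY3)) : bool :=
  ddec (fS1 o, fS2 o) (fW o') (fY z) != (fS1 o', fS2 o').

Definition zblk (z : {ffun 'I_n -> aY * aY3}) (b : 'I_B.+1) : out (aY * aY3) :=
  [ffun j => z (kpos b j)].

Lemma genie_error_field pad c z b :
  genie_error pad (mk_outcome c z) b =
  relay_wrong (field pad c (prv b)) (field pad c b) (zblk z b) ||
  dest_wrong (field pad c (prv b)) (field pad c b) (zblk z b).
Proof.
rewrite /genie_error /= /bpair !b1_field !b2_field bw_field bw3_field.
rewrite /relay_wrong /dest_wrong.
have -> : readout y30 [tuple (z k).2 | k < n] b = fY3 (zblk z b).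
  apply/ffunP => j; rewrite !ffunE -(tnth_nth y30 _ (kpos b j)) tnth_mktuple.
  by [].
have -> : readout y0 [tuple (z k).1 | k < n] b = fY (zblk z b).
  apply/ffunP => j; rewrite !ffunE -(tnth_nth y0 _ (kpos b j)) tnth_mktuple.
  by [].
by [].
Qed.

(** The actual and the idealised channel laws agree on every output without genie error. Both have
    mass 1, so they also give the set of genie errors the same probability. *)
Lemma markov_Pe_le pad :
  mabrc_Pe src ch (markov_code pad) <=
  Ex (tab (fun _ : 'I_m => src)) (fun c => Ex (field_ch (field pad c))
    (fun z => [exists b, genie_error pad (mk_outcome c z) b]%:R)).
Proof.
rewrite /mabrc_Pe big_mkcond sum_outcome /Ex; apply: ler_sum => c _.
pose act (z : {ffun 'I_n -> aY * aY3}) (k : 'I_n) :=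
  ch (e1 (fS1 (field pad c (kblk k))) (fS1 (field pad c (prv (kblk k)))) (kidx k))
     (e2 (fS2 (field pad c (kblk k))) (fS2 (field pad c (prv (kblk k)))) (kidx k))
     (relay_enc (markov_marc pad) (past k [tuple (z k).2 | k < n]) [tuple (c i).2 | i < m]).
have lawE z : block_law src ch (markov_code pad) (mk_outcome c z) =
    tab (fun _ : 'I_m => src) c * \prod_k act z k (z k).
  rewrite /block_law /mk_outcome tabE; congr (_ * _); apply: eq_bigr => i _.
    by rewrite !tnth_mktuple; case: (c i) => [[[? ?] ?] ?].
  rewrite !tnth_mktuple !b1_field !b2_field -surjective_pairing.
  by [].
have act_genie z : ~~ [exists b, genie_error pad (mk_outcome c z) b] ->
    \prod_k act z k (z k) = field_ch (field pad c) z.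
  move=> /existsPn ok; rewrite tabE; apply: eq_bigr => k _; rewrite /act.
  rewrite (relay_enc_genie ok) /ideal_x3 !b1_field !b2_field.
  by [].
have act_sum1 : \sum_z \prod_k act z k (z k) = 1.
  apply: (causal_sum1 (y0, y30) (p := fun k z => act z k)) => k z z' zz'.
  congr (ch _ _ _); congr relay_enc; apply: eq_from_tnth => j.
  by rewrite !tnth_mktuple zz' //; apply: ltn_ord j.
have act_ge0 z : 0 <= \prod_k act z k (z k).
  by apply: prodr_ge0 => k _; apply: fdist_ge0.
set g := fun z => [exists b, genie_error pad (mk_outcome c z) b].
have src0 := fdist_ge0 (tab (fun _ : 'I_m => src)) c.
apply: (@le_trans _ _ (tab (fun _ : 'I_m => src) c *
    \sum_z (\prod_k act z k (z k)) * (g z)%:R)).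
  rewrite mulr_sumr; apply: ler_sum => z _; rewrite mulrA -lawE.
  case: ifPn => [err|_]; last by rewrite mulr_ge0 // lawE mulr_ge0.
  suff -> : g z by rewrite mulr1.
  apply: contraTT err => /existsPn ok; exact: no_genie_no_error.
apply: ler_wpM2l => //.
have split_sum (p : {ffun 'I_n -> aY * aY3} -> R) : \sum_z p z = 1 ->
    \sum_z p z * (g z)%:R = 1 - \sum_z p z * (~~ g z)%:R.
  move=> p1; apply/esym/eqP; rewrite -[X in X - _]p1 subr_eq -big_split /=; apply/eqP.
  by apply: eq_bigr => z _; case: (g z); rewrite ?mulr1 ?mulr0 ?addr0 ?add0r.
rewrite split_sum // split_sum ?fdist_sum1 // lerD2l lerN2.
apply: ler_sum => z _; case: (boolP (g z)) => [_|/act_genie->]; first by rewrite !mulr0.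
by [].
Qed.

Lemma Ex_field2 (b b' : 'I_B.+1) (F : blk aS -> blk aS -> R) : b' != b ->
  Ex (tab (fun _ : pos => src)) (fun f => F [ffun j => f (b', j)] [ffun j => f (b, j)]) =
  Ex (tab (fun _ : 'I_M => src)) (fun o' => Ex (tab (fun _ : 'I_M => src)) (F o')).
Proof.
move=> bb'.
rewrite -(Ex_tab_plus (fun _ : 'I_M + 'I_M => src) F).
pose phi (j : 'I_M + 'I_M) : pos := match j with inl j => (b', j) | inr j => (b, j) end.
have phiI : injective phi.
  move=> [j|j] [j'|j'] //= []; [by move=> -> | | | by move=> ->].
    by move=> e; rewrite e eqxx in bb'.
  by move=> e; rewrite e eqxx in bb'.
rewrite -(Ex_tab_sub (fun _ : pos => src) _ phiI).
by apply: eq_Ex => f _; congr F; apply/ffunP => j; rewrite !ffunE.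
Qed.

Lemma Ex_field_ch (f : 'I_B.+1 -> blk aS) (b : 'I_B.+1) (H : out (aY * aY3) -> R) :
  Ex (field_ch f) (fun z => H (zblk z b)) =
  Ex (blk_ch (e1 (fS1 (f b)) (fS1 (f (prv b)))) (e2 (fS2 (f b)) (fS2 (f (prv b))))
    (e3 (fS1 (f (prv b))) (fS2 (f (prv b))))) H.
Proof.
rewrite (Ex_tab_sub _ H (@kpos_inj b)); apply: eq_tab => j /=.
by rewrite kblk_kpos kidx_kpos.
Qed.

(** Averaged over pads, source letters and pad form one i.i.d. field, in which a block and its
    cyclic predecessor are independent. Hence the union bound adds [B + 1] equal terms. *)
Lemma markov_average :
  Ex (tab (fun _ : pos => src)) (fun pad => mabrc_Pe src ch (markov_code pad)) <=
  B.+1%:R * (blk_relay_failure + blk_dest_failure).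
Proof.
pose err o' o z : R := (relay_wrong o' o z)%:R + (dest_wrong o' o z)%:R.
pose F (f : {ffun pos -> aS}) : R := \sum_b Ex (field_ch (fun b => [ffun j => f (b, j)]))
  (fun z => err [ffun j => f (prv b, j)] [ffun j => f (b, j)] (zblk z b)).
apply: (@le_trans _ _ (Ex (tab (fun _ : pos => src)) F)).
  rewrite -[leRHS](Ex_merge slot); apply: le_Ex => pad _.
  apply: (le_trans (markov_Pe_le pad)); apply: le_Ex => c _.
  rewrite /F -Ex_sum.
  have fieldE b : [ffun j => [ffun g => merge slot c pad g] (b, j)] = field pad c b.
    by apply/ffunP => j; rewrite !ffunE.
  rewrite [leRHS](@eq_tab _ _ _ _ (fun k =>
    ch (e1 (fS1 (field pad c (kblk k))) (fS1 (field pad c (prv (kblk k)))) (kidx k))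
       (e2 (fS2 (field pad c (kblk k))) (fS2 (field pad c (prv (kblk k)))) (kidx k))
       (e3 (fS1 (field pad c (prv (kblk k)))) (fS2 (field pad c (prv (kblk k))))
         (kidx k)))) => [|k]; last by rewrite !fieldE.
  apply: le_Ex => z _.
  have [[b gb]|nb] := existsP; last first.
    by apply: sumr_ge0 => b _; rewrite addr_ge0.
  rewrite (bigD1 b) //= !fieldE ler_wpDr //.
    by apply: sumr_ge0 => b' _; rewrite addr_ge0.
  move: gb; rewrite genie_error_field /err.
  by case: relay_wrong; case: dest_wrong => //= _; rewrite ?addr0 ?add0r // lerDl ler01.
rewrite /F Ex_sum.
rewrite (eq_bigr (fun _ => blk_relay_failure + blk_dest_failure)) => [|b _].
  by rewrite sumr_const card_ord mulr_natl.
under eq_Ex => f _ do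
  rewrite (Ex_field_ch (fun b => [ffun j => f (b, j)]) b
    (err [ffun j => f (prv b, j)] [ffun j => f (b, j)])).
rewrite (Ex_field2 (fun o' o => Ex (blk_ch (e1 (fS1 o) (fS1 o'))
  (e2 (fS2 o) (fS2 o')) (e3 (fS1 o') (fS2 o'))) (err o' o)) (prv_neq b)).
rewrite /blk_relay_failure /blk_dest_failure.
rewrite -ExD; apply: eq_Ex => o' _; rewrite -ExD; apply: eq_Ex => o _.
by rewrite -ExD.
Qed.

Lemma markov_exists (eps : R) : B.+1%:R * (blk_relay_failure + blk_dest_failure) < eps ->
  exists c : mabrc_code aS1 aS2 aW aW3 aX1 aX2 aX3 aY aY3 m n, mabrc_Pe src ch c < eps.
Proof.
move=> /(le_lt_trans markov_average)/Ex_exists[pad Pe].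
by exists (markov_code pad).
Qed.

End BlockMarkov.

(** * Threshold tests on blocks *)

Section Thresholds.
Context {R : realType}.

Lemma sum_prod_ffun (I A : finType) (g : I -> A -> R) :
  \sum_(u : {ffun I -> A}) \prod_i g i (u i) = \prod_i \sum_a g i a.
Proof. by rewrite bigA_distr_bigA. Qed.

(** Every coordinate outside the image is free and contributes [#|A|]: this is the cost of source
    letters that no codeword law uses. *)
Lemma sum_prod_sub (K J A : finType) (phi : K -> J) (g : K -> A -> R) : injective phi ->
  \sum_(u : {ffun J -> A}) \prod_k g k (u (phi k)) =
  #|A|%:R ^+ (#|J| - #|K|) * \prod_k \sum_a g k a.
Proof.
move=> phiI.
have := sum_ffun_sub (fun _ _ => 1) (fun d : {ffun K -> A} => \prod_k g k (d k)) phiI.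
rewrite (eq_bigr (fun u : {ffun J -> A} => \prod_k g k (u (phi k)))) => [->|u _]; last first.
  by rewrite big1 // mul1r; apply: eq_bigr => k _; rewrite ffunE.
congr (_ * _).
  rewrite (eq_bigr (fun _ => #|A|%:R)) => [|j _]; last by rewrite sumr_const.
  rewrite prodr_const; congr (_ ^+ _).
  rewrite -(card_codom phiI) -(cardC (mem (codom phi))) addKn.
  by apply: eq_card.
rewrite -sum_prod_ffun; apply: eq_bigr => d _.
by rewrite big1 // mul1r.
Qed.

Lemma mul_Ex_le (A : finType) (p : fdist R A) (w : R) (f y : A -> R) :
  (forall a, w * p a * f a <= y a) -> w * Ex p f <= \sum_a y a.
Proof.
by move=> H; rewrite mulr_sumr; apply: ler_sum => a _; rewrite mulrA.
Qed.

(** The mechanism of the tests: the coding probability of an accepted redraw is at most its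
    threshold, which can then be summed over all redraws. *)
Lemma threshold_le (w w' y : R) : w = w' -> 0 <= y -> w * (w' <= y)%R%:R <= y.
Proof. by move=> -> y0; case: (leP w' y) => [h|_]; rewrite /= ?mulr1 ?mulr0. Qed.

Lemma expR_opp_le (x : R) : - 2^-1 <= x -> expR (- x) <= 1 - x + 2 * x ^+ 2.
Proof.
move=> x_ge; have x1 : 0 < 1 + x by lra.
have sq0 : 0 <= 1 - x + 2 * x ^+ 2 by nra.
rewrite expRN -(ler_pM2l (expR_gt0 x)) mulfV ?gt_eqF ?expR_gt0 //.
apply: le_trans (ler_wpM2r sq0 (expR_ge1Dx x)).
have -> : (1 + x) * (1 - x + 2 * x ^+ 2) = 1 + x ^+ 2 * (1 + 2 * x) by ring.
by rewrite lerDl mulr_ge0 ?sqr_ge0 //; lra.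
Qed.

End Thresholds.

(** * Exponential moments under the coding law *)

Section ExperTheory.
Context {R : realType}.
Variables (Src I1 I2 V1 V2 Q X1 X2 X3 Z : finType).
Variables (ps : fdist R Src) (s1 : Src -> I1) (s2 : Src -> I2).
Variables (pV1 : fdist R V1) (pV2 : fdist R V2) (pQ : fdist R Q)
  (pX1 : I1 -> V1 -> Q -> fdist R X1) (pX2 : I2 -> V2 -> Q -> fdist R X2)
  (pX3 : V1 -> V2 -> fdist R X3) (ch : X1 -> X2 -> X3 -> fdist R Z).

Local Notation E := (exper ps s1 s2 pV1 pV2 pQ pX1 pX2 pX3 ch).
Local Notation wd := (word V1 V2 Q X1 X2 X3).

Definition esupp (o' o : Src) (c : wd) (z : Z) : Prop :=
  let: (v1, v2, q, x1, x2, x3) := c in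
  [/\ 0 < ps o' /\ 0 < ps o, 0 < pV1 v1 /\ 0 < pV2 v2, 0 < pQ q /\ 0 < pX1 (s1 o) v1 q x1,
      0 < pX2 (s2 o) v2 q x2 /\ 0 < pX3 v1 v2 x3 & 0 < ch x1 x2 x3 z].

Lemma le_exper_supp (F G : Src -> Src -> wd -> Z -> R) :
  (forall o' o c z, esupp o' o c z -> F o' o c z <= G o' o c z) -> E F <= E G.
Proof.
move=> FG; apply: le_Ex => o' ?; apply: le_Ex => o ?.
apply: le_Ex => v1 ?; apply: le_Ex => v2 ?; apply: le_Ex => q ?.
apply: le_Ex => x1 ?; apply: le_Ex => x2 ?; apply: le_Ex => x3 ?.
by apply: le_Ex => z ?; apply: FG.
Qed.

Lemma exper_cst (c : R) : E (fun _ _ _ _ => c) = c.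
Proof. by do 9 (apply: Ex_eq_cst => ?). Qed.

Lemma experZl (c : R) (F : Src -> Src -> wd -> Z -> R) :
  E (fun o' o w z => c * F o' o w z) = c * E F.
Proof.
rewrite /exper /ExW.
rewrite -ExZl; apply: eq_Ex => o' _.
rewrite -ExZl; apply: eq_Ex => o _.
rewrite -ExZl; apply: eq_Ex => v1 _.
rewrite -ExZl; apply: eq_Ex => v2 _.
rewrite -ExZl; apply: eq_Ex => q _.
rewrite -ExZl; apply: eq_Ex => x1 _.
rewrite -ExZl; apply: eq_Ex => x2 _.
rewrite -ExZl; apply: eq_Ex => x3 _.
by rewrite -ExZl; apply: eq_Ex => z _.
Qed.

(** A bounded variable of positive mean has an exponential moment below 1 for a small tilt [l], by
    the second-order bound [expR_opp_le]. The margin [g] is what later pays for the factor [rho] in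
    the thresholds. *)
Lemma exper_mgf (F : Src -> Src -> wd -> Z -> R) : 0 < E F ->
  exists2 l, 0 < l &
  exists2 g, 0 < g & E (fun o' o c z => expR (- (l * (F o' o c z - g)))) < 1.
Proof.
set mu := E F => mu_gt0.
(* A crude bound for [|F - g|]; summing all absolute values is possible because the alphabets are
   finite. *)
pose D := \sum_o' \sum_o \sum_(c : wd) \sum_z `|F o' o c z| + mu + 1.
have sum_ge0 : 0 <= \sum_o' \sum_o \sum_(c : wd) \sum_z `|F o' o c z|.
  by do 4 (apply: sumr_ge0 => ? _).
have FD o' o c z : `|F o' o c z| <= D - mu - 1.
  have -> : D - mu - 1 = \sum_o' \sum_o \sum_(c : wd) \sum_z `|F o' o c z|.
    by rewrite /D; ring.
  rewrite (bigD1 o') //= ler_wpDr //.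
    by do 4 (apply: sumr_ge0 => ? _).
  rewrite (bigD1 o) //= ler_wpDr //; first by do 3 (apply: sumr_ge0 => ? _).
  rewrite (bigD1 c) //= ler_wpDr //; first by do 2 (apply: sumr_ge0 => ? _).
  by rewrite (bigD1 z) //= ler_wpDr // sumr_ge0.
have D_gt0 : 1 <= D - mu by rewrite /D; lra.
(* The second-order term [2 * (l * D) ^+ 2] becomes [l * mu / 4] and the margin costs [l * mu / 2],
   which leaves [1 - l * mu / 4]. *)
pose l := mu / (8 * D ^+ 2); pose g := mu / 2.
have D2_gt0 : 0 < D ^+ 2 by rewrite exprn_gt0 //; lra.
have lD2 : l * (8 * D ^+ 2) = mu by rewrite /l divfK // gt_eqF //; lra.
have l_gt0 : 0 < l by rewrite /l divr_gt0 //; lra.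
exists l => //; exists g; first by rewrite /g; lra.
have xD o' o c z : `|F o' o c z - g| <= D.
  have := FD o' o c z; rewrite !ler_norml => /andP[? ?]; rewrite /g; apply/andP; split; lra.
have lD : l * D <= 2^-1.
  have : l * D * (8 * D) = mu by rewrite -lD2; ring.
  by nra.
have step : E (fun o' o c z => expR (- (l * (F o' o c z - g)))) <=
    E (fun o' o c z => (- l) * F o' o c z + (1 + l * g + 2 * (l * D) ^+ 2)).
  apply: le_exper => o' o c z; have := xD o' o c z; rewrite ler_norml => /andP[h1 h2].
  set x := l * (F o' o c z - g).
  have x1 : - (l * D) <= x by rewrite /x -mulrN ler_pM2l.
  have x2 : x <= l * D by rewrite /x ler_pM2l.
  have xx : x ^+ 2 <= (l * D) ^+ 2 by nra.
  apply: (le_trans (expR_opp_le _)); first by lra.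
  have -> : x = l * F o' o c z - l * g by rewrite /x; ring.
  move: xx; rewrite (_ : x = l * F o' o c z - l * g); last by rewrite /x; ring.
  by move=> ?; lra.
apply: (le_lt_trans step); rewrite experD experZl exper_cst -/mu.
have -> : 2 * (l * D) ^+ 2 = l * (l * (8 * D ^+ 2)) / 4 by field.
rewrite lD2 /g; nra.
Qed.

End ExperTheory.

(** * Blocks of independent letters and the Chernoff bound *)

Section BlockCoding.
Context {R : realType}.
Variables (aS1 aS2 aW aW3 aX1 aX2 aX3 aY aY3 aT aQ aV1 aV2 : finType).
Variables (src : fdist R (aS1 * aS2 * aW * aW3)%type)
  (ch : aX1 -> aX2 -> aX3 -> fdist R (aY * aY3)%type)
  (h1 : aS1 -> aT) (h2 : aS2 -> aT)
  (pQ : fdist R aQ) (pV1 : fdist R aV1) (pV2 : fdist R aV2)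
  (pX1 : aS1 -> aV1 -> aQ -> fdist R aX1)
  (pX2 : aS2 -> aV2 -> aQ -> fdist R aX2)
  (pX3 : aV1 -> aV2 -> fdist R aX3).

Local Notation aS := (aS1 * aS2 * aW * aW3)%type.
Local Notation wd := (word aV1 aV2 aQ aX1 aX2 aX3).
Local Notation Z := (aY * aY3)%type.

Definition src1 (o : aS) : aS1 := o.1.1.1.
Definition src2 (o : aS) : aS2 := o.1.1.2.

Definition exper1 : (aS -> aS -> wd -> Z -> R) -> R :=
  exper src src1 src2 pV1 pV2 pQ pX1 pX2 pX3 ch.

Definition supp1 : aS -> aS -> wd -> Z -> Prop :=
  esupp src src1 src2 pV1 pV2 pQ pX1 pX2 pX3 ch.

Section Block.
Variables (M N : nat) (inj : 'I_N -> 'I_M).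
Hypothesis injI : injective inj.

Local Notation blk A := {ffun 'I_M -> A}.
Local Notation out A := {ffun 'I_N -> A}.
Local Notation bwd := (word (out aV1) (out aV2) (out aQ) (out aX1) (out aX2) (out aX3)).

Definition bsrc : fdist R (blk aS) := tab (fun _ => src).
Definition bV1 : fdist R (out aV1) := tab (fun _ => pV1).
Definition bV2 : fdist R (out aV2) := tab (fun _ => pV2).
Definition bQ : fdist R (out aQ) := tab (fun _ => pQ).
Definition bX1 (i1 : blk aS1) (v1 : out aV1) (q : out aQ) : fdist R (out aX1) :=
  tab (fun j => pX1 (i1 (inj j)) (v1 j) (q j)).
Definition bX2 (i2 : blk aS2) (v2 : out aV2) (q : out aQ) : fdist R (out aX2) :=
  tab (fun j => pX2 (i2 (inj j)) (v2 j) (q j)).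
Definition bX3 (v1 : out aV1) (v2 : out aV2) : fdist R (out aX3) :=
  tab (fun j => pX3 (v1 j) (v2 j)).

Definition letter (c : bwd) (j : 'I_N) : wd :=
  let: (v1, v2, q, x1, x2, x3) := c in (v1 j, v2 j, q j, x1 j, x2 j, x3 j).

Definition experN : (blk aS -> blk aS -> bwd -> out Z -> R) -> R :=
  exper bsrc (@fS1 _ _ _ _ _) (@fS2 _ _ _ _ _) bV1 bV2 bQ bX1 bX2 bX3 (@blk_ch _ _ _ _ _ _ ch N).

(** Letters are independent under the coding law, and source letters outside the range of [inj]
    integrate out; the product is passed through the nested expectations one draw at a time. *)
Lemma experN_prod (g : aS -> aS -> wd -> Z -> R) :
  experN (fun o' o c z => \prod_j g (o' (inj j)) (o (inj j)) (letter c j) (z j)) =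
  exper1 g ^+ N.
Proof.
pose g1 o' o c := Ex (chw ch c) (g o' o c).
pose g2 o' o v1 v2 q x1 x2 := Ex (pX3 v1 v2) (fun x3 => g1 o' o (v1, v2, q, x1, x2, x3)).
pose g3 o' o v1 v2 q x1 := Ex (pX2 (src2 o) v2 q) (g2 o' o v1 v2 q x1).
pose g4 o' o v1 v2 q := Ex (pX1 (src1 o) v1 q) (g3 o' o v1 v2 q).
pose g5 o' o v1 v2 := Ex pQ (g4 o' o v1 v2).
pose g6 o' o v1 := Ex pV2 (g5 o' o v1).
pose g7 o' o := Ex pV1 (g6 o' o).
pose g8 o' := Ex src (g7 o').
transitivity (Ex bsrc (fun o' => \prod_j g8 (o' (inj j)))).
  apply: eq_Ex => o' _.
  transitivity (Ex bsrc (fun o => \prod_j g7 (o' (inj j)) (o (inj j)))).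
    apply: eq_Ex => o _.
    rewrite -Ex_tab_prod; apply: eq_Ex => v1 _.
    rewrite -Ex_tab_prod; apply: eq_Ex => v2 _.
    rewrite -Ex_tab_prod; apply: eq_Ex => q _.
    transitivity (Ex (bX1 (fS1 o) v1 q) (fun x1 =>
      \prod_j g3 (o' (inj j)) (o (inj j)) (v1 j) (v2 j) (q j) (x1 j))); last first.
      rewrite /bX1 (Ex_tab_prod _ (fun j => g3 (o' (inj j)) (o (inj j)) (v1 j) (v2 j) (q j))).
      by apply: eq_bigr => j _; rewrite ffunE.
    apply: eq_Ex => x1 _.
    transitivity (Ex (bX2 (fS2 o) v2 q) (fun x2 =>
      \prod_j g2 (o' (inj j)) (o (inj j)) (v1 j) (v2 j) (q j) (x1 j) (x2 j))); last first.
      rewrite /bX2 (Ex_tab_prod _ (fun j => g2 (o' (inj j)) (o (inj j)) (v1 j) (v2 j) (q j) (x1 j))).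
      by apply: eq_bigr => j _; rewrite ffunE.
    apply: eq_Ex => x2 _.
    rewrite -(Ex_tab_prod _ (fun j x3 => g1 (o' (inj j)) (o (inj j))
      (v1 j, v2 j, q j, x1 j, x2 j, x3))).
    apply: eq_Ex => x3 _.
    by rewrite -(Ex_tab_prod _ (fun j => g (o' (inj j)) (o (inj j))
      (v1 j, v2 j, q j, x1 j, x2 j, x3 j))).
  rewrite -(Ex_tab_prod (fun _ => src) (fun j => g7 (o' (inj j)))).
  rewrite -(Ex_tab_sub (fun _ => src) (fun c : out aS => \prod_j g7 (o' (inj j)) (c j)) injI).
  by apply: eq_Ex => o _; apply: eq_bigr => j _; rewrite ffunE.
transitivity (Ex (tab (fun _ : 'I_N => src)) (fun c => \prod_j g8 (c j))).
  rewrite -[RHS](Ex_tab_sub (fun _ => src) (fun c : out aS => \prod_j g8 (c j)) injI).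
  by apply: eq_Ex => o _; apply: eq_bigr => j _; rewrite ffunE.
by rewrite (Ex_tab_prod _ (fun _ => g8)) prodr_const card_ord.
Qed.

End Block.

Definition fails (r c : aS -> aS -> wd -> Z -> R) (rho : R) (M N : nat) (inj : 'I_N -> 'I_M)
    (o' o : {ffun 'I_M -> aS})
    (w : word {ffun 'I_N -> aV1} {ffun 'I_N -> aV2} {ffun 'I_N -> aQ}
              {ffun 'I_N -> aX1} {ffun 'I_N -> aX2} {ffun 'I_N -> aX3})
    (z : {ffun 'I_N -> Z}) : bool :=
  ~~ (\prod_j r (o' (inj j)) (o (inj j)) (letter w j) (z j) <=
      \prod_j (rho * c (o' (inj j)) (o (inj j)) (letter w j) (z j))).

(** On failure the product of [r] exceeds that of [rho * c]; if [rho >= expR (- g)], the product of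
    the tilted letters [psi] is then at least 1 and dominates the indicator. Its expectation is
    [exper1 psi] to the power [N]. Validity for every larger [rho] lets all tests share one
    threshold. *)
Lemma chernoff (r c : aS -> aS -> wd -> Z -> R) :
  (forall o' o w z, supp1 o' o w z -> 0 < r o' o w z /\ 0 < c o' o w z) ->
  0 < exper1 (fun o' o w z => ln (c o' o w z) - ln (r o' o w z)) ->
  exists2 rho0, 0 < rho0 < 1 & forall rho, rho0 <= rho ->
  forall M N (inj : 'I_N -> 'I_M), injective inj ->
  experN inj (fun o' o w z => (fails r c rho inj o' o w z)%:R) <= rho ^+ N.
Proof.
move=> pos /exper_mgf[l l0 [g g0 mgf]].
set psi := (fun o' o w z => expR (- (l * (ln (c o' o w z) - ln (r o' o w z) - g)))) in mgf.
exists (Num.max (exper1 psi) (expR (- g))).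
  by rewrite lt_max expR_gt0 orbT /= gt_max mgf expR_lt1 oppr_lt0 g0.
move=> rho; rewrite ge_max => /andP[psi_le rho_ge] M N inj injI.
have rho_gt0 : 0 < rho by apply: lt_le_trans rho_ge; apply: expR_gt0.
have psi_ge0 : 0 <= exper1 psi.
  by do 9 (apply: Ex_ge0 => ?); apply: expR_ge0.
apply: (@le_trans _ _ (exper1 psi ^+ N)); last by apply: lerXn2r; rewrite // nnegrE ltW.
rewrite -(experN_prod injI); apply: le_exper_supp => o' o w z supp.
have psi_prod_ge0 : 0 <= \prod_j psi (o' (inj j)) (o (inj j)) (letter w j) (z j).
  by apply: prodr_ge0 => j _; apply: expR_ge0.
rewrite /fails -ltNge; case: (ltP (\prod_j (rho * _)) _) => //= rc.
have posj j : 0 < r (o' (inj j)) (o (inj j)) (letter w j) (z j) /\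
    0 < c (o' (inj j)) (o (inj j)) (letter w j) (z j).
  apply: pos; move: w supp {rc psi_prod_ge0} => [[[[[v1 v2] q] x1] x2] x3].
  case=> -[/tab_gt0 s' /tab_gt0 s] [/tab_gt0 a1 /tab_gt0 a2] [/tab_gt0 a3 /tab_gt0 a4].
  case=> /tab_gt0 a5 /tab_gt0 a6 /tab_gt0 a7.
  have := a4 j; have := a5 j; rewrite !ffunE => b5 b4.
  by split; [split; [exact: s'|exact: s] | split; [exact: a1|exact: a2] |
    split; [exact: a3|exact: b4] | split; [exact: b5|exact: a6] | exact: a7].
rewrite /psi -expR_sum -expR0 ler_expR.
under eq_bigr do rewrite -mulrN.
rewrite -mulr_sumr; apply: mulr_ge0; first exact: ltW.
rewrite -ler_expR expR0 expR_sum.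
set rr := fun j => r (o' (inj j)) (o (inj j)) (letter w j) (z j).
set cc := fun j => c (o' (inj j)) (o (inj j)) (letter w j) (z j).
have -> : \prod_j expR (- (ln (cc j) - ln (rr j) - g)) =
    (\prod_j rr j) / \prod_j (expR (- g) * cc j).
  rewrite -prodf_div; apply: eq_bigr => j _.
  have [rj cj] := posj j.
  rewrite (_ : - _ = ln (rr j) - ln (cc j) + g); last by ring.
  rewrite expRD expRB !lnK ?posrE // expRN invfM invrK.
  by rewrite mulrA mulrAC.
have den_gt0 : 0 < \prod_j (expR (- g) * cc j).
  by apply: prodr_gt0 => j _; rewrite mulr_gt0 ?expR_gt0 //; have [] := posj j.
rewrite ler_pdivlMr // mul1r; apply: le_trans (ltW rc).
apply: ler_prod => j _; have [_ cj] := posj j.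
by rewrite mulr_ge0 ?expR_ge0 ?(ltW cj) //= ler_pM2r.
Qed.

(* [fresh1 .. fresh4]: coding probability of the components redrawn in the relay's error
   events (only s1 wrong; only s2 wrong; both wrong with the right, resp. wrong, common
   part). [fresh5 .. fresh7]: the same for the destination (only s1, only s2, both). *)
Definition fresh1 (s1 : aS1) (s2 : aS2) (w : wd) : R :=
  let: (v1, v2, q, x1, x2, x3) := w in pX1 s1 v1 q x1.
Definition fresh2 (s1 : aS1) (s2 : aS2) (w : wd) : R :=
  let: (v1, v2, q, x1, x2, x3) := w in pX2 s2 v2 q x2.
Definition fresh3 (s1 : aS1) (s2 : aS2) (w : wd) : R :=
  let: (v1, v2, q, x1, x2, x3) := w in pX1 s1 v1 q x1 * pX2 s2 v2 q x2.
Definition fresh4 (s1 : aS1) (s2 : aS2) (w : wd) : R :=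
  let: (v1, v2, q, x1, x2, x3) := w in pQ q * pX1 s1 v1 q x1 * pX2 s2 v2 q x2.
Definition fresh5 (s1 : aS1) (s2 : aS2) (w : wd) : R :=
  let: (v1, v2, q, x1, x2, x3) := w in pV1 v1 * pX1 s1 v1 q x1 * pX3 v1 v2 x3.
Definition fresh6 (s1 : aS1) (s2 : aS2) (w : wd) : R :=
  let: (v1, v2, q, x1, x2, x3) := w in pV2 v2 * pX2 s2 v2 q x2 * pX3 v1 v2 x3.
Definition fresh7 (s1 : aS1) (s2 : aS2) (w : wd) : R :=
  let: (v1, v2, q, x1, x2, x3) := w in
  pV1 v1 * pV2 v2 * pX1 s1 v1 q x1 * pX2 s2 v2 q x2 * pX3 v1 v2 x3.

(** * Accepted candidates and the existence of a good block code *)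

Section Tests.
Variables (c1 c2 c4 : aS1 -> aS2 -> wd -> aW3 -> aY3 -> R)
  (c3 : aT -> aS1 -> aS2 -> wd -> aW3 -> aY3 -> R)
  (c5 c6 c7 : aS1 -> aS2 -> aS1 -> aS2 -> wd -> aW -> aY -> R).
Hypotheses (c1_ge0 : forall s1 s2 w a b, 0 <= c1 s1 s2 w a b)
  (c2_ge0 : forall s1 s2 w a b, 0 <= c2 s1 s2 w a b)
  (c3_ge0 : forall t s1 s2 w a b, 0 <= c3 t s1 s2 w a b)
  (c4_ge0 : forall s1 s2 w a b, 0 <= c4 s1 s2 w a b)
  (c5_ge0 : forall s1 s2 s1' s2' w a b, 0 <= c5 s1 s2 s1' s2' w a b)
  (c6_ge0 : forall s1 s2 s1' s2' w a b, 0 <= c6 s1 s2 s1' s2' w a b)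
  (c7_ge0 : forall s1 s2 s1' s2' w a b, 0 <= c7 s1 s2 s1' s2' w a b).
Hypothesis c1_sum : forall s2 v1 v2 q x2 x3 a b,
  \sum_s1 \sum_x1 c1 s1 s2 (v1, v2, q, x1, x2, x3) a b <= 1.
Hypothesis c2_sum : forall s1 v1 v2 q x1 x3 a b,
  \sum_s2 \sum_x2 c2 s1 s2 (v1, v2, q, x1, x2, x3) a b <= 1.
Hypothesis c3_sum : forall t v1 v2 q x3 a b,
  \sum_s1 \sum_s2 \sum_x1 \sum_x2 c3 t s1 s2 (v1, v2, q, x1, x2, x3) a b <= 1.
Hypothesis c4_sum : forall v1 v2 x3 a b,
  \sum_s1 \sum_s2 \sum_q \sum_x1 \sum_x2 c4 s1 s2 (v1, v2, q, x1, x2, x3) a b <= 1.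
Hypothesis c5_sum : forall s1 s2 s2' v2 q x2 a b,
  \sum_s1' \sum_v1 \sum_x1 \sum_x3 c5 s1 s2 s1' s2' (v1, v2, q, x1, x2, x3) a b <= 1.
Hypothesis c6_sum : forall s1 s2 s1' v1 q x1 a b,
  \sum_s2' \sum_v2 \sum_x2 \sum_x3 c6 s1 s2 s1' s2' (v1, v2, q, x1, x2, x3) a b <= 1.
Hypothesis c7_sum : forall s1 s2 q a b,
  \sum_s1' \sum_s2' \sum_v1 \sum_v2 \sum_x1 \sum_x2 \sum_x3
    c7 s1 s2 s1' s2' (v1, v2, q, x1, x2, x3) a b <= 1.

Section BlockTests.
Variables (rho : R) (M N : nat) (inj : 'I_N -> 'I_M).
Hypotheses (injI : injective inj) (rho_gt0 : 0 < rho).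

Local Notation blk A := {ffun 'I_M -> A}.
Local Notation out A := {ffun 'I_N -> A}.
Local Notation bwd := (word (out aV1) (out aV2) (out aQ) (out aX1) (out aX2) (out aX3)).

Definition rblock_test (r : aS1 -> aS2 -> wd -> R) (c : aS1 -> aS2 -> wd -> aW3 -> aY3 -> R)
    (i1 : blk aS1) (i2 : blk aS2) (w : bwd) (a : blk aW3) (b : out aY3) : bool :=
  \prod_j r (i1 (inj j)) (i2 (inj j)) (letter w j) <=
  \prod_j (rho * c (i1 (inj j)) (i2 (inj j)) (letter w j) (a (inj j)) (b j)).

Definition dblock_test (r : aS1 -> aS2 -> wd -> R)
    (c : aS1 -> aS2 -> aS1 -> aS2 -> wd -> aW -> aY -> R)
    (i1 : blk aS1) (i2 : blk aS2) (i1' : blk aS1) (i2' : blk aS2) (w : bwd)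
    (a : blk aW) (b : out aY) : bool :=
  \prod_j r (i1 (inj j)) (i2 (inj j)) (letter w j) <=
  \prod_j (rho * c (i1 (inj j)) (i2 (inj j)) (i1' (inj j)) (i2' (inj j)) (letter w j)
                   (a (inj j)) (b j)).

(* Number of continuations of a pair of [N]-letter prefixes to [M] letters. *)
Let D : R := (#|aS1| * #|aS2|)%:R ^+ (M - N).

Hypotheses (aS1_gt0 : (0 < #|aS1|)%N) (aS2_gt0 : (0 < #|aS2|)%N).

Lemma prod_rho_le (f : 'I_N -> R) : (forall j, 0 <= f j) -> (forall j, f j <= 1) ->
  \prod_j (rho * f j) <= rho ^+ N.
Proof.
move=> f0 f1; rewrite -[N in leRHS]card_ord -prodr_const; apply: ler_prod => j _.
by rewrite mulr_ge0 ?(ltW rho_gt0) //= ler_piMr // ltW.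
Qed.

Lemma card1_le : #|aS1|%:R ^+ (M - N) <= D.
Proof.
rewrite /D lerXn2r ?nnegrE ?ler0n // ler_nat.
by rewrite leq_pmulr.
Qed.

Lemma card2_le : #|aS2|%:R ^+ (M - N) <= D.
Proof.
rewrite /D lerXn2r ?nnegrE ?ler0n // ler_nat.
by rewrite leq_pmull.
Qed.

(** The covered letters factor over [j], each with sum at most 1, and the uncovered ones are free.
    The bound uses the common factor [D], although only one transmitter's letters are summed, so
    that all tests have the same bound. *)
Lemma sum1_block_le (f : 'I_N -> aS1 -> R) : (forall j s, 0 <= f j s) ->
  (forall j, \sum_s f j s <= 1) ->
  \sum_(i1 : blk aS1) \prod_j (rho * f j (i1 (inj j))) <= D * rho ^+ N.
Proof.
move=> f0 f1; rewrite (sum_prod_sub (fun j s => rho * f j s)) // !card_ord.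
under eq_bigr do rewrite -mulr_sumr.
have fs0 j : 0 <= \sum_s f j s by apply: sumr_ge0.
apply: ler_pM; rewrite ?exprn_ge0 ?card1_le //; last exact: prod_rho_le.
by apply: prodr_ge0 => j _; rewrite mulr_ge0 // ltW.
Qed.

Lemma sum2_block_le (f : 'I_N -> aS2 -> R) : (forall j s, 0 <= f j s) ->
  (forall j, \sum_s f j s <= 1) ->
  \sum_(i2 : blk aS2) \prod_j (rho * f j (i2 (inj j))) <= D * rho ^+ N.
Proof.
move=> f0 f1; rewrite (sum_prod_sub (fun j s => rho * f j s)) // !card_ord.
under eq_bigr do rewrite -mulr_sumr.
have fs0 j : 0 <= \sum_s f j s by apply: sumr_ge0.
apply: ler_pM; rewrite ?exprn_ge0 ?card2_le //; last exact: prod_rho_le.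
by apply: prodr_ge0 => j _; rewrite mulr_ge0 // ltW.
Qed.

Lemma sum12_block_le (f : 'I_N -> aS1 -> aS2 -> R) : (forall j s1 s2, 0 <= f j s1 s2) ->
  (forall j, \sum_s1 \sum_s2 f j s1 s2 <= 1) ->
  \sum_(k : blk aS1 * blk aS2) \prod_j (rho * f j (k.1 (inj j)) (k.2 (inj j))) <=
  D * rho ^+ N.
Proof.
move=> f0 f1.
rewrite -(pair_bigA _ (fun (k1 : blk aS1) (k2 : blk aS2) => \prod_j (rho * f j (k1 (inj j)) (k2 (inj j))))) /=.
under eq_bigr => k1 _.
  rewrite (sum_prod_sub (fun j s => rho * f j (k1 (inj j)) s)) //.
  over.
rewrite -mulr_sumr (sum_prod_sub (fun j s => \sum_a rho * f j s a)) //.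
rewrite mulrA -exprMn -natrM !card_ord [(#|aS2| * _)%N]mulnC.
under [X in _ * X]eq_bigr => j _.
  rewrite (eq_bigr (fun s => rho * \sum_a f j s a)) => [|s _]; last by rewrite mulr_sumr.
  rewrite -mulr_sumr; over.
apply: ler_wpM2l; first by rewrite exprn_ge0.
by apply: prod_rho_le => // j; do 2 (apply: sumr_ge0 => ? _).
Qed.

Lemma rtest1_block_sum k2 v1 v2 q x2 x3 a b :
  \sum_k1 Ex (bX1 inj k1 v1 q) (fun z1 =>
    (rblock_test fresh1 c1 k1 k2 (v1, v2, q, z1, x2, x3) a b)%:R) <= D * rho ^+ N.
Proof.
apply: (@le_trans _ _ (\sum_(k1 : blk aS1) \prod_j (rho * \sum_x1
    c1 (k1 (inj j)) (k2 (inj j)) (v1 j, v2 j, q j, x1, x2 j, x3 j) (a (inj j)) (b j)))).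
  apply: ler_sum => k1 _; rewrite -[leLHS]mul1r.
  under [leRHS]eq_bigr do rewrite mulr_sumr.
  rewrite -sum_prod_ffun; apply: mul_Ex_le => z1; apply: threshold_le.
    by rewrite mul1r tabE.
  by apply: prodr_ge0 => j _; rewrite mulr_ge0 // ltW.
apply: (sum1_block_le (f := fun j s => \sum_x1 c1 s _ (_, _, _, x1, _, _) _ _)) => // j s.
exact: sumr_ge0.
Qed.

Lemma rtest2_block_sum k1 v1 v2 q x1 x3 a b :
  \sum_k2 Ex (bX2 inj k2 v2 q) (fun z2 =>
    (rblock_test fresh2 c2 k1 k2 (v1, v2, q, x1, z2, x3) a b)%:R) <= D * rho ^+ N.
Proof.
apply: (@le_trans _ _ (\sum_(k2 : blk aS2) \prod_j (rho * \sum_x2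
    c2 (k1 (inj j)) (k2 (inj j)) (v1 j, v2 j, q j, x1 j, x2, x3 j) (a (inj j)) (b j)))).
  apply: ler_sum => k2 _; rewrite -[leLHS]mul1r.
  under [leRHS]eq_bigr do rewrite mulr_sumr.
  rewrite -sum_prod_ffun; apply: mul_Ex_le => z2; apply: threshold_le.
    by rewrite mul1r tabE.
  by apply: prodr_ge0 => j _; rewrite mulr_ge0 // ltW.
apply: (sum2_block_le (f := fun j s => \sum_x2 c2 _ s (_, _, _, _, x2, _) _ _)) => // j s.
exact: sumr_ge0.
Qed.

Definition bh1 (i1 : blk aS1) : blk aT := [ffun j => h1 (i1 j)].
Definition bh2 (i2 : blk aS2) : blk aT := [ffun j => h2 (i2 j)].

(** With the common block fixed to [t], the conditioning value [h1 s1] of [c3] is the same letter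
    for all candidates, so the sum runs over one conditional law. *)
Lemma rtest3_block_sum t v1 v2 q x3 a b :
  \sum_(k : blk aS1 * blk aS2 | (bh1 k.1 == t) && (bh2 k.2 == t))
    Ex (bX1 inj k.1 v1 q) (fun z1 => Ex (bX2 inj k.2 v2 q) (fun z2 =>
    (rblock_test fresh3 (fun s1 => c3 (h1 s1) s1) k.1 k.2 (v1, v2, q, z1, z2, x3) a b)%:R))
  <= D * rho ^+ N.
Proof.
pose f j s1 s2 := \sum_x1 \sum_x2
  c3 (t (inj j)) s1 s2 (v1 j, v2 j, q j, x1, x2, x3 j) (a (inj j)) (b j).
have f0 j s1 s2 : 0 <= f j s1 s2 by do 2 (apply: sumr_ge0 => ? _).
apply: le_trans (sum12_block_le (f := f) f0 _) => [|j]; last exact: c3_sum.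
rewrite [leLHS]big_mkcond; apply: ler_sum => -[k1 k2] _ /=.
have p0 : 0 <= \prod_j (rho * f j (k1 (inj j)) (k2 (inj j))).
  by apply: prodr_ge0 => j _; rewrite mulr_ge0 // ltW.
case: ifP => // /andP[/eqP k1t _]; rewrite -[leLHS]mul1r /f.
under [leRHS]eq_bigr do rewrite mulr_sumr.
rewrite -sum_prod_ffun; apply: mul_Ex_le => z1.
under [leRHS]eq_bigr do rewrite mulr_sumr.
rewrite -sum_prod_ffun; apply: mul_Ex_le => z2.
have -> : rblock_test fresh3 (fun s1 => c3 (h1 s1) s1) k1 k2 (v1, v2, q, z1, z2, x3) a b =
    (\prod_j fresh3 (k1 (inj j)) (k2 (inj j)) (letter (v1, v2, q, z1, z2, x3) j) <=
     \prod_j (rho * c3 (t (inj j)) (k1 (inj j)) (k2 (inj j))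
       (letter (v1, v2, q, z1, z2, x3) j) (a (inj j)) (b j))).
  by congr (_ <= _); apply: eq_bigr => j _; rewrite -k1t ffunE.
apply: threshold_le.
  by rewrite mul1r !tabE -big_split.
by apply: prodr_ge0 => j _; rewrite mulr_ge0 // ltW.
Qed.

Lemma rtest4_block_sum v1 v2 x3 a b :
  \sum_(k : blk aS1 * blk aS2) Ex (bQ N) (fun r =>
    Ex (bX1 inj k.1 v1 r) (fun z1 => Ex (bX2 inj k.2 v2 r) (fun z2 =>
    (rblock_test fresh4 c4 k.1 k.2 (v1, v2, r, z1, z2, x3) a b)%:R)))
  <= D * rho ^+ N.
Proof.
pose f j s1 s2 := \sum_q \sum_x1 \sum_x2
  c4 s1 s2 (v1 j, v2 j, q, x1, x2, x3 j) (a (inj j)) (b j).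
have f0 j s1 s2 : 0 <= f j s1 s2 by do 3 (apply: sumr_ge0 => ? _).
apply: le_trans (sum12_block_le (f := f) f0 _) => [|j]; last exact: c4_sum.
apply: ler_sum => -[k1 k2] _ /=; rewrite -[leLHS]mul1r /f.
under [leRHS]eq_bigr do rewrite mulr_sumr.
rewrite -sum_prod_ffun; apply: mul_Ex_le => r.
under [leRHS]eq_bigr do rewrite mulr_sumr.
rewrite -sum_prod_ffun; apply: mul_Ex_le => z1.
under [leRHS]eq_bigr do rewrite mulr_sumr.
rewrite -sum_prod_ffun; apply: mul_Ex_le => z2.
apply: threshold_le.
  by rewrite mul1r !tabE -!big_split.
by apply: prodr_ge0 => j _; rewrite mulr_ge0 // ltW.
Qed.

Lemma dtest1_block_sum i1 i2 i2' v2 q x2 a b :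
  \sum_k1 Ex (bV1 N) (fun u1 => Ex (bX1 inj i1 u1 q) (fun z1 => Ex (bX3 u1 v2) (fun z3 =>
    (dblock_test fresh5 c5 i1 i2 k1 i2' (u1, v2, q, z1, x2, z3) a b)%:R))) <= D * rho ^+ N.
Proof.
pose f j s1' := \sum_v1 \sum_x1 \sum_x3 c5 (i1 (inj j)) (i2 (inj j)) s1' (i2' (inj j))
  (v1, v2 j, q j, x1, x2 j, x3) (a (inj j)) (b j).
have f0 j s1 : 0 <= f j s1 by do 3 (apply: sumr_ge0 => ? _).
apply: le_trans (sum1_block_le (f := f) f0 _) => [|j]; last exact: c5_sum.
apply: ler_sum => k1 _ /=; rewrite -[leLHS]mul1r /f.
under [leRHS]eq_bigr do rewrite mulr_sumr.
rewrite -sum_prod_ffun; apply: mul_Ex_le => u1.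
under [leRHS]eq_bigr do rewrite mulr_sumr.
rewrite -sum_prod_ffun; apply: mul_Ex_le => z1.
under [leRHS]eq_bigr do rewrite mulr_sumr.
rewrite -sum_prod_ffun; apply: mul_Ex_le => z3.
apply: threshold_le.
  by rewrite mul1r !tabE -!big_split.
by apply: prodr_ge0 => j _; rewrite mulr_ge0 // ltW.
Qed.

Lemma dtest2_block_sum i1 i2 i1' v1 q x1 a b :
  \sum_k2 Ex (bV2 N) (fun u2 => Ex (bX2 inj i2 u2 q) (fun z2 => Ex (bX3 v1 u2) (fun z3 =>
    (dblock_test fresh6 c6 i1 i2 i1' k2 (v1, u2, q, x1, z2, z3) a b)%:R))) <= D * rho ^+ N.
Proof.
pose f j s2' := \sum_v2 \sum_x2 \sum_x3 c6 (i1 (inj j)) (i2 (inj j)) (i1' (inj j)) s2'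
  (v1 j, v2, q j, x1 j, x2, x3) (a (inj j)) (b j).
have f0 j s2 : 0 <= f j s2 by do 3 (apply: sumr_ge0 => ? _).
apply: le_trans (sum2_block_le (f := f) f0 _) => [|j]; last exact: c6_sum.
apply: ler_sum => k2 _ /=; rewrite -[leLHS]mul1r /f.
under [leRHS]eq_bigr do rewrite mulr_sumr.
rewrite -sum_prod_ffun; apply: mul_Ex_le => u2.
under [leRHS]eq_bigr do rewrite mulr_sumr.
rewrite -sum_prod_ffun; apply: mul_Ex_le => z2.
under [leRHS]eq_bigr do rewrite mulr_sumr.
rewrite -sum_prod_ffun; apply: mul_Ex_le => z3.
apply: threshold_le.
  by rewrite mul1r !tabE -!big_split.
by apply: prodr_ge0 => j _; rewrite mulr_ge0 // ltW.
Qed.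

Lemma dtest3_block_sum i1 i2 q a b :
  \sum_(k : blk aS1 * blk aS2) Ex (bV1 N) (fun u1 => Ex (bV2 N) (fun u2 =>
    Ex (bX1 inj i1 u1 q) (fun z1 => Ex (bX2 inj i2 u2 q) (fun z2 => Ex (bX3 u1 u2) (fun z3 =>
    (dblock_test fresh7 c7 i1 i2 k.1 k.2 (u1, u2, q, z1, z2, z3) a b)%:R)))))
  <= D * rho ^+ N.
Proof.
pose f j s1' s2' := \sum_v1 \sum_v2 \sum_x1 \sum_x2 \sum_x3
  c7 (i1 (inj j)) (i2 (inj j)) s1' s2' (v1, v2, q j, x1, x2, x3) (a (inj j)) (b j).
have f0 j s1 s2 : 0 <= f j s1 s2 by do 5 (apply: sumr_ge0 => ? _).
apply: le_trans (sum12_block_le (f := f) f0 _) => [|j]; last exact: c7_sum.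
apply: ler_sum => -[k1 k2] _ /=; rewrite -[leLHS]mul1r /f.
under [leRHS]eq_bigr do rewrite mulr_sumr.
rewrite -sum_prod_ffun; apply: mul_Ex_le => u1.
under [leRHS]eq_bigr do rewrite mulr_sumr.
rewrite -sum_prod_ffun; apply: mul_Ex_le => u2.
under [leRHS]eq_bigr do rewrite mulr_sumr.
rewrite -sum_prod_ffun; apply: mul_Ex_le => z1.
under [leRHS]eq_bigr do rewrite mulr_sumr.
rewrite -sum_prod_ffun; apply: mul_Ex_le => z2.
under [leRHS]eq_bigr do rewrite mulr_sumr.
rewrite -sum_prod_ffun; apply: mul_Ex_le => z3.
apply: threshold_le.
  by rewrite mul1r !tabE -!big_split.
by apply: prodr_ge0 => j _; rewrite mulr_ge0 // ltW.
Qed.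

End BlockTests.

Definition rterm (c : aS1 -> aS2 -> wd -> aW3 -> aY3 -> R) (o' o : aS) (w : wd) (z : Z) : R :=
  c (src1 o) (src2 o) w o.2 z.2.

Definition dterm (c : aS1 -> aS2 -> aS1 -> aS2 -> wd -> aW -> aY -> R)
    (o' o : aS) (w : wd) (z : Z) : R :=
  c (src1 o) (src2 o) (src1 o') (src2 o') w o'.1.2 z.1.

Definition freshterm (r : aS1 -> aS2 -> wd -> R) (o' o : aS) (w : wd) (z : Z) : R :=
  r (src1 o) (src2 o) w.

Lemma rblock_failsE r c rho M N (inj : 'I_N -> 'I_M) o' o w z :
  fails (freshterm r) (rterm c) rho inj o' o w z =
  ~~ rblock_test rho inj r c (fS1 o) (fS2 o) w (fW3 o) (fY3 z).
Proof.
rewrite /fails /rblock_test; congr (~~ (_ <= _)); apply: eq_bigr => j _.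
  by rewrite !ffunE.
by rewrite !ffunE.
Qed.

Lemma dblock_failsE r c rho M N (inj : 'I_N -> 'I_M) o' o w z :
  fails (freshterm r) (dterm c) rho inj o' o w z =
  ~~ dblock_test rho inj r c (fS1 o) (fS2 o) (fS1 o') (fS2 o') w (fW o') (fY z).
Proof.
rewrite /fails /dblock_test; congr (~~ (_ <= _)); apply: eq_bigr => j _.
  by rewrite !ffunE.
by rewrite !ffunE.
Qed.

Lemma fresh_gt0 o' o w z : supp1 o' o w z ->
  [/\ 0 < freshterm fresh1 o' o w z, 0 < freshterm fresh2 o' o w z,
      0 < freshterm fresh3 o' o w z & 0 < freshterm fresh4 o' o w z] /\
  [/\ 0 < freshterm fresh5 o' o w z, 0 < freshterm fresh6 o' o w z
      & 0 < freshterm fresh7 o' o w z].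
Proof.
move: w => [[[[[v1 v2] q] x1] x2] x3] [_ [? ?] [? ?] [? ?] _].
by rewrite /freshterm /=; split; split; rewrite ?mulr_gt0.
Qed.

Hypothesis common_src : forall o, 0 < src o -> h1 (src1 o) = h2 (src2 o).
Hypothesis src_gt0 : exists o, 0 < src o.

Let c3' s1 := c3 (h1 s1) s1.
Let gain (r c : aS -> aS -> wd -> Z -> R) : R :=
  exper1 (fun o' o w z => ln (c o' o w z) - ln (r o' o w z)).

Hypothesis rterm_gt0 : forall o' o w z, supp1 o' o w z ->
  [/\ 0 < rterm c1 o' o w z, 0 < rterm c2 o' o w z,
      0 < rterm c3' o' o w z & 0 < rterm c4 o' o w z].
Hypothesis dterm_gt0 : forall o' o w z, supp1 o' o w z ->
  [/\ 0 < dterm c5 o' o w z, 0 < dterm c6 o' o w z & 0 < dterm c7 o' o w z].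
Hypothesis rgain : [/\ 0 < gain (freshterm fresh1) (rterm c1), 0 < gain (freshterm fresh2) (rterm c2),
  0 < gain (freshterm fresh3) (rterm c3') & 0 < gain (freshterm fresh4) (rterm c4)].
Hypothesis dgain : [/\ 0 < gain (freshterm fresh5) (dterm c5), 0 < gain (freshterm fresh6) (dterm c6)
  & 0 < gain (freshterm fresh7) (dterm c7)].

Lemma good_block_code : exists2 rho, 0 < rho < 1 &
  forall M N (inj : 'I_N -> 'I_M), injective inj ->
  exists (e1 : {ffun 'I_M -> aS1} -> {ffun 'I_M -> aS1} -> {ffun 'I_N -> aX1})
    (e2 : {ffun 'I_M -> aS2} -> {ffun 'I_M -> aS2} -> {ffun 'I_N -> aX2})
    (e3 : {ffun 'I_M -> aS1} -> {ffun 'I_M -> aS2} -> {ffun 'I_N -> aX3})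
    (rdec : {ffun 'I_M -> aS1} * {ffun 'I_M -> aS2} -> {ffun 'I_M -> aW3} ->
      {ffun 'I_N -> aY3} -> {ffun 'I_M -> aS1} * {ffun 'I_M -> aS2})
    (ddec : {ffun 'I_M -> aS1} * {ffun 'I_M -> aS2} -> {ffun 'I_M -> aW} ->
      {ffun 'I_N -> aY} -> {ffun 'I_M -> aS1} * {ffun 'I_M -> aS2}),
    blk_relay_failure src ch e1 e2 e3 rdec + blk_dest_failure src ch e1 e2 e3 ddec <
    15%:R * ((#|aS1| * #|aS2|)%:R ^+ (M - N) * rho ^+ N).
Proof.
have [g1 g2 g3 g4] := rgain; have [g5 g6 g7] := dgain.
have [|r1 /andP[r1_gt0 r1_lt1] ch1] := chernoff _ g1.
  by move=> o' o w z h; have [[]] := fresh_gt0 h; have [] := rterm_gt0 h.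
have [|r2 /andP[r2_gt0 r2_lt1] ch2] := chernoff _ g2.
  by move=> o' o w z h; have [[]] := fresh_gt0 h; have [] := rterm_gt0 h.
have [|r3 /andP[r3_gt0 r3_lt1] ch3] := chernoff _ g3.
  by move=> o' o w z h; have [[]] := fresh_gt0 h; have [] := rterm_gt0 h.
have [|r4 /andP[r4_gt0 r4_lt1] ch4] := chernoff _ g4.
  by move=> o' o w z h; have [[]] := fresh_gt0 h; have [] := rterm_gt0 h.
have [|r5 /andP[r5_gt0 r5_lt1] ch5] := chernoff _ g5.
  by move=> o' o w z h; have [_ []] := fresh_gt0 h; have [] := dterm_gt0 h.
have [|r6 /andP[r6_gt0 r6_lt1] ch6] := chernoff _ g6.
  by move=> o' o w z h; have [_ []] := fresh_gt0 h; have [] := dterm_gt0 h.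
have [|r7 /andP[r7_gt0 r7_lt1] ch7] := chernoff _ g7.
  by move=> o' o w z h; have [_ []] := fresh_gt0 h; have [] := dterm_gt0 h.
pose rho := Num.max r1 (Num.max r2 (Num.max r3 (Num.max r4 (Num.max r5 (Num.max r6 r7))))).
have rho_gt0 : 0 < rho by rewrite lt_max r1_gt0.
exists rho; first by rewrite rho_gt0 !gt_max r1_lt1 r2_lt1 r3_lt1 r4_lt1 r5_lt1 r6_lt1 r7_lt1.
move=> M N inj injI.
have /ch1 /(_ _ _ _ injI) {}ch1 : r1 <= rho by rewrite /rho !le_max lexx ?orbT.
have /ch2 /(_ _ _ _ injI) {}ch2 : r2 <= rho by rewrite /rho !le_max lexx ?orbT.
have /ch3 /(_ _ _ _ injI) {}ch3 : r3 <= rho by rewrite /rho !le_max lexx ?orbT.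
have /ch4 /(_ _ _ _ injI) {}ch4 : r4 <= rho by rewrite /rho !le_max lexx ?orbT.
have /ch5 /(_ _ _ _ injI) {}ch5 : r5 <= rho by rewrite /rho !le_max lexx ?orbT.
have /ch6 /(_ _ _ _ injI) {}ch6 : r6 <= rho by rewrite /rho !le_max lexx ?orbT.
have /ch7 /(_ _ _ _ injI) {}ch7 : r7 <= rho by rewrite /rho !le_max lexx ?orbT.
have [o0 _] := src_gt0.
have n1 : (0 < #|aS1|)%N by apply/card_gt0P; exists (src1 o0).
have n2 : (0 < #|aS2|)%N by apply/card_gt0P; exists (src2 o0).
set D : R := (#|aS1| * #|aS2|)%:R ^+ (M - N).
have D1 : 1 <= D by rewrite /D exprn_ege1 // ler1n muln_gt0 n1.
have bcommon (o : {ffun 'I_M -> aS}) : 0 < bsrc M o -> bh2 (fS2 o) = bh1 (fS1 o).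
  by move=> /tab_gt0 o_gt0; apply/ffunP => j; rewrite !ffunE -/(src2 _) -common_src.
have rfail := @relay_failure_le _ _ _ _ _ _ _ _ _ _ _ _ _ _ (bsrc M) _ _ (@fW3 _ _ _ _ _)
  (@bh1 M) (@bh2 M) (bV1 N) (bV2 N) (bQ N) (bX1 inj) (bX2 inj) (@bX3 N)
  (@blk_ch _ _ _ _ _ _ ch N) (@fY3 _ _ _)
  (rblock_test rho inj fresh1 c1) (rblock_test rho inj fresh2 c2)
  (rblock_test rho inj fresh3 c3') (rblock_test rho inj fresh4 c4)
  (D * rho ^+ N) (rho ^+ N) bcommon
  (rtest1_block_sum injI rho_gt0 n2) (rtest2_block_sum injI rho_gt0 n1)
  (rtest3_block_sum injI rho_gt0) (rtest4_block_sum injI rho_gt0).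
have dfail := @dest_failure_le _ _ _ _ _ _ _ _ _ _ _ _ _ _ (bsrc M) _ _ (@fW _ _ _ _ _)
  (@bh1 M) (@bh2 M) (bV1 N) (bV2 N) (bQ N) (bX1 inj) (bX2 inj) (@bX3 N)
  (@blk_ch _ _ _ _ _ _ ch N) (@fY _ _ _)
  (dblock_test rho inj fresh5 c5) (dblock_test rho inj fresh6 c6)
  (dblock_test rho inj fresh7 c7)
  (D * rho ^+ N) (rho ^+ N) bcommon
  (dtest1_block_sum injI rho_gt0 n2) (dtest2_block_sum injI rho_gt0 n1)
  (dtest3_block_sum injI rho_gt0).
have conv r c : experN inj (fun o' o w z => (fails (freshterm r) (rterm c) rho inj o' o w z)%:R) =
    experN inj (fun o' o w z => (~~ rblock_test rho inj r c (fS1 o) (fS2 o) w (fW3 o)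
      (fY3 z))%:R).
  by apply: eq_exper => o' o w z; rewrite rblock_failsE.
have convd r c : experN inj (fun o' o w z => (fails (freshterm r) (dterm c) rho inj o' o w z)%:R) =
    experN inj (fun o' o w z => (~~ dblock_test rho inj r c (fS1 o) (fS2 o) (fS1 o')
      (fS2 o') w (fW o') (fY z))%:R).
  by apply: eq_exper => o' o w z; rewrite dblock_failsE.
rewrite conv in ch1; rewrite conv in ch2; rewrite conv in ch3; rewrite conv in ch4.
rewrite convd in ch5; rewrite convd in ch6; rewrite convd in ch7.
have {}rfail := rfail ch1 ch2 ch3 ch4; have {}dfail := dfail ch5 ch6 ch7.
have rhoN_gt0 : 0 < rho ^+ N by rewrite exprn_gt0.
have rhoD : rho ^+ N <= D * rho ^+ N by rewrite ler_peMl // ltW.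
have total := lerD rfail dfail; rewrite -ExCD in total.
(* The bounds with constants 4 + 4 and 3 + 3 add up to at most [14 * (D * rho ^+ N)]; 15 makes the
   inequality strict. *)
have [|C] := ExC_exists (le_lt_trans total (_ : _ < 15%:R * (D * rho ^+ N))); first by lra.
exists (enc_x1 (@bh1 M) C), (enc_x2 (@bh2 M) C), (enc_x3 C).
by do 2 eexists; eassumption.
Qed.

End Tests.

End BlockCoding.

(** * Information densities *)

Section InformationDensity.
Context {R : realType} {Omega : finType}.
Variable P : fdist R Omega.

Lemma Ex_law (A : finType) (X : Omega -> A) (g : A -> R) :
  Ex P (fun o => g (X o)) = \sum_a law P X a * g a.
Proof.
rewrite /Ex (partition_big X predT) //=; apply: eq_bigr => a _.
by rewrite mulr_suml; apply: eq_bigr => o /eqP->.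
Qed.

Lemma law_ge0 (A : finType) (X : Omega -> A) a : 0 <= law P X a.
Proof. by apply: sumr_ge0 => o _; apply: fdist_ge0. Qed.

Lemma law_gt0 (A : finType) (X : Omega -> A) o : 0 < P o -> 0 < law P X (X o).
Proof.
move=> Po; rewrite /law (bigD1 o) //= ltr_wpDr //.
by apply: sumr_ge0 => o' _; apply: fdist_ge0.
Qed.

Lemma law_sum1 (A : finType) (X : Omega -> A) : \sum_a law P X a = 1.
Proof.
have := Ex_law X (fun=> 1); rewrite Ex_cst => ->.
by apply: eq_bigr => a _; rewrite mulr1.
Qed.

Lemma law_pair_suml (A B : finType) (X : Omega -> A) (Y : Omega -> B) b :
  \sum_a law P [% X, Y] (a, b) = law P Y b.
Proof.
rewrite [RHS]/law (partition_big X predT) //=; apply: eq_bigr => a _.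
by apply: eq_bigl => o; rewrite xpair_eqE andbC.
Qed.

Definition cond_law (A B : finType) (X : Omega -> A) (Y : Omega -> B) (a : A) (b : B) : R :=
  law P [% X, Y] (a, b) / law P Y b.

Lemma cond_law_ge0 (A B : finType) (X : Omega -> A) (Y : Omega -> B) a b :
  0 <= cond_law X Y a b.
Proof. by rewrite divr_ge0 ?law_ge0. Qed.

Lemma cond_law_gt0 (A B : finType) (X : Omega -> A) (Y : Omega -> B) o :
  0 < P o -> 0 < cond_law X Y (X o) (Y o).
Proof. by move=> Po; rewrite divr_gt0 ?(law_gt0 Y) ?(law_gt0 [% X, Y]). Qed.

(** An inequality because division by 0 gives 0: the sum vanishes when [b] has probability 0. *)
Lemma cond_law_sum (A B : finType) (X : Omega -> A) (Y : Omega -> B) b :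
  \sum_a cond_law X Y a b <= 1.
Proof.
rewrite -mulr_suml law_pair_suml.
by have [->|l0] := eqVneq (law P Y b) 0; rewrite ?mul0r // divff.
Qed.

Lemma cond_law_sum2 (A A' B : finType) (X : Omega -> A) (X' : Omega -> A')
    (Y : Omega -> B) b :
  \sum_a \sum_a' cond_law [% X, X'] Y (a, a') b <= 1.
Proof.
apply: le_trans (cond_law_sum [% X, X'] Y b); rewrite pair_bigA /=.
by apply: ler_sum => -[a a'] _.
Qed.

Lemma ln2_gt0 : 0 < ln 2 :> R.
Proof. by rewrite ln_gt0 // ltr1n. Qed.

(** The factor [ln 2] passes from bits to natural logarithms, the unit of the exponential bounds. *)
Lemma cond_entropyE (A B : finType) (X : Omega -> A) (Y : Omega -> B) :
  ln 2 * cond_entropy P X Y = - Ex P (fun o => ln (cond_law X Y (X o) (Y o))).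
Proof.
rewrite (Ex_law [% X, Y] (fun ab => ln (cond_law X Y ab.1 ab.2))).
rewrite /cond_entropy mulrN pair_bigA /= mulr_sumr; congr (- _).
apply: eq_bigr => -[a b] _ /=; rewrite /log2 /cond_law mulrCA.
by congr (_ * _); rewrite mulrCA mulfV ?mulr1 // gt_eqF // ln2_gt0.
Qed.

(** From [ln x <= x - 1] at [x = q / law]. Total mass at most 1 is enough, which is all that
    reference laws built from [cond_law] provide. *)
Lemma gibbs (A : finType) (X : Omega -> A) (q : A -> R) :
  (forall a, 0 <= q a) -> \sum_a q a <= 1 -> (forall o, 0 < P o -> 0 < q (X o)) ->
  0 <= Ex P (fun o => ln (law P X (X o)) - ln (q (X o))).
Proof.
move=> q0 q1 qpos.
apply: (@le_trans _ _ (Ex P (fun o => 1 - q (X o) / law P X (X o)))).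
  rewrite (Ex_law X (fun a => 1 - q a / law P X a)).
  rewrite -(law_sum1 X) in q1; apply: le_trans (_ : 0 <= \sum_a (law P X a - q a)) _.
    by rewrite sumrB subr_ge0.
  apply: ler_sum => a _; have [->|l0] := eqVneq (law P X a) 0.
    by rewrite mul0r sub0r oppr_le0 q0.
  by rewrite mulrBr mulr1 mulrCA mulfV // mulr1.
apply: le_Ex => o Po; have l0 := law_gt0 X Po; have qo := qpos o Po.
rewrite -[leRHS]opprB lerNr opprB -ln_div ?posrE //.
have x0 : 0 < q (X o) / law P X (X o) by rewrite divr_gt0.
have := @le_ln1Dx R (q (X o) / law P X (X o) - 1).
by rewrite (addrC 1) subrK; apply; lra.
Qed.

(* No Markov property is needed: the slack is a relative entropy. *)
Lemma info_density_mean (AE AX AY AZ : finType) (E : Omega -> AE) (X : Omega -> AX)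
    (Y : Omega -> AY) (Z : Omega -> AZ) (r : AE -> AX -> AZ -> R) :
  (forall e x z, 0 <= r e x z) -> (forall z, \sum_e \sum_x r e x z <= 1) ->
  (forall o, 0 < P o -> 0 < r (E o) (X o) (Z o)) ->
  ln 2 * cond_mutual_info P X Y Z <=
  Ex P (fun o => ln (cond_law [% E, X] [% Y, Z] (E o, X o) (Y o, Z o))
                 - ln (r (E o) (X o) (Z o))).
Proof.
move=> r0 r1 rpos.
rewrite /cond_mutual_info mulrBr !cond_entropyE opprK -subr_ge0.
(* The comparison law: [Z] has its own law, [(E, X)] given [Z] follows [r], and [Y] depends on
   [(X, Z)] only. *)
pose q (a : AE * AX * (AY * AZ)) : R :=
  let: (e, x, (y, z)) := a in
  r e x z * law P Z z * law P [% X, [% Y, Z]] (x, (y, z)) / law P [% X, Z] (x, z).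
have q0 a : 0 <= q a.
  by case: a => -[e x] [y z]; rewrite /q divr_ge0 ?mulr_ge0 ?law_ge0.
have q1 : \sum_a q a <= 1.
  rewrite -(law_sum1 Z).
  have -> : \sum_a q a = \sum_z \sum_e \sum_x \sum_y q (e, x, (y, z)).
    rewrite sum_pair exchange_big /= sum_pair exchange_big /=.
    by apply: eq_bigr => z _; rewrite exchange_big /= sum_pair.
  apply: ler_sum => z _.
  apply: (@le_trans _ _ (\sum_e \sum_x r e x z * law P Z z)); last first.
    under eq_bigr do rewrite -mulr_suml.
    by rewrite -mulr_suml ler_piMl // law_ge0.
  apply: ler_sum => e _; apply: ler_sum => x _; rewrite /q -mulr_suml -mulr_sumr.
  have -> : \sum_y law P [% X, [% Y, Z]] (x, (y, z)) = law P [% X, Z] (x, z).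
    rewrite -(law_pair_suml Y [% X, Z]); apply: eq_bigr => y _.
    by apply: eq_bigl => o; rewrite !xpair_eqE andbCA.
  have [->|l0] := eqVneq (law P [% X, Z] (x, z)) 0.
    by rewrite !mulr0 ?invr0 ?mulr0 mulr_ge0 // law_ge0.
  by rewrite mulfK.
have qpos o : 0 < P o -> 0 < q ([% E, X, [% Y, Z]] o).
  move=> Po; rewrite /q /= divr_gt0 ?mulr_gt0 ?rpos //.
  - exact: (law_gt0 Z).
  - exact: (law_gt0 [% X, [% Y, Z]]).
  - exact: (law_gt0 [% X, Z]).
rewrite opprD opprK addrA -ExN -!ExD.
apply: le_trans (gibbs q0 q1 qpos) _; apply: le_Ex => o Po.
have l1 := law_gt0 [% [% E, X], [% Y, Z]] Po.
have l2 := law_gt0 [% Y, Z] Po.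
have l3 := law_gt0 [% X, Z] Po.
have l4 := law_gt0 Z Po.
have l5 := law_gt0 [% X, [% Y, Z]] Po.
have l6 := rpos o Po.
rewrite /q /cond_law /= !ln_div ?posrE ?mulr_gt0 //.
rewrite !lnM ?posrE ?mulr_gt0 //.
by rewrite /rv_pair in l1 l2 l3 l4 l5 *; lra.
Qed.

End InformationDensity.

(** * The single-letter coding law and the given random variables *)

Section SingleLetter.
Context {R : realType}.
Variables (aS1 aS2 aW aW3 aX1 aX2 aX3 aY aY3 aT aQ aV1 aV2 : finType).
Variables (src : fdist R (aS1 * aS2 * aW * aW3)%type)
  (ch : aX1 -> aX2 -> aX3 -> fdist R (aY * aY3)%type)
  (pQ : fdist R aQ) (pV1 : fdist R aV1) (pV2 : fdist R aV2)
  (pX1 : aS1 -> aV1 -> aQ -> fdist R aX1)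
  (pX2 : aS2 -> aV2 -> aQ -> fdist R aX2)
  (pX3 : aV1 -> aV2 -> fdist R aX3).
Variables (Omega : finType) (P : fdist R Omega)
  (S1 : Omega -> aS1) (S2 : Omega -> aS2) (W3 : Omega -> aW3) (W : Omega -> aW)
  (Q : Omega -> aQ) (V1 : Omega -> aV1) (X1 : Omega -> aX1)
  (V2 : Omega -> aV2) (X2 : Omega -> aX2) (X3 : Omega -> aX3)
  (Y3 : Omega -> aY3) (Y : Omega -> aY).
Hypothesis joint : forall s1 s2 w3 w q v1 x1 v2 x2 x3 y3 y,
  law P [% S1, S2, W3, W, Q, V1, X1, V2, X2, X3, Y3, Y]
        (s1, s2, w3, w, q, v1, x1, v2, x2, x3, y3, y) =
  src (s1, s2, w, w3) * pQ q * pV1 v1 * pX1 s1 v1 q x1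
  * pV2 v2 * pX2 s2 v2 q x2 * pX3 v1 v2 x3 * ch x1 x2 x3 (y, y3).

Local Notation aS := (aS1 * aS2 * aW * aW3)%type.
Local Notation wd := (word aV1 aV2 aQ aX1 aX2 aX3).
Local Notation Z := (aY * aY3)%type.
Local Notation E1 := (exper1 src ch pQ pV1 pV2 pX1 pX2 pX3).

Definition src_rv (o : Omega) : aS := (S1 o, S2 o, W o, W3 o).
Definition word_rv (o : Omega) : wd := (V1 o, V2 o, Q o, X1 o, X2 o, X3 o).
Definition out_rv (o : Omega) : Z := (Y o, Y3 o).

(** The bridge to the entropies: one current letter under the coding law has the joint law of the
    given variables, and the previous letter integrates out. *)
Lemma exper1_rv (G : aS -> wd -> Z -> R) :
  E1 (fun _ o w z => G o w z) = Ex P (fun o => G (src_rv o) (word_rv o) (out_rv o)).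
Proof.
rewrite /exper1 /exper Ex_cst.
pose wt (t : aS * wd * Z) : R :=
  let: (o, (v1, v2, q, x1, x2, x3), z) := t in
  src o * pV1 v1 * pV2 v2 * pQ q * pX1 (src1 o) v1 q x1 * pX2 (src2 o) v2 q x2 *
  pX3 v1 v2 x3 * ch x1 x2 x3 z.
transitivity (\sum_t wt t * G t.1.1 t.1.2 t.2).
  rewrite 2!sum_pair /=; apply: eq_bigr => o _.
  rewrite 5!sum_pair /= mul_ExE; apply: eq_bigr => v1 _.
  rewrite mul_ExE; apply: eq_bigr => v2 _.
  rewrite mul_ExE; apply: eq_bigr => q _.
  rewrite mul_ExE; apply: eq_bigr => x1 _.
  rewrite mul_ExE; apply: eq_bigr => x2 _.
  rewrite mul_ExE; apply: eq_bigr => x3 _.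
  by rewrite mul_ExE; apply: eq_bigr => z _.
pose U := [% S1, S2, W3, W, Q, V1, X1, V2, X2, X3, Y3, Y].
pose tr (u : aS1 * aS2 * aW3 * aW * aQ * aV1 * aX1 * aV2 * aX2 * aX3 * aY3 * aY) :
    aS * wd * Z :=
  let: (s1, s2, w3, w, q, v1, x1, v2, x2, x3, y3, y) := u in
  ((s1, s2, w, w3), (v1, v2, q, x1, x2, x3), (y, y3)).
rewrite (reindex tr) /=; last first.
  exists (fun t : aS * wd * Z =>
    let: ((s1, s2, w, w3), (v1, v2, q, x1, x2, x3), (y, y3)) := t in
    (s1, s2, w3, w, q, v1, x1, v2, x2, x3, y3, y)).
    by move=> [[[[[[[[[[[? ?] ?] ?] ?] ?] ?] ?] ?] ?] ?] ?] _.
  by move=> [[[[[? ?] ?] ?] [[[[[? ?] ?] ?] ?] ?]] [? ?]] _.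
rewrite (Ex_law P U (fun u => G (tr u).1.1 (tr u).1.2 (tr u).2)).
apply: eq_bigr => u _; congr (_ * _).
move: u => [[[[[[[[[[[s1 s2] w3] w] q] v1] x1] v2] x2] x3] y3] y].
by rewrite joint /wt /tr /src1 /src2 /=; ring.
Qed.

Lemma Ex_src_rv (G : aS -> R) : Ex src G = Ex P (fun o => G (src_rv o)).
Proof.
rewrite -(exper1_rv (fun o _ _ => G o)) /exper1 /exper Ex_cst.
by apply: eq_Ex => o _; apply/esym; do 7 (apply: Ex_eq_cst => ?).
Qed.

Lemma src_supp (o : aS) : 0 < src o -> exists2 u, 0 < P u & src_rv u = o.
Proof.
move=> o_gt0.
have : Ex src (fun a => (a == o)%:R) != 0.
  rewrite /Ex (bigD1 o) //= eqxx mulr1 gt_eqF // ltr_wpDr //.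
  by apply: sumr_ge0 => a _; rewrite mulr_ge0 ?fdist_ge0.
rewrite Ex_src_rv; case: (pickP (fun u => (0 < P u) && (src_rv u == o))) => [u /andP[Pu /eqP]|no].
  by exists u.
rewrite [Ex _ _](_ : _ = 0) ?eqxx //; apply: Ex_eq0 => u Pu.
by have := no u; rewrite Pu /= => ->.
Qed.

(** Two outcomes are needed: the previous letter is independent of the current one, while [P]
    describes a single letter. *)
Lemma joint_supp o' o w z : supp1 src ch pQ pV1 pV2 pX1 pX2 pX3 o' o w z ->
  (exists2 u, 0 < P u & src_rv u = o') /\
  exists2 u, 0 < P u & [/\ src_rv u = o, word_rv u = w & out_rv u = z].
Proof.
move: o w z => [[[s1 s2] w] w3] [[[[[v1 v2] q] x1] x2] x3] [y y3].
case=> -[/src_supp o'_ex o_gt0] [? ?] [? ?] [? ?] ?; split=> //.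
have : law P [% S1, S2, W3, W, Q, V1, X1, V2, X2, X3, Y3, Y]
    (s1, s2, w3, w, q, v1, x1, v2, x2, x3, y3, y) != 0.
  by rewrite joint gt_eqF // !mulr_gt0.
case: (pickP (fun u => (0 < P u) && ([% S1, S2, W3, W, Q, V1, X1, V2, X2, X3, Y3, Y] u ==
    (s1, s2, w3, w, q, v1, x1, v2, x2, x3, y3, y)))) => [u /andP[Pu /eqP]|no].
  case=> e1 e2 e3 e4 e5 e6 e7 e8 e9 e10 e11 e12 _; exists u => //.
  by rewrite /src_rv /word_rv /out_rv e1 e2 e3 e4 e5 e6 e7 e8 e9 e10 e11 e12.
rewrite /law big1 ?eqxx // => u /eqP Uu; have := no u; rewrite Uu eqxx andbT => /negbT.
by rewrite lt_neqAle fdist_ge0 andbT negbK eq_sym => /eqP.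
Qed.

End SingleLetter.

(** * Achievability *)

Section Achievability.
Context {R : realType}.
Variables (aS1 aS2 aW aW3 aX1 aX2 aX3 aY aY3 : finType).
Variables (src : fdist R (aS1 * aS2 * aW * aW3)%type)
  (ch : aX1 -> aX2 -> aX3 -> fdist R (aY * aY3)%type).

Lemma block_law_ge0 m n (c : marc_code aS1 aS2 aW aW3 aX1 aX2 aX3 aY aY3 m n) o :
  0 <= block_law src ch c o.
Proof.
move: o => [[[[[s1 s2] w] w3] y] y3].
by apply: mulr_ge0; apply: prodr_ge0 => i _; apply: fdist_ge0.
Qed.

Lemma marc_of_mabrc kappa : mabrc_achievable src ch kappa -> marc_achievable src ch kappa.
Proof.
move=> ach eps /ach[m0 H]; exists m0 => m /H[c Pe]; exists c; apply: le_lt_trans Pe.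
rewrite /marc_Pe /mabrc_Pe [leLHS]big_mkcond [leRHS]big_mkcond; apply: ler_sum => o _.
by case: dest_error => //=; case: ifP => // _; apply: block_law_ge0.
Qed.

(* With [N = K L] channel uses and [(K+1) L] source letters per block, and [K+1] data
   blocks in [K+2] channel blocks, the number [(K+1)^2 L] of source letters exceeds the
   number [K (K+2) L] of channel uses: the surplus pays for the last, empty block. *)
Lemma mabrc_achievable1 (a : nat) (rho : R) : 0 < rho < 1 -> (0 < a)%N ->
  inhabited aY -> inhabited aY3 ->
  (forall M N (inj : 'I_N -> 'I_M), injective inj ->
    exists (e1 : {ffun 'I_M -> aS1} -> {ffun 'I_M -> aS1} -> {ffun 'I_N -> aX1})
      (e2 : {ffun 'I_M -> aS2} -> {ffun 'I_M -> aS2} -> {ffun 'I_N -> aX2})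
      (e3 : {ffun 'I_M -> aS1} -> {ffun 'I_M -> aS2} -> {ffun 'I_N -> aX3})
      (rdec : {ffun 'I_M -> aS1} * {ffun 'I_M -> aS2} -> {ffun 'I_M -> aW3} ->
        {ffun 'I_N -> aY3} -> {ffun 'I_M -> aS1} * {ffun 'I_M -> aS2})
      (ddec : {ffun 'I_M -> aS1} * {ffun 'I_M -> aS2} -> {ffun 'I_M -> aW} ->
        {ffun 'I_N -> aY} -> {ffun 'I_M -> aS1} * {ffun 'I_M -> aS2}),
      blk_relay_failure src ch e1 e2 e3 rdec + blk_dest_failure src ch e1 e2 e3 ddec <
      15%:R * (a%:R ^+ (M - N) * rho ^+ N)) ->
  mabrc_achievable src ch 1.
Proof.
move=> rho01 a_gt0 [y0] [y30] good eps eps_gt0.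
have a0 : 0 < a%:R :> R by rewrite ltr0n.
have [|K0 HK] := exists_expr_lt (x := rho) (e := a%:R^-1 / 2) rho01; first by rewrite divr_gt0 ?invr_gt0.
(* [K] covered letters must outweigh the [a] values of one surplus letter pair; the successor
   ensures that blocks have positive length. *)
pose K := K0.+1.
have {}HK : a%:R * rho ^+ K <= 2^-1.
  by rewrite -ler_pdivlMl // ltW // HK // leqnSn.
have [||L0 HL] := exists_expr_lt (x := 2^-1) (e := eps / (K.+2%:R * 15%:R)); first by lra.
  by rewrite divr_gt0 // mulr_gt0.
pose A := (K.+1 * K.+1)%N.
(* [A <= m %/ A] yields [A <= L], so the [K * (K + 2) * L = (A - 1) * L] channel uses fit into
   [m >= A * (L - 1)]. [L0] controls the error. *)
exists (A * maxn A L0)%N => m m_gt.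
have trE : Num.truncn (1 * m%:R : R) = m by rewrite mul1r natrK.
rewrite trE.
pose L := (m %/ A).+1.
have A_gt0 : (0 < A)%N by [].
have L_ge : (maxn A L0 <= m %/ A)%N by rewrite leq_divRL // mulnC ltnW.
have LA : (A <= m %/ A)%N by apply: leq_trans L_ge; apply: leq_maxl.
have LL0 : (L0 <= L)%N by apply: leqW; apply: leq_trans L_ge; apply: leq_maxr.
have m_lt : (m < L * A)%N by apply: ltn_ceil.
have m_ge : (m %/ A * A <= m)%N by apply: leq_divM.
pose N := (K * L)%N; pose M := (K.+1 * L)%N.
have NM : (N <= M)%N by rewrite /N /M leq_mul2r leqnSn orbT.
have widenI : injective (widen_ord NM).
  by move=> i j /(congr1 val) /= ij; apply: val_inj.
have [e1 [e2 [e3 [rdec [ddec fail]]]]] := good M N (widen_ord NM) widenI.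
apply: (@markov_exists _ _ _ _ _ _ _ _ _ _ src ch y0 y30 m m K.+1 M N _ _ _ _ _
  e1 e2 e3 rdec ddec eps).
- by [].
- by rewrite /N muln_gt0.
- by rewrite /M muln_gt0.
- by rewrite /M mulnA -/A mulnC ltnW.
- by rewrite /N; rewrite /A /K in LA m_ge *; rewrite /L; nia.
have MN : (M - N)%N = L by rewrite /M /N -mulnBl subSnn mul1n.
have aL : a%:R ^+ (M - N) * rho ^+ N <= 2^-1 ^+ L.
  rewrite MN /N exprM -exprMn; apply: lerXn2r => //; rewrite nnegrE.
    by rewrite mulr_ge0 ?exprn_ge0 ?ltW //; case/andP: rho01.
  by lra.
have HLL := HL L LL0; rewrite ltr_pdivlMr ?mulr_gt0 // in HLL.
apply: le_lt_trans HLL.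
apply: le_trans (ler_wpM2l _ (ltW fail)) _ => //.
by rewrite [leRHS]mulrC -mulrA !ler_wpM2l.
Qed.

End Achievability.

(** * From rate inequalities to positive gains *)

Section DensityGain.
Context {R : realType} {Omega : finType}.
Variable P : fdist R Omega.
Variables (AE AX AY AZ AH BH : finType).
Variables (E : Omega -> AE) (X : Omega -> AX) (Y : Omega -> AY) (Z : Omega -> AZ)
  (H1 : Omega -> AH) (H2 : Omega -> BH).

(** The first expectation is minus the source entropy, the second at least the mutual information.
    They stay separate because they concern letters of different blocks. *)
Lemma dest_gain (r : AE -> AX -> AZ -> R) :
  (forall e x z, 0 <= r e x z) -> (forall z, \sum_e \sum_x r e x z <= 1) ->
  (forall o, 0 < P o -> 0 < r (E o) (X o) (Z o)) ->
  cond_entropy P H1 H2 < cond_mutual_info P X Y Z ->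
  0 < Ex P (fun o => ln (cond_law P H1 H2 (H1 o) (H2 o))) +
      Ex P (fun o => ln (cond_law P [% E, X] [% Y, Z] (E o, X o) (Y o, Z o))
                     - ln (r (E o) (X o) (Z o))).
Proof.
move=> r0 r1 rpos; rewrite -(ltr_pM2l ln2_gt0) cond_entropyE => HI.
by have := info_density_mean Y r0 r1 rpos; lra.
Qed.

(** Here the source letter is itself among the redrawn components, so the reference [r] contains the
    source law. Dividing by the coding probability [q] alone costs exactly the source entropy. *)
Lemma relay_gain (r : AE -> AX -> AZ -> R) (q : Omega -> R) :
  (forall e x z, 0 <= r e x z) -> (forall z, \sum_e \sum_x r e x z <= 1) ->
  (forall o, 0 < P o -> 0 < q o) ->
  (forall o, r (E o) (X o) (Z o) = q o * cond_law P H1 H2 (H1 o) (H2 o)) ->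
  cond_entropy P H1 H2 < cond_mutual_info P X Y Z ->
  0 < Ex P (fun o => ln (cond_law P [% E, X] [% Y, Z] (E o, X o) (Y o, Z o)) - ln (q o)).
Proof.
move=> r0 r1 q_gt0 rE HI.
have rpos o : 0 < P o -> 0 < r (E o) (X o) (Z o).
  by move=> Po; rewrite rE mulr_gt0 ?q_gt0 ?cond_law_gt0.
apply: lt_le_trans (dest_gain r0 r1 rpos HI) _; rewrite -ExD.
apply: le_Ex => o Po; rewrite rE lnM ?posrE ?q_gt0 ?cond_law_gt0 //.
lra.
Qed.

End DensityGain.

(** * The tests belonging to the seven rate inequalities *)

Section Main.
Context {R : realType}.
Variables (aS1 aS2 aW aW3 aX1 aX2 aX3 aY aY3 aT aQ aV1 aV2 : finType).
Variables (src : fdist R (aS1 * aS2 * aW * aW3)%type)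
  (ch : aX1 -> aX2 -> aX3 -> fdist R (aY * aY3)%type)
  (h1 : aS1 -> aT) (h2 : aS2 -> aT)
  (pQ : fdist R aQ) (pV1 : fdist R aV1) (pV2 : fdist R aV2)
  (pX1 : aS1 -> aV1 -> aQ -> fdist R aX1)
  (pX2 : aS2 -> aV2 -> aQ -> fdist R aX2)
  (pX3 : aV1 -> aV2 -> fdist R aX3).
Variables (Omega : finType) (P : fdist R Omega)
  (S1 : Omega -> aS1) (S2 : Omega -> aS2) (W3 : Omega -> aW3) (W : Omega -> aW)
  (Q : Omega -> aQ) (V1 : Omega -> aV1) (X1 : Omega -> aX1)
  (V2 : Omega -> aV2) (X2 : Omega -> aX2) (X3 : Omega -> aX3)
  (Y3 : Omega -> aY3) (Y : Omega -> aY).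
Hypothesis joint : forall s1 s2 w3 w q v1 x1 v2 x2 x3 y3 y,
  law P [% S1, S2, W3, W, Q, V1, X1, V2, X2, X3, Y3, Y]
        (s1, s2, w3, w, q, v1, x1, v2, x2, x3, y3, y) =
  src (s1, s2, w, w3) * pQ q * pV1 v1 * pX1 s1 v1 q x1
  * pV2 v2 * pX2 s2 v2 q x2 * pX3 v1 v2 x3 * ch x1 x2 x3 (y, y3).

Local Notation wd := (word aV1 aV2 aQ aX1 aX2 aX3).
Local Notation T := (h1 \o S1).

Let Z1 := [% S2, V1, X2, X3, W3, Q].
Let Z2 := [% S1, V2, X1, X3, W3, Q].
Let Z3 := [% V1, V2, X3, W3, T, Q].
Let Z4 := [% V1, V2, X3, W3].
Let Z5 := [% S1, V2, X2, Q].
Let Z6 := [% S2, V1, X1, Q].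
Let Z7 := [% S1, S2, Q].

(** Each [c] is the law of the redrawn letters given the relay output and everything the candidate
    keeps. In [c4] the letter of [Q] is redrawn, so it moves from the condition to the redrawn
    letters. *)
Let c1 s1 s2 (w : wd) a b : R := let: (v1, v2, q, x1, x2, x3) := w in
  cond_law P [% S1, X1] [% Y3, Z1] (s1, x1) (b, (s2, v1, x2, x3, a, q)).
Let c2 s1 s2 (w : wd) a b : R := let: (v1, v2, q, x1, x2, x3) := w in
  cond_law P [% S2, X2] [% Y3, Z2] (s2, x2) (b, (s1, v2, x1, x3, a, q)).
Let c3 t s1 s2 (w : wd) a b : R := let: (v1, v2, q, x1, x2, x3) := w in
  cond_law P [% [% S1, S2], [% X1, X2]] [% Y3, Z3] (s1, s2, (x1, x2))
    (b, (v1, v2, x3, a, t, q)).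
Let c4 s1 s2 (w : wd) a b : R := let: (v1, v2, q, x1, x2, x3) := w in
  cond_law P [% [% S1, S2, Q], [% X1, X2]] [% Y3, Z4] (s1, s2, q, (x1, x2))
    (b, (v1, v2, x3, a)).
Let d5 s1 (s2 : aS2) (w : wd) b : R := let: (v1, v2, q, x1, x2, x3) := w in
  cond_law P [% V1, [% X1, X3]] [% Y, Z5] (v1, (x1, x3)) (b, (s1, v2, x2, q)).
Let d6 (s1 : aS1) s2 (w : wd) b : R := let: (v1, v2, q, x1, x2, x3) := w in
  cond_law P [% V2, [% X2, X3]] [% Y, Z6] (v2, (x2, x3)) (b, (s2, v1, x1, q)).
Let d7 s1 s2 (w : wd) b : R := let: (v1, v2, q, x1, x2, x3) := w in
  cond_law P [% [% V1, V2], [% X1, X2, X3]] [% Y, Z7] (v1, v2, (x1, x2, x3)) (b, (s1, s2, q)).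
(** The source factors of the destination tests: posterior laws of letters of the previous block
    given its side information, while [d5], [d6], [d7] concern the current block. *)
Let p5 s1' s2' a := cond_law P S1 [% S2, W] s1' (s2', a).
Let p6 s1' s2' a := cond_law P S2 [% S1, W] s2' (s1', a).
Let p7 s1' s2' a := cond_law P [% S1, S2] W (s1', s2') a.
Let c5 s1 s2 s1' s2' w a b := p5 s1' s2' a * d5 s1 s2 w b.
Let c6 s1 s2 s1' s2' w a b := p6 s1' s2' a * d6 s1 s2 w b.
Let c7 s1 s2 s1' s2' w a b := p7 s1' s2' a * d7 s1 s2 w b.

Lemma c3_sum1 t v1 v2 q x3 a b :
  \sum_s1 \sum_s2 \sum_x1 \sum_x2 c3 t s1 s2 (v1, v2, q, x1, x2, x3) a b <= 1.
Proof.
apply: le_trans (cond_law_sum P [% [% S1, S2], [% X1, X2]] [% Y3, Z3]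
  (b, (v1, v2, x3, a, t, q))).
rewrite 2!sum_pair /=; do 2 (apply: ler_sum => ? _).
by rewrite sum_pair.
Qed.

Lemma c4_sum1 v1 v2 x3 a b :
  \sum_s1 \sum_s2 \sum_q \sum_x1 \sum_x2 c4 s1 s2 (v1, v2, q, x1, x2, x3) a b <= 1.
Proof.
apply: le_trans (cond_law_sum P [% [% S1, S2, Q], [% X1, X2]] [% Y3, Z4]
  (b, (v1, v2, x3, a))).
rewrite 3!sum_pair /=; do 3 (apply: ler_sum => ? _).
by rewrite sum_pair.
Qed.

Lemma c5_sum1 s1 s2 s2' v2 q x2 a b :
  \sum_s1' \sum_v1 \sum_x1 \sum_x3 c5 s1 s2 s1' s2' (v1, v2, q, x1, x2, x3) a b <= 1.
Proof.
apply: le_trans (cond_law_sum P S1 [% S2, W] (s2', a)); apply: ler_sum => s1' _.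
rewrite -[leRHS]mulr1.
apply: le_trans (ler_wpM2l (cond_law_ge0 _ _ _ _ _)
  (cond_law_sum P [% V1, [% X1, X3]] [% Y, Z5] (b, (s1, v2, x2, q)))).
rewrite sum_pair mulr_sumr; apply: ler_sum => v1 _.
rewrite sum_pair mulr_sumr; apply: ler_sum => x1 _.
by rewrite mulr_sumr.
Qed.

Lemma c6_sum1 s1 s2 s1' v1 q x1 a b :
  \sum_s2' \sum_v2 \sum_x2 \sum_x3 c6 s1 s2 s1' s2' (v1, v2, q, x1, x2, x3) a b <= 1.
Proof.
apply: le_trans (cond_law_sum P S2 [% S1, W] (s1', a)); apply: ler_sum => s2' _.
rewrite -[leRHS]mulr1.
apply: le_trans (ler_wpM2l (cond_law_ge0 _ _ _ _ _)
  (cond_law_sum P [% V2, [% X2, X3]] [% Y, Z6] (b, (s2, v1, x1, q)))).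
rewrite sum_pair mulr_sumr; apply: ler_sum => v2 _.
rewrite sum_pair mulr_sumr; apply: ler_sum => x2 _.
by rewrite mulr_sumr.
Qed.

Lemma c7_sum1 s1 s2 q a b :
  \sum_s1' \sum_s2' \sum_v1 \sum_v2 \sum_x1 \sum_x2 \sum_x3
    c7 s1 s2 s1' s2' (v1, v2, q, x1, x2, x3) a b <= 1.
Proof.
apply: le_trans (cond_law_sum P [% S1, S2] W a); rewrite sum_pair.
apply: ler_sum => s1' _; apply: ler_sum => s2' _.
rewrite -[leRHS]mulr1.
apply: le_trans (ler_wpM2l (cond_law_ge0 _ _ _ _ _)
  (cond_law_sum P [% [% V1, V2], [% X1, X2, X3]] [% Y, Z7] (b, (s1, s2, q)))).
rewrite 2!sum_pair mulr_sumr; apply: ler_sum => v1 _.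
rewrite mulr_sumr; apply: ler_sum => v2 _.
rewrite 2!sum_pair mulr_sumr; apply: ler_sum => x1 _.
rewrite mulr_sumr; apply: ler_sum => x2 _.
by rewrite mulr_sumr.
Qed.

Hypothesis common : common_function P S1 S2 h1 h2.
Hypotheses
  (relay1 : cond_entropy P S1 [% S2, W3] <
            cond_mutual_info P X1 Y3 [% S2, V1, X2, X3, W3, Q])
  (relay2 : cond_entropy P S2 [% S1, W3] <
            cond_mutual_info P X2 Y3 [% S1, V2, X1, X3, W3, Q])
  (relay12T : cond_entropy P [% S1, S2] [% W3, T] <
              cond_mutual_info P [% X1, X2] Y3 [% V1, V2, X3, W3, T, Q])
  (relay12 : cond_entropy P [% S1, S2] W3 <
             cond_mutual_info P [% X1, X2] Y3 [% V1, V2, X3, W3])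
  (dest1 : cond_entropy P S1 [% S2, W] <
           cond_mutual_info P [% X1, X3] Y [% S1, V2, X2, Q])
  (dest2 : cond_entropy P S2 [% S1, W] <
           cond_mutual_info P [% X2, X3] Y [% S2, V1, X1, Q])
  (dest12 : cond_entropy P [% S1, S2] W <
            cond_mutual_info P [% X1, X2, X3] Y [% S1, S2, Q]).

Local Notation Esupp := (supp1 src ch pQ pV1 pV2 pX1 pX2 pX3).
Local Notation E1 := (exper1 src ch pQ pV1 pV2 pX1 pX2 pX3).

Lemma rterms_gt0 o' o w z : Esupp o' o w z ->
  [/\ 0 < rterm c1 o' o w z, 0 < rterm c2 o' o w z,
      0 < rterm (fun s1 => c3 (h1 s1) s1) o' o w z & 0 < rterm c4 o' o w z].
Proof.
move=> /(joint_supp joint)[_ [u Pu [<- <- <-]]].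
split; rewrite /rterm /=.
- exact: (cond_law_gt0 [% S1, X1] [% Y3, Z1] Pu).
- exact: (cond_law_gt0 [% S2, X2] [% Y3, Z2] Pu).
- exact: (cond_law_gt0 [% [% S1, S2], [% X1, X2]] [% Y3, Z3] Pu).
- exact: (cond_law_gt0 [% [% S1, S2, Q], [% X1, X2]] [% Y3, Z4] Pu).
Qed.

Lemma priors_gt0 u : 0 < P u ->
  [/\ 0 < p5 (S1 u) (S2 u) (W u), 0 < p6 (S1 u) (S2 u) (W u) & 0 < p7 (S1 u) (S2 u) (W u)].
Proof.
move=> Pu; split.
- exact: (cond_law_gt0 S1 [% S2, W] Pu).
- exact: (cond_law_gt0 S2 [% S1, W] Pu).
- exact: (cond_law_gt0 [% S1, S2] W Pu).
Qed.

Lemma densities_gt0 u : 0 < P u -> let w := word_rv Q V1 X1 V2 X2 X3 u in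
  [/\ 0 < d5 (S1 u) (S2 u) w (Y u), 0 < d6 (S1 u) (S2 u) w (Y u) & 0 < d7 (S1 u) (S2 u) w (Y u)].
Proof.
move=> Pu; split.
- exact: (cond_law_gt0 [% V1, [% X1, X3]] [% Y, Z5] Pu).
- exact: (cond_law_gt0 [% V2, [% X2, X3]] [% Y, Z6] Pu).
- exact: (cond_law_gt0 [% [% V1, V2], [% X1, X2, X3]] [% Y, Z7] Pu).
Qed.

Lemma dterms_gt0 o' o w z : Esupp o' o w z ->
  [/\ 0 < dterm c5 o' o w z, 0 < dterm c6 o' o w z & 0 < dterm c7 o' o w z].
Proof.
move=> /(joint_supp joint)[[u' Pu' <-] [u Pu [<- <- <-]]].
have [? ? ?] := priors_gt0 Pu'; have [? ? ?] := densities_gt0 Pu.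
by split; rewrite /dterm /= mulr_gt0.
Qed.

Lemma factors_gt0 u : 0 < P u ->
  [/\ 0 < pQ (Q u), 0 < pV1 (V1 u), 0 < pV2 (V2 u), 0 < pX1 (S1 u) (V1 u) (Q u) (X1 u) &
      0 < pX2 (S2 u) (V2 u) (Q u) (X2 u) /\ 0 < pX3 (V1 u) (V2 u) (X3 u)].
Proof.
move=> /(law_gt0 [% S1, S2, W3, W, Q, V1, X1, V2, X2, X3, Y3, Y]).
rewrite [X in law _ _ X]/= joint => h.
have pos (a b : R) : 0 <= a -> 0 < a * b -> 0 < b.
  rewrite le_eqVlt => /orP[/eqP<-|a0]; first by rewrite mul0r ltxx.
  by rewrite pmulr_rgt0.
move: h; rewrite -!mulrA.
move/pos => /(_ (fdist_ge0 _ _)) h0.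
have posl (a b : R) : 0 <= a -> 0 < a * b -> 0 < a /\ 0 < b.
  by move=> a0 ab; have b0 := pos _ _ a0 ab; split; rewrite // -(pmulr_lgt0 _ b0).
have [? {}h0] := posl _ _ (fdist_ge0 _ _) h0.
have [? {}h0] := posl _ _ (fdist_ge0 _ _) h0.
have [? {}h0] := posl _ _ (fdist_ge0 _ _) h0.
have [? {}h0] := posl _ _ (fdist_ge0 _ _) h0.
have [? {}h0] := posl _ _ (fdist_ge0 _ _) h0.
by have [? _] := posl _ _ (fdist_ge0 _ _) h0.
Qed.

Lemma relay_gains :
  let gain r c := E1 (fun o' o w z => ln (c o' o w z) - ln (r o' o w z)) in
  [/\ 0 < gain (freshterm (fresh1 pX1)) (rterm c1),
      0 < gain (freshterm (fresh2 pX2)) (rterm c2),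
      0 < gain (freshterm (fresh3 pX1 pX2)) (rterm (fun s1 => c3 (h1 s1) s1)) &
      0 < gain (freshterm (fresh4 pQ pX1 pX2)) (rterm c4)].
Proof.
move=> gain.
have gainE r c : gain (freshterm r) (rterm c) = Ex P (fun u =>
    ln (c (S1 u) (S2 u) (word_rv Q V1 X1 V2 X2 X3 u) (W3 u) (Y3 u)) -
    ln (r (S1 u) (S2 u) (word_rv Q V1 X1 V2 X2 X3 u))).
  exact: (exper1_rv joint (fun o w z => ln (c (src1 o) (src2 o) w o.2 z.2) -
    ln (r (src1 o) (src2 o) w))).
split; rewrite gainE.
- apply: (@relay_gain _ _ P _ _ _ _ _ _ S1 X1 Y3 Z1 S1 [% S2, W3] (fun s1 x1 z =>
    let: (s2, v1, x2, x3, w3, q) := z in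
    pX1 s1 v1 q x1 * cond_law P S1 [% S2, W3] s1 (s2, w3))) => //.
  + by move=> s1 x1 [[[[[s2 v1] x2] x3] w3] q]; rewrite mulr_ge0 ?fdist_ge0 ?cond_law_ge0.
  + move=> [[[[[s2 v1] x2] x3] w3] q].
    under eq_bigr do rewrite -mulr_suml fdist_sum1 mul1r.
    exact: cond_law_sum.
  + by move=> u /factors_gt0[].
- apply: (@relay_gain _ _ P _ _ _ _ _ _ S2 X2 Y3 Z2 S2 [% S1, W3] (fun s2 x2 z =>
    let: (s1, v2, x1, x3, w3, q) := z in
    pX2 s2 v2 q x2 * cond_law P S2 [% S1, W3] s2 (s1, w3))) => //.
  + by move=> s2 x2 [[[[[s1 v2] x1] x3] w3] q]; rewrite mulr_ge0 ?fdist_ge0 ?cond_law_ge0.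
  + move=> [[[[[s1 v2] x1] x3] w3] q].
    under eq_bigr do rewrite -mulr_suml fdist_sum1 mul1r.
    exact: cond_law_sum.
  + by move=> u /factors_gt0[_ _ _ _ []].
- apply: (@relay_gain _ _ P _ _ _ _ _ _ [% S1, S2] [% X1, X2] Y3 Z3 [% S1, S2] [% W3, T]
    (fun s x z => let: (v1, v2, x3, w3, t, q) := z in
    pX1 s.1 v1 q x.1 * pX2 s.2 v2 q x.2 * cond_law P [% S1, S2] [% W3, T] s (w3, t))) => //.
  + by move=> s x [[[[[v1 v2] x3] w3] t] q]; rewrite mulr_ge0 ?cond_law_ge0 // !mulr_ge0 ?fdist_ge0.
  + move=> [[[[[v1 v2] x3] w3] t] q].
    apply: le_trans (cond_law_sum P [% S1, S2] [% W3, T] (w3, t)); apply: ler_sum => s _.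
    rewrite -mulr_suml sum_pair /=; under eq_bigr do rewrite fdist_sum_mul.
    by rewrite fdist_sum1 mul1r.
  + by move=> u /factors_gt0[_ _ _ ? [? _]]; rewrite /= mulr_gt0.
(* [Q] is redrawn but is placed in the [E] component, so that the resulting information is about
   [X1, X2] only, as in the fourth rate inequality. *)
- apply: (@relay_gain _ _ P _ _ _ _ _ _ [% S1, S2, Q] [% X1, X2] Y3 Z4 [% S1, S2] W3
    (fun s x z => let: (v1, v2, x3, w3) := z in
    pQ s.2 * pX1 s.1.1 v1 s.2 x.1 * pX2 s.1.2 v2 s.2 x.2 *
    cond_law P [% S1, S2] W3 s.1 w3)) => //.
  + by move=> s x [[[v1 v2] x3] w3]; rewrite mulr_ge0 ?cond_law_ge0 // !mulr_ge0 ?fdist_ge0.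
  + move=> [[[v1 v2] x3] w3].
    apply: le_trans (cond_law_sum P [% S1, S2] W3 w3); rewrite [leLHS]sum_pair.
    apply: ler_sum => s _ /=.
    under eq_bigr => q _.
      rewrite -mulr_suml sum_pair /=; under eq_bigr do rewrite fdist_sum_mul.
      rewrite fdist_sum_mul; over.
    by rewrite -mulr_suml fdist_sum1 mul1r.
  + by move=> u /factors_gt0[? _ _ ? [? _]]; rewrite /= !mulr_gt0.
Qed.

Lemma dest_gains :
  let gain r c := E1 (fun o' o w z => ln (c o' o w z) - ln (r o' o w z)) in
  [/\ 0 < gain (freshterm (fresh5 pV1 pX1 pX3)) (dterm c5),
      0 < gain (freshterm (fresh6 pV2 pX2 pX3)) (dterm c6) &
      0 < gain (freshterm (fresh7 pV1 pV2 pX1 pX2 pX3)) (dterm c7)].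
Proof.
move=> gain.
have gainE r p d : (forall u, 0 < P u -> 0 < p (S1 u) (S2 u) (W u)) ->
    (forall u, 0 < P u -> 0 < d (S1 u) (S2 u) (word_rv Q V1 X1 V2 X2 X3 u) (Y u)) ->
    Ex P (fun u => ln (p (S1 u) (S2 u) (W u))) + Ex P (fun u =>
      ln (d (S1 u) (S2 u) (word_rv Q V1 X1 V2 X2 X3 u) (Y u)) -
      ln (r (S1 u) (S2 u) (word_rv Q V1 X1 V2 X2 X3 u))) <=
    gain (freshterm r) (dterm (fun s1 s2 s1' s2' w a b => p s1' s2' a * d s1 s2 w b)).
  move=> p_gt0 d_gt0.
  rewrite -(exper1_rv joint (fun o w z => ln (d (src1 o) (src2 o) w z.1) -
    ln (r (src1 o) (src2 o) w))).
  rewrite -(Ex_src_rv joint (fun o => ln (p (src1 o) (src2 o) o.1.2))).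
  (* The source factor is evaluated on the previous letter [o'], which has the same law as the
     current one. *)
  have -> : Ex src (fun o => ln (p (src1 o) (src2 o) o.1.2)) =
      E1 (fun o' _ _ _ => ln (p (src1 o') (src2 o') o'.1.2)).
    by apply: eq_Ex => o' _; apply/esym; do 8 (apply: Ex_eq_cst => ?).
  rewrite /gain /exper1 -experD; apply: le_exper_supp => o' o w z.
  move=> /(joint_supp joint)[[u' Pu' <-] [u Pu [<- <- <-]]].
  rewrite /dterm /freshterm /= lnM ?posrE ?p_gt0 ?d_gt0 // addrA.
  exact: lexx.
split.
- apply: lt_le_trans (gainE (fresh5 pV1 pX1 pX3) p5 d5 _ _); last 2 first.
  + by move=> u /priors_gt0[].
  + by move=> u /densities_gt0[].
  (* The redrawn auxiliary letter [V1] enters as [E], hence it does not appear in the mutual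
     information. The other two tests treat [V2] and [(V1, V2)] in the same way. *)
  apply: (@dest_gain _ _ P _ _ _ _ _ _ V1 [% X1, X3] Y Z5 S1 [% S2, W] (fun v1 x z =>
    let: (s1, v2, x2, q) := z in pV1 v1 * pX1 s1 v1 q x.1 * pX3 v1 v2 x.2)) => //.
  + by move=> v1 x [[[s1 v2] x2] q]; rewrite !mulr_ge0 ?fdist_ge0.
  + move=> [[[s1 v2] x2] q]; rewrite -[leRHS](fdist_sum1 pV1); apply: ler_sum => v1 _.
    by rewrite sum_pair /=; under eq_bigr do rewrite fdist_sum_mul; rewrite fdist_sum_mul.
  + by move=> u /factors_gt0[_ ? _ ? [_ ?]]; rewrite /= !mulr_gt0.
- apply: lt_le_trans (gainE (fresh6 pV2 pX2 pX3) p6 d6 _ _); last 2 first.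
  + by move=> u /priors_gt0[].
  + by move=> u /densities_gt0[].
  apply: (@dest_gain _ _ P _ _ _ _ _ _ V2 [% X2, X3] Y Z6 S2 [% S1, W] (fun v2 x z =>
    let: (s2, v1, x1, q) := z in pV2 v2 * pX2 s2 v2 q x.1 * pX3 v1 v2 x.2)) => //.
  + by move=> v2 x [[[s2 v1] x1] q]; rewrite !mulr_ge0 ?fdist_ge0.
  + move=> [[[s2 v1] x1] q]; rewrite -[leRHS](fdist_sum1 pV2); apply: ler_sum => v2 _.
    by rewrite sum_pair /=; under eq_bigr do rewrite fdist_sum_mul; rewrite fdist_sum_mul.
  + by move=> u /factors_gt0[_ _ ? _ [? ?]]; rewrite /= !mulr_gt0.
- apply: lt_le_trans (gainE (fresh7 pV1 pV2 pX1 pX2 pX3) p7 d7 _ _); last 2 first.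
  + by move=> u /priors_gt0[].
  + by move=> u /densities_gt0[].
  apply: (@dest_gain _ _ P _ _ _ _ _ _ [% V1, V2] [% X1, X2, X3] Y Z7 [% S1, S2] W
    (fun v x z => let: (s1, s2, q) := z in
    pV1 v.1 * pV2 v.2 * pX1 s1 v.1 q x.1.1 * pX2 s2 v.2 q x.1.2 * pX3 v.1 v.2 x.2)) => //.
  + by move=> v x [[s1 s2] q]; rewrite !mulr_ge0 ?fdist_ge0.
  + move=> [[s1 s2] q]; rewrite -[leRHS](fdist_sum1 pV1) sum_pair /=.
    apply: ler_sum => v1 _; rewrite -[leRHS](fdist_sum_mul pV2).
    apply: ler_sum => v2 _; rewrite 2!sum_pair /=.
    under eq_bigr => x1 _.
      under eq_bigr do rewrite fdist_sum_mul.
      rewrite fdist_sum_mul; over.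
    by rewrite fdist_sum_mul.
  + by move=> u /factors_gt0[_ ? ? ? [? ?]]; rewrite /= !mulr_gt0.
Qed.

Lemma mabrc_achievable_of_joint : mabrc_achievable src ch 1.
Proof.
have [o0 P0] : exists o, 0 < P o.
  have [o Po|no] := pickP (fun o => 0 < P o); first by exists o.
  have := fdist_sum1 P; rewrite big1 => [/eqP|o _]; first by rewrite eq_sym oner_eq0.
  by have := fdist_ge0 P o; rewrite le_eqVlt (no o) orbF => /eqP.
have src_supp0 : exists o, 0 < src o.
  exists (src_rv S1 S2 W3 W o0); rewrite lt_neqAle fdist_ge0 andbT eq_sym.
  apply: contraTneq (law_gt0 [% S1, S2, W3, W, Q, V1, X1, V2, X2, X3, Y3, Y] P0) => z0.
  by rewrite /src_rv in z0; rewrite joint z0 !mul0r ltxx.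
have common_src o : 0 < src o -> h1 (src1 o) = h2 (src2 o).
  by move=> /(src_supp joint)[u Pu <-]; apply: common.
have c1_ge0 s1 s2 w a b : 0 <= c1 s1 s2 w a b.
  by move: w => [[[[[? ?] ?] ?] ?] ?]; apply: cond_law_ge0.
have c2_ge0 s1 s2 w a b : 0 <= c2 s1 s2 w a b.
  by move: w => [[[[[? ?] ?] ?] ?] ?]; apply: cond_law_ge0.
have c3_ge0 t s1 s2 w a b : 0 <= c3 t s1 s2 w a b.
  by move: w => [[[[[? ?] ?] ?] ?] ?]; apply: cond_law_ge0.
have c4_ge0 s1 s2 w a b : 0 <= c4 s1 s2 w a b.
  by move: w => [[[[[? ?] ?] ?] ?] ?]; apply: cond_law_ge0.
have c5_ge0 s1 s2 s1' s2' w a b : 0 <= c5 s1 s2 s1' s2' w a b.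
  by move: w => [[[[[? ?] ?] ?] ?] ?]; apply: mulr_ge0; apply: cond_law_ge0.
have c6_ge0 s1 s2 s1' s2' w a b : 0 <= c6 s1 s2 s1' s2' w a b.
  by move: w => [[[[[? ?] ?] ?] ?] ?]; apply: mulr_ge0; apply: cond_law_ge0.
have c7_ge0 s1 s2 s1' s2' w a b : 0 <= c7 s1 s2 s1' s2' w a b.
  by move: w => [[[[[? ?] ?] ?] ?] ?]; apply: mulr_ge0; apply: cond_law_ge0.
have c1_sum s2 v1 v2 q x2 x3 a b :
    \sum_s1 \sum_x1 c1 s1 s2 (v1, v2, q, x1, x2, x3) a b <= 1.
  exact: cond_law_sum2.
have c2_sum s1 v1 v2 q x1 x3 a b :
    \sum_s2 \sum_x2 c2 s1 s2 (v1, v2, q, x1, x2, x3) a b <= 1.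
  exact: cond_law_sum2.
have [rho rho01 good] := good_block_code c1_ge0 c2_ge0 c3_ge0 c4_ge0 c5_ge0 c6_ge0 c7_ge0
  c1_sum c2_sum c3_sum1 c4_sum1 c5_sum1 c6_sum1 c7_sum1
  common_src src_supp0 rterms_gt0 dterms_gt0 relay_gains dest_gains.
apply: (mabrc_achievable1 rho01 _ (inhabits (Y o0)) (inhabits (Y3 o0)) good).
by rewrite muln_gt0; apply/andP; split; apply/card_gt0P; [exists (S1 o0) | exists (S2 o0)].
Qed.

End Main.

Theorem theorem7 (R : realType)
  (* alphabets of the sources, side informations, channel and common part *)
  (aS1 aS2 aW aW3 aX1 aX2 aX3 aY aY3 aT : finType)
  (src : fdist R (aS1 * aS2 * aW * aW3)%type)
  (ch : aX1 -> aX2 -> aX3 -> fdist R (aY * aY3)%type)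
  (h1 : aS1 -> aT) (h2 : aS2 -> aT)
  (* auxiliary alphabets and factors of the joint distribution *)
  (aQ aV1 aV2 : finType)
  (pQ : fdist R aQ) (pV1 : fdist R aV1) (pV2 : fdist R aV2)
  (pX1 : aS1 -> aV1 -> aQ -> fdist R aX1)
  (pX2 : aS2 -> aV2 -> aQ -> fdist R aX2)
  (pX3 : aV1 -> aV2 -> fdist R aX3)
  (* random variables with that joint distribution *)
  (Omega : finType) (P : fdist R Omega)
  (S1 : Omega -> aS1) (S2 : Omega -> aS2) (W3 : Omega -> aW3) (W : Omega -> aW)
  (Q : Omega -> aQ) (V1 : Omega -> aV1) (X1 : Omega -> aX1)
  (V2 : Omega -> aV2) (X2 : Omega -> aX2) (X3 : Omega -> aX3)
  (Y3 : Omega -> aY3) (Y : Omega -> aY) (T : Omega -> aT)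
  (joint : forall s1 s2 w3 w q v1 x1 v2 x2 x3 y3 y,
     law P [% S1, S2, W3, W, Q, V1, X1, V2, X2, X3, Y3, Y]
           (s1, s2, w3, w, q, v1, x1, v2, x2, x3, y3, y) =
     src (s1, s2, w, w3) * pQ q * pV1 v1 * pX1 s1 v1 q x1
     * pV2 v2 * pX2 s2 v2 q x2 * pX3 v1 v2 x3 * ch x1 x2 x3 (y, y3))
  (common : common_part P S1 S2 h1 h2)
  (T_def : T = h1 \o S1)
  (relay1 : cond_entropy P S1 [% S2, W3] <
            cond_mutual_info P X1 Y3 [% S2, V1, X2, X3, W3, Q])
  (relay2 : cond_entropy P S2 [% S1, W3] <
            cond_mutual_info P X2 Y3 [% S1, V2, X1, X3, W3, Q])
  (relay12T : cond_entropy P [% S1, S2] [% W3, T] <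
              cond_mutual_info P [% X1, X2] Y3 [% V1, V2, X3, W3, T, Q])
  (relay12 : cond_entropy P [% S1, S2] W3 <
             cond_mutual_info P [% X1, X2] Y3 [% V1, V2, X3, W3])
  (dest1 : cond_entropy P S1 [% S2, W] <
           cond_mutual_info P [% X1, X3] Y [% S1, V2, X2, Q])
  (dest2 : cond_entropy P S2 [% S1, W] <
           cond_mutual_info P [% X2, X3] Y [% S2, V1, X1, Q])
  (dest12 : cond_entropy P [% S1, S2] W <
            cond_mutual_info P [% X1, X2, X3] Y [% S1, S2, Q]) :
  marc_achievable src ch 1 /\ mabrc_achievable src ch 1.
Proof.
have mabrc : mabrc_achievable src ch 1.
  move: T_def relay12T => -> relay12T'.
  by apply: (mabrc_achievable_of_joint joint (proj1 common)).
by split=> //; apply: marc_of_mabrc.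
Qed.
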